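(* Let $k$ be an algebraically closed field of characteristic $5$, let $\Gamma\subset\mathbb{P}^2$ be a $k$-Hermitian curve, let $\mathcal{Q}$ be the set of non-singular conics totally tangent to $\Gamma$, and let $\mathcal{D}$ be the set of connected components of the graph $G$ on $\mathcal{Q}$. Suppose that $Q\in\mathcal{Q}$ and $D'\in\mathcal{D}$ satisfy $Q\notin D'$. Then one of the following holds: $(\alpha)$ $|Q\cap Q'\cap\Gamma|$ equals $2$ for $3$ conics $Q'\in D'$, and $0$ for $18$ conics $Q'\in D'$. $(\beta)$ $|Q\cap Q'\cap\Gamma|$ equals $2$ for $1$ conic $Q'\in D'$, $1$ for $4$ conics $Q'\in D'$, and $0$ for $16$ conics $Q'\in D'$. $(\gamma)$ $|Q\cap Q'\cap\Gamma|$ equals $1$ for $6$ conics $Q'\in D'$, and $0$ for $15$ conics $Q'\in D'$.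
   Context: Work over an algebraically closed field $k$ of characteristic $5$. A $k$-Hermitian curve is a projective plane curve $\Gamma\subset\mathbb{P}^2$ of degree $6$ that is projectively isomorphic (via $\mathrm{PGL}_3(k)$) to the Fermat curve $\Gamma_5: x^6+y^6+z^6=0$. $\mathcal{P}$ denotes the set of Weierstrass points of $\Gamma$; equivalently, the set of points $P\in\Gamma$ whose tangent line meets $\Gamma$ at $P$ with intersection multiplicity $6$ (for $\Gamma=\Gamma_5$, the $\mathbb{F}_{25}$-rational points). One has $|\mathcal{P}|=126$. A line of $\mathbb{P}^2$ is a special secant line of $\Gamma$ if it passes through two distinct points of $\mathcal{P}$. A non-singular conic $Q\subset\mathbb{P}^2$ is totally tangent to $\Gamma$ if $Q$ meets $\Gamma$ at six distinct points, each with intersection multiplicity $2$. $\mathcal{Q}$ denotes the set of all such conics; one has $|\mathcal{Q}|=3150$ and $Q\cap\Gamma\subset\mathcal{P}$ for $Q\in\mathcal{Q}$. For $Q\in\mathcal{Q}$, $\mathcal{S}(Q)$ is the set of the $15$ special secant lines of $\Gamma$ passing through two distinct points of $Q\cap\Gamma$. $G$ is the graph with vertex set $\mathcal{Q}$ in which distinct $Q,Q'$ are adjacent if and only if $|Q\cap Q'|=4$ and $|\mathcal{S}(Q)\cap\mathcal{S}(Q')|=3$. $\mathcal{D}$ is the set of connected components of $G$ (there are $150$ of them); each $D\in\mathcal{D}$ is regarded as a subset of $\mathcal{Q}$, consisting of $21$ conics. *)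

(* Defs.v *)
From mathcomp Require Import all_boot all_order all_algebra.
From mathcomp Require Import mpoly.
From mathcomp Require Import boolp classical_sets functions cardinality.
From Stdlib Require Import Relation_Operators.

Set Implicit Arguments.
Unset Strict Implicit.
Unset Printing Implicit Defensive.

Import GRing.Theory.
Local Open Scope classical_set_scope.
Local Open Scope card_scope.
Local Open Scope ring_scope.

(* The projective plane over k: lines through the origin of k^3. *)
Definition proj_point (k : fieldType) : Type :=
  {L : {vspace 'rV[k]_3} | \dim L == 1%N}.

(* One choice of homogeneous coordinates; everything below evaluates only
   homogeneous polynomials, and only tests vanishing or scales linear forms,
   so nothing depends on the choice. *)
Definition hcoord (k : fieldType) (P : proj_point k) : 'I_3 -> k :=
  fun i => vpick (val P) 0 i.

Definition locus (k : fieldType) (F : {mpoly k[3]}) : set (proj_point k) :=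
  [set P | F.@[hcoord P] = 0].

(* Local ring O_P of the projective plane, inside the fraction field of
   k[X_0,X_1,X_2]: degree-0 fractions with denominator nonzero at P. *)
Definition local_ring (k : fieldType) (P : proj_point k) :
    set {fraction {mpoly k[3]}} :=
  [set x | exists d (a b : {mpoly k[3]}),
    [/\ a \is d.-homog, b \is d.-homog, b.@[hcoord P] != 0 &
        x = tofrac a / tofrac b]].

(* Ideal of O_P generated by the local equations at P of the curves with
   homogeneous equations F and G. *)
Definition local_ideal (k : fieldType) (P : proj_point k) (F G : {mpoly k[3]}) :
    set {fraction {mpoly k[3]}} :=
  [set x | exists d (a b : {mpoly k[3]}),
    [/\ a \is d.-homog, b \is d.-homog, b.@[hcoord P] != 0,
        exists u v : {mpoly k[3]}, a = u * F + v * G &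
        x = tofrac a / tofrac b]].

(* The intersection multiplicity dim_k O_P/(F,G) is n: the classes of some
   e_0, ..., e_(n-1) in O_P form a k-basis of the quotient. *)
Definition inter_mult_eq (k : fieldType) (P : proj_point k) (F G : {mpoly k[3]})
    (n : nat) : Prop :=
  exists e : 'I_n -> {fraction {mpoly k[3]}},
    (forall i, local_ring P (e i)) /\
    (forall x, local_ring P x ->
       exists! c : 'rV[k]_n,
         local_ideal P F G (x - \sum_(i < n) tofrac (c 0 i)%:MP * e i)).

Definition nonsingular (k : fieldType) (F : {mpoly k[3]}) : Prop :=
  forall P : proj_point k, locus F P -> exists i, F^`M(i).@[hcoord P] != 0.

Definition fermat6 (k : fieldType) : {mpoly k[3]} := \sum_(i < 3) 'X_i ^+ 6.

Definition linear_change (k : fieldType) (g : 'M[k]_3) (F : {mpoly k[3]}) :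
    {mpoly k[3]} :=
  F \mPo [tuple \sum_(j < 3) g i j *: 'X_j | i < 3].

(* F is an equation of a k-Hermitian curve. *)
Definition hermitian_curve (k : fieldType) (F : {mpoly k[3]}) : Prop :=
  exists (c : k) (g : 'M[k]_3),
    [/\ c != 0, g \in unitmx & F = c *: linear_change g (fermat6 k)].

Definition is_line (k : fieldType) (L : set (proj_point k)) : Prop :=
  exists l : {mpoly k[3]}, [/\ l \is 1.-homog, l != 0 & L = locus l].

Definition tangent_form (k : fieldType) (F : {mpoly k[3]}) (P : proj_point k) :
    {mpoly k[3]} :=
  \sum_(i < 3) F^`M(i).@[hcoord P] *: 'X_i.

(* On a k-Hermitian curve the Weierstrass points are exactly the points where
   the tangent line has the maximal contact order 6. *)
Definition weierstrass (k : fieldType) (F : {mpoly k[3]}) :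
    set (proj_point k) :=
  [set P | locus F P /\ inter_mult_eq P (tangent_form F P) F 6].

Definition joins_two (k : fieldType) (A L : set (proj_point k)) : Prop :=
  exists P P' : proj_point k, [/\ P <> P', A P, A P', L P & L P'].

Definition special_secant (k : fieldType) (F : {mpoly k[3]}) :
    set (set (proj_point k)) :=
  [set L | is_line L /\ joins_two (weierstrass F) L].

(* The non-singular conics totally tangent to F = 0, as sets of points. *)
Definition totally_tangent_conics (k : fieldType) (F : {mpoly k[3]}) :
    set (set (proj_point k)) :=
  [set Q | exists q : {mpoly k[3]},
    [/\ q \is 2.-homog, nonsingular q, Q = locus q,
        Q `&` locus F #= `I_6 &
        forall P, (Q `&` locus F) P -> inter_mult_eq P q F 2]].

Definition secants_of (k : fieldType) (F : {mpoly k[3]})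
    (Q : set (proj_point k)) : set (set (proj_point k)) :=
  [set L | special_secant F L /\ joins_two (Q `&` locus F) L].

Definition adjacent (k : fieldType) (F : {mpoly k[3]})
    (Q Q' : set (proj_point k)) : Prop :=
  [/\ totally_tangent_conics F Q, totally_tangent_conics F Q', Q <> Q',
      Q `&` Q' #= `I_4 & secants_of F Q `&` secants_of F Q' #= `I_3].

Definition components (k : fieldType) (F : {mpoly k[3]}) :
    set (set (set (proj_point k))) :=
  [set D | exists2 Q, totally_tangent_conics F Q &
           D = [set Q' | clos_refl_trans _ (adjacent F) Q Q']].

(* |Q & Q' & Gamma| equals m for exactly n conics Q' in D, Gamma being F = 0. *)
Definition meets_in (k : fieldType) (F : {mpoly k[3]}) (Q : set (proj_point k))
    (D : set (set (proj_point k))) (m n : nat) : Prop :=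
  [set Q' | D Q' /\ Q `&` Q' `&` locus F #= `I_m] #= `I_n.

(* Main.v *)
(* A conic is parametrized by polynomials of degree 2, and its intersection
   multiplicity with a curve [F = 0] is the order of vanishing of the pullback
   of [F].  A Hermitian curve has an equation [sum H_ij x_i x_j^5].  Take
   coordinates in which a totally tangent conic is [x z = y^2] and two of its
   six contact points are the parameters 0 and infinity.  The pullback to
   [(1, t, t^2)] is then [c f^2] with [f] monic of degree 5, has exponents
   [i + 5 j] with [i, j <= 2] only, and vanishes at 0.  The coefficients of
   [t^9], [t^8], [t^4] and [1] in [f^2] are therefore zero, so [f = t^5 + a t];
   after rescaling [t], the equation of the curve is [x z^5 - 2 y^6 + z x^5] up
   to a factor and the contact points have parameters in P^1(F_5).  Two
   coordinate systems of this kind differ, up to a scalar, by a matrix over F_25.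

   The rest takes place in the Hermitian plane over F_25.  The contact points
   of the 21 conics in a component partition the 126 isotropic points, which
   colors these points with 21 colors, and the proposition describes how many
   of the six contact points of [Q] have each color.  If coordinates are chosen
   so that [Q] and the conic of [D'] through one of these points both contain
   (1, 0, 0), the latter being [x z = y^2], then [Q] is one of 25 * 5 * 24
   conics, and each of them is checked. *)

Require Import Defs.
From HB Require Import structures.
From mathcomp Require Import all_boot all_order all_algebra.
From mathcomp Require Import mpoly.
From mathcomp Require Import boolp classical_sets functions cardinality.
From mathcomp Require Import ring zify.
From Stdlib Require Import Relation_Operators Operators_Properties.

Set Implicit Arguments.
Unset Strict Implicit.
Unset Printing Implicit Defensive.

(** * The Hermitian plane over F_25 *)

(** A component is given only as a transitive closure, so the proof exhibits it: the list [W] is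
    certified to be closed under adjacency and to be reachable from its first member. Closure
    requires all the neighbors of a conic. Adjacent conics share a special secant. Coordinates that
    make this secant y = 0, with the contact points of one conic on it at parameters 0 and infinity,
    make the matrix of the other conic so sparse that its candidates can be enumerated; up to
    reparametrization only [K1] and [K2] survive. Equality of conics is decided on contact points: a
    conic lies in the component as soon as its six contact points have the same color.

    On the geometric side, multiplicities are dimensions of quotients of local rings. A tangency
    hypothesis yields an order of vanishing only because such a dimension is unique, so the proof
    needs both the computation of multiplicities along a parametrization and their uniqueness. *)

Inductive F5 := f0 | f1 | f2 | f3 | f4.

Definition F5_nat x : nat :=
  match x with f0 => 0 | f1 => 1 | f2 => 2 | f3 => 3 | f4 => 4 end.
Definition F5_eqb x y :=
  match x, y with
  | f0, f0 | f1, f1 | f2, f2 | f3, f3 | f4, f4 => true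
  | _, _ => false
  end.
Lemma F5_eqP : Equality.axiom F5_eqb.
Proof. by do 2!case; constructor. Qed.
HB.instance Definition _ := hasDecEq.Build F5 F5_eqP.

Definition F5_succ x :=
  match x with f0 => f1 | f1 => f2 | f2 => f3 | f3 => f4 | f4 => f0 end.
Definition F5_opp x :=
  match x with f0 => f0 | f1 => f4 | f2 => f3 | f3 => f2 | f4 => f1 end.
Definition F5_dbl x :=
  match x with f0 => f0 | f1 => f2 | f2 => f4 | f3 => f1 | f4 => f3 end.
Definition F5_add x y :=
  match x with
  | f0 => y
  | f1 => F5_succ y
  | f2 => F5_succ (F5_succ y)
  | f3 => F5_succ (F5_succ (F5_succ y))
  | f4 => F5_succ (F5_succ (F5_succ (F5_succ y)))
  end.
Definition F5_mul x y :=
  match x with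
  | f0 => f0
  | f1 => y
  | f2 => F5_dbl y
  | f3 => F5_opp (F5_dbl y)
  | f4 => F5_opp y
  end.
Definition F5_inv x :=
  match x with f0 => f0 | f1 => f1 | f2 => f3 | f3 => f2 | f4 => f4 end.
Definition F5s := [:: f0; f1; f2; f3; f4].
Lemma mem_F5s x : x \in F5s. Proof. by case: x. Qed.

(* [(a, b)] stands for [a + b w] in [F_25 = F_5[w]], where [w ^ 2 = 2]. *)
Notation F25 := (F5 * F5)%type.

Definition qadd (x y : F25) : F25 := (F5_add x.1 y.1, F5_add x.2 y.2).
Definition qopp (x : F25) : F25 := (F5_opp x.1, F5_opp x.2).
Definition qmul (x y : F25) : F25 :=
  let: (a, b) := x in let: (c, d) := y in
  (F5_add (F5_mul a c) (F5_dbl (F5_mul b d)), F5_add (F5_mul a d) (F5_mul b c)).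
(** Since w^5 = 4 w = -w, this is the Frobenius map x -> x^5. *)
Definition qconj (x : F25) : F25 := (x.1, F5_opp x.2).
(** The product of x and its conjugate, that is x^6; the coefficient is 3 = -2. *)
Definition qnorm (x : F25) : F5 :=
  F5_add (F5_mul x.1 x.1) (F5_mul f3 (F5_mul x.2 x.2)).
Definition qinv (x : F25) : F25 :=
  let n := F5_inv (qnorm x) in (F5_mul n x.1, F5_mul n (F5_opp x.2)).
Definition q0 : F25 := (f0, f0).
Definition q1 : F25 := (f1, f0).
Definition q2 : F25 := (f2, f0).
Definition q3 : F25 := (f3, f0).
Definition F25s := [seq (a, b) | a <- F5s, b <- F5s].
Lemma mem_F25s x : x \in F25s. Proof. by case: x => [] [] []. Qed.

Notation vec := (F25 * F25 * F25)%type.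
Notation mat := (vec * vec * vec)%type.

Definition vadd (u v : vec) : vec :=
  let: (u0, u1, u2) := u in let: (v0, v1, v2) := v in
  (qadd u0 v0, qadd u1 v1, qadd u2 v2).
Definition vscale (c : F25) (v : vec) : vec :=
  let: (v0, v1, v2) := v in (qmul c v0, qmul c v1, qmul c v2).
Definition vmul (v : vec) (N : mat) : vec :=
  let: (v0, v1, v2) := v in let: (r0, r1, r2) := N in
  vadd (vadd (vscale v0 r0) (vscale v1 r1)) (vscale v2 r2).
Definition mmul (M N : mat) : mat :=
  let: (r0, r1, r2) := M in (vmul r0 N, vmul r1 N, vmul r2 N).
Definition dot (u v : vec) : F25 :=
  let: (u0, u1, u2) := u in let: (v0, v1, v2) := v in
  qadd (qadd (qmul u0 v0) (qmul u1 v1)) (qmul u2 v2).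
(** With 3 = -2, the isotropic vectors are the solutions of x z^5 - 2 y^6 + z x^5 = 0. *)
Definition herm (u v : vec) : F25 :=
  let: (u0, u1, u2) := u in let: (v0, v1, v2) := v in
  qadd (qadd (qmul u0 (qconj v2)) (qmul u2 (qconj v0)))
       (qmul q3 (qmul u1 (qconj v1))).
Definition isometry_up_to_scalar (N : mat) : bool :=
  let: (r0, r1, r2) := N in let l := herm r0 r2 in
  [&& l != q0, herm r2 r0 == l, herm r1 r1 == qmul q3 l &
   all (pred1 q0) [:: herm r0 r0; herm r2 r2; herm r0 r1; herm r1 r0;
                      herm r1 r2; herm r2 r1]].
Definition cross (u v : vec) : vec :=
  let: (u0, u1, u2) := u in let: (v0, v1, v2) := v in
  (qadd (qmul u1 v2) (qopp (qmul u2 v1)),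
   qadd (qmul u2 v0) (qopp (qmul u0 v2)),
   qadd (qmul u0 v1) (qopp (qmul u1 v0))).

Definition vscalem (c : F25) (N : mat) : mat :=
  let: (r0, r1, r2) := N in (vscale c r0, vscale c r1, vscale c r2).

(* The points of P^1(F_5) on the conic [x z = y ^ 2]. *)
Definition params : seq (F5 * F5) := (f0, f1) :: [seq (f1, s) | s <- F5s].
Definition veronese : seq vec :=
  [seq ((F5_mul p.1 p.1, f0), (F5_mul p.1 p.2, f0), (F5_mul p.2 p.2, f0)) | p <- params].
(** For an isometry up to scalar, these represent the contact points of the conic onto which [N]
    carries the standard one. *)
Definition block (N : mat) : seq vec := [seq vmul u N | u <- veronese].

(* A nonzero isotropic vector is a multiple of [canv (vnorm v)]; the isotropic
   [(a, b, 1)] are those with [a + a^5 = 2 b^6], that is [a = b^6 + a1 w]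
   with [a1] in F_5. *)
Definition canv (o : option (F25 * F25)) : vec :=
  if o is Some (a, b) then (a, b, q1) else (q1, q0, q0).
Definition vnorm (v : vec) : option (F25 * F25) :=
  let: (x, y, z) := v in
  if z == q0 then None
  else let i := qinv z in Some (qmul i x, qmul i y).
Definition nblock (N : mat) := map vnorm (block N).

Definition idm : mat := ((q1, q0, q0), (q0, q1, q0), (q0, q0, q1)).

(* The action of an element of GL_2(F_5) with rows [p], [q] on the conic. *)
Definition sym2 (p q : F5 * F5) : mat :=
  let: (s1, t1) := p in let: (s2, t2) := q in
  let i x : F25 := (x, f0) in
  ((i (F5_mul s1 s1), i (F5_mul s1 t1), i (F5_mul t1 t1)),
   (i (F5_dbl (F5_mul s1 s2)), i (F5_add (F5_mul s1 t2) (F5_mul s2 t1)),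
    i (F5_dbl (F5_mul t1 t2))),
   (i (F5_mul s2 s2), i (F5_mul s2 t2), i (F5_mul t2 t2))).
(** In [params], number 0 is infinity and number 1 is the parameter 0. Rows 0 and 2 of this matrix
    are the points number [ij.1] and [ij.2], so it keeps the conic and makes these two points the
    new 0 and infinity. *)
Definition reparam (ij : nat * nat) : mat :=
  sym2 (nth (f0, f0) params ij.1) (nth (f0, f0) params ij.2).
Definition pairs : seq (nat * nat) :=
  [seq ij <- [seq (i, j) | i <- iota 0 6, j <- iota 0 6] | ij.1 != ij.2].

(* Up to the automorphisms of the conic, the adjacent conics. *)
Definition K1 : mat :=
  ((q1, q0, (f0, f3)), (q0, (f0, f1), q0), ((f0, f3), q0, q1)).
Definition K2 : mat :=
  (((f4, f0), q0, (f0, f1)), (q0, q1, q0), ((f0, f4), q0, q1)).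

(* The 21 conics of the component of the standard conic. *)
Definition W : seq mat := [::
  (((f1,f0), (f0,f0), (f0,f0)), ((f0,f0), (f1,f0), (f0,f0)), ((f0,f0), (f0,f0), (f1,f0)));
  (((f1,f0), (f0,f0), (f0,f3)), ((f0,f0), (f0,f1), (f0,f0)), ((f0,f3), (f0,f0), (f1,f0)));
  (((f1,f3), (f0,f3), (f0,f3)), ((f0,f2), (f0,f1), (f0,f0)), ((f1,f3), (f1,f0), (f1,f0)));
  (((f1,f2), (f0,f1), (f0,f3)), ((f0,f4), (f0,f1), (f0,f0)), ((f4,f3), (f2,f0), (f1,f0)));
  (((f1,f2), (f0,f4), (f0,f3)), ((f0,f1), (f0,f1), (f0,f0)), ((f4,f3), (f3,f0), (f1,f0)));
  (((f1,f3), (f0,f2), (f0,f3)), ((f0,f3), (f0,f1), (f0,f0)), ((f1,f3), (f4,f0), (f1,f0)));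
  (((f1,f4), (f3,f2), (f1,f0)), ((f0,f0), (f1,f4), (f1,f4)), ((f3,f1), (f4,f3), (f1,f0)));
  (((f1,f4), (f2,f3), (f1,f0)), ((f0,f0), (f4,f1), (f1,f4)), ((f3,f1), (f1,f2), (f1,f0)));
  (((f3,f3), (f4,f2), (f1,f0)), ((f3,f2), (f2,f3), (f1,f4)), ((f2,f2), (f0,f3), (f1,f0)));
  (((f1,f0), (f3,f3), (f1,f0)), ((f4,f1), (f0,f0), (f1,f4)), ((f1,f0), (f2,f2), (f1,f0)));
  (((f2,f2), (f0,f2), (f1,f0)), ((f3,f2), (f3,f2), (f1,f4)), ((f3,f3), (f1,f3), (f1,f0)));
  (((f1,f0), (f3,f4), (f2,f0)), ((f1,f1), (f1,f3), (f1,f3)), ((f1,f2), (f3,f3), (f1,f0)));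
  (((f1,f0), (f1,f2), (f3,f0)), ((f3,f2), (f1,f2), (f2,f4)), ((f4,f2), (f4,f1), (f1,f0)));
  (((f1,f0), (f4,f3), (f3,f0)), ((f2,f3), (f1,f2), (f3,f1)), ((f4,f2), (f1,f4), (f1,f0)));
  (((f1,f0), (f2,f1), (f2,f0)), ((f4,f4), (f1,f3), (f4,f2)), ((f1,f2), (f2,f2), (f1,f0)));
  (((f4,f3), (f0,f4), (f2,f0)), ((f4,f0), (f2,f1), (f1,f3)), ((f3,f3), (f4,f3), (f1,f0)));
  (((f1,f4), (f4,f2), (f3,f0)), ((f2,f0), (f3,f1), (f2,f4)), ((f3,f4), (f0,f1), (f1,f0)));
  (((f2,f2), (f4,f1), (f2,f0)), ((f0,f2), (f0,f0), (f4,f2)), ((f1,f1), (f3,f2), (f1,f0)));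
  (((f1,f1), (f2,f4), (f2,f0)), ((f4,f0), (f3,f4), (f1,f3)), ((f2,f4), (f0,f3), (f1,f0)));
  (((f2,f3), (f2,f2), (f3,f0)), ((f0,f1), (f0,f0), (f2,f4)), ((f4,f1), (f1,f1), (f1,f0)));
  (((f4,f2), (f0,f2), (f3,f0)), ((f2,f0), (f2,f4), (f2,f4)), ((f2,f3), (f2,f1), (f1,f0)))].
Definition Wm j := nth idm W j.

(* These 21 conics partition the 126 isotropic points; [color] gives the index
   of the part. *)
Definition sel (x : F5) (n0 n1 n2 n3 n4 : nat) : nat :=
  match x with f0 => n0 | f1 => n1 | f2 => n2 | f3 => n3 | f4 => n4 end.
Definition color_table (b0 b1 a1 : F5) : nat :=
  match b0 with
  | f0 => match b1 with
    | f0 => sel a1 0 1 9 1 9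
    | f1 => sel a1 19 20 6 5 16
    | f2 => sel a1 17 18 10 3 15
    | f3 => sel a1 17 15 8 4 18
    | f4 => sel a1 19 16 7 2 20
    end
  | f1 => match b1 with
    | f0 => sel a1 0 2 6 2 6
    | f1 => sel a1 1 19 20 13 8
    | f2 => sel a1 14 7 4 18 11
    | f3 => sel a1 14 11 18 10 5
    | f4 => sel a1 9 3 13 20 19
    end
  | f2 => match b1 with
    | f0 => sel a1 0 3 8 3 8
    | f1 => sel a1 12 10 2 20 13
    | f2 => sel a1 9 5 14 15 17
    | f3 => sel a1 1 17 15 14 7
    | f4 => sel a1 12 13 20 6 4
    end
  | f3 => match b1 with
    | f0 => sel a1 0 4 10 4 10
    | f1 => sel a1 13 12 16 7 3
    | f2 => sel a1 1 17 18 11 6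
    | f3 => sel a1 9 2 11 18 17
    | f4 => sel a1 13 8 5 16 12
    end
  | f4 => match b1 with
    | f0 => sel a1 0 5 7 5 7
    | f1 => sel a1 9 4 12 16 19
    | f2 => sel a1 11 14 15 8 2
    | f3 => sel a1 11 6 3 15 14
    | f4 => sel a1 1 19 16 12 10
    end
  end.
Definition color (o : option (F25 * F25)) : nat :=
  if o is Some (a, b) then color_table b.1 b.2 a.2 else 0.
Definition monochrome (c : nat) (N : mat) :=
  all (fun o => color o == c) (nblock N).

Definition secant (ij : nat * nat) : vec :=
  cross (nth (q0, q0, q0) veronese ij.1) (nth (q0, q0, q0) veronese ij.2).
Definition secants : seq vec := [seq secant ij | ij <- pairs & ij.1 < ij.2].
Definition common_secants (N : mat) : nat :=
  count (fun l => 1 < count (fun v => dot l v == q0) (block N)) secants.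

(* Coefficients of [A + B s^2 + C s^4], the pullback of [x z - y^2] to the conic
   of matrix [((x0, 0, x2), (0, y, 0), (z0, 0, z2))]. *)
Definition even_quartic (x0 x2 y z0 z2 : F25) : F25 * F25 * F25 :=
  (qmul x0 x2,
   qadd (qadd (qmul x0 z2) (qmul x2 z0)) (qopp (qmul y y)),
   qmul z0 z2).

(** * Finite verifications over F_25 *)

Lemma W_monochrome : all (fun j => monochrome j (Wm j)) (iota 0 21) = true.
Proof. by vm_compute. Qed.

Lemma W_isometry : all isometry_up_to_scalar W = true.
Proof. by vm_compute. Qed.

Lemma K_isometry : all isometry_up_to_scalar [:: K1; K2] = true.
Proof. by vm_compute. Qed.

(** The pairs [(b, a1)] run over the 125 isotropic points with last coordinate 1, and [None] is the
    remaining one. *)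
Lemma color_partition :
  all (fun b => all (fun a1 => let o := Some ((qnorm b, a1), b) in
    (color o < 21) && (o \in nblock (Wm (color o)))) F5s) F25s
  && (None \in nblock (Wm 0)) = true.
Proof. by vm_compute. Qed.

Lemma reparam_ok :
  all (fun ij => let R := reparam ij in
    [&& isometry_up_to_scalar R, all (mem (nblock idm)) (nblock R),
        nth None (nblock R) 1 == nth None (nblock idm) ij.1 &
        nth None (nblock R) 0 == nth None (nblock idm) ij.2]) pairs = true.
Proof. by vm_compute. Qed.

(** [K] is applied in the coordinates of conic [j] that put a chosen pair of its points at 0 and
    infinity, so these products cover every neighbor of conic [j]. A common color is enough to
    recognize a member of the list, by [monochrome_cset]. *)
Lemma W_closed :
  all (fun j => all (fun ij => all (fun K =>
    let N := mmul K (mmul (reparam ij) (Wm j)) in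
    let c := color (head None (nblock N)) in
    (c < 21) && monochrome c N) [:: K1; K2]) pairs) (iota 0 21) = true.
Proof. by vm_compute. Qed.

(* Entry [j] is [(r, l, i)]: conic [j.+1] is adjacent to the earlier conic [i],
   through [K1] in the coordinates that put parameters number [r] and [l] at 0 and
   infinity. *)
Definition W_path : seq (nat * nat * nat) := [::
  (0, 1, 0); (0, 4, 0); (0, 5, 0); (0, 2, 0); (0, 3, 0);
  (3, 5, 0); (2, 4, 0); (1, 4, 0); (2, 5, 0); (1, 3, 0);
  (0, 4, 1); (0, 5, 1); (0, 2, 1); (0, 3, 1); (0, 4, 2);
  (0, 5, 2); (0, 3, 2); (0, 4, 3); (0, 5, 3); (0, 5, 4)].
Lemma W_reachable :
  all (fun j => let: (r, l, i) := nth (0, 0, 0) W_path j in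
    [&& i < j.+1, (r, l) \in pairs &
        monochrome j.+1 (mmul K1 (mmul (reparam (r, l)) (Wm i)))])
    (iota 0 20) = true.
Proof. by vm_compute. Qed.

(* [N] runs over the conics through [(1, 0, 0)] in normal form, [m] lists how
   often each color occurs among their six points. *)
Lemma color_patterns :
  all (fun b => all (fun a1 => all (fun y => (y == q0) ||
    let a : F25 := (qnorm b, a1) in
    let N := (((qnorm y, f0) : F25, q0, q0),
              (qmul q2 (qmul y (qconj b)), y, q0), (a, b, q1)) in
    let c := map color (nblock N) in
    let m := [seq count (pred1 j) c | j <- iota 0 21] in
    [|| (count (pred1 2) m == 3) && (count (pred1 0) m == 18),
        [&& count (pred1 2) m == 1, count (pred1 1) m == 4 &
            count (pred1 0) m == 16],
        (count (pred1 1) m == 6) && (count (pred1 0) m == 15) |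
        monochrome (head 0 c) N]) F25s) F5s) F25s = true.
Proof. by vm_compute. Qed.

(** A secant is recognized by the contact points on it; this makes the 15 secants of a conic
    distinct lines. *)
Lemma secants_separated :
  uniq [seq [seq dot l v == q0 | v <- veronese] | l <- secants] = true.
Proof. by vm_compute. Qed.

Lemma secants_incident :
  all (fun ij => let l := secant ij in let u i := nth (q0, q0, q0) veronese i in
    [&& l != (q0, q0, q0), dot l (u ij.1) == q0, dot l (u ij.2) == q0 &
        (ij.1 < ij.2) || (ij.2 < ij.1)]) pairs = true.
Proof. by vm_compute. Qed.

(** [N] is the matrix of a conic with two contact points on the line y = 0, which joins the points 0
    and infinity of the standard conic. Among those sharing exactly three secants with the standard
    conic, the ones that are neither [K1] nor [K2] have a pullback quartic that is a monomial in s^2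
    or has B^2 = 4 A C, hence fewer than four common points. *)
Lemma adjacent_candidates :
  all (fun x0 => all (fun x2 => if herm (x0, q0, x2) (x0, q0, x2) != q0 then true else
  all (fun o => let: (z0, _, z2) := canv o in all (fun y =>
    let N := ((x0, q0, x2), (q0, y, q0), (z0, q0, z2)) in
    if ~~ isometry_up_to_scalar N then true else
    let: (A, B, C) := even_quartic x0 x2 y z0 z2 in
    [|| common_secants N != 3, [&& A == q0, C == q0 & B != q0],
        (A != q0) && (qmul B B == qmul (f4, f0) (qmul A C)),
        all (mem (nblock K1)) (nblock N) | all (mem (nblock K2)) (nblock N)])
    F25s) (None :: [seq Some (a, q0) | a <- F25s])) F25s) F25s = true.
Proof. by vm_compute. Qed.

Import GRing.Theory.
Local Open Scope ring_scope.

(** * Intersection multiplicities along a parametrization *)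

Section Points.
Variable k : fieldType.
Implicit Types (P : proj_point k) (x y : 'rV[k]_3) (F : {mpoly k[3]}).

Definition ev F x : k := F.@[fun i => x 0 i].

Fact dim_line1 : \dim <[const_mx 1 : 'rV[k]_3]> == 1%N.
Proof.
rewrite dim_vline; suff -> : const_mx 1 != 0 :> 'rV[k]_3 by [].
apply/eqP => /(congr1 (fun x : 'rV_3 => x 0 0))/eqP.
by rewrite !mxE oner_eq0.
Qed.

(* Junk value for [x = 0]. *)
Definition pt x : proj_point k := insubd (exist (fun L : {vspace 'rV[k]_3} => \dim L == 1%N) _ dim_line1 : proj_point k) <[x]>%VS.

Lemma val_pt x : x != 0 -> val (pt x) = <[x]>%VS.
Proof. by move=> x0; rewrite insubdK // unfold_in dim_vline x0. Qed.

Lemma vpick_neq0 P : vpick (val P) != 0.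
Proof. by rewrite vpick0 -dimv_eq0 (eqP (valP P)). Qed.

Lemma pt_vpick P : pt (vpick (val P)) = P.
Proof.
apply: val_inj; rewrite val_pt ?vpick_neq0 //.
apply/eqP; rewrite eqEdim -memvE memv_pick (eqP (valP P)).
by rewrite dim_vline vpick_neq0.
Qed.

Lemma pt_eqP x y : x != 0 -> y != 0 ->
  pt x = pt y <-> exists2 c, c != 0 & y = c *: x.
Proof.
move=> x0 y0; split=> [/(congr1 val)|[c c0 ->]].
  rewrite !val_pt // => e; have : y \in <[x]>%VS by rewrite e memv_line.
  case/vlineP=> c yE; exists c => //; apply: contraNneq y0 => c0.
  by rewrite yE c0 scale0r.
have cx0: c *: x != 0 by rewrite scaler_eq0 negb_or c0.
apply: val_inj; rewrite !val_pt //.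
apply/eqP; rewrite eq_sym eqEdim -memvE !dim_vline x0 cx0 /= andbT.
by rewrite memvZ // memv_line.
Qed.

Lemma ptZ c x : c != 0 -> x != 0 -> pt (c *: x) = pt x.
Proof.
move=> c0 x0; apply/esym/pt_eqP => //; last by exists c.
by rewrite scaler_eq0 negb_or c0.
Qed.

Lemma pt_surj P : exists2 x, x != 0 & P = pt x.
Proof. by exists (vpick (val P)); rewrite ?pt_vpick ?vpick_neq0. Qed.

Lemma hcoord_ev F P : F.@[hcoord P] = ev F (vpick (val P)).
Proof. by []. Qed.

Lemma vpick_pt x : x != 0 -> exists2 c, c != 0 & vpick (val (pt x)) = c *: x.
Proof.
by move=> x0; apply/pt_eqP; rewrite ?vpick_neq0 // pt_vpick.
Qed.

Lemma ev_homogZ d F c x : F \is d.-homog -> ev F (c *: x) = c ^+ d * ev F x.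
Proof.
move=> /dhomogP hF; rewrite /ev !mevalE mulr_sumr; apply: eq_big_seq => m mF.
rewrite mulrCA; congr (_ * _); under eq_bigr do rewrite mxE exprMn.
by rewrite big_split /= prodrXr -mdegE (hF m mF).
Qed.

Lemma ev_pt_eq0 d F x : F \is d.-homog -> x != 0 ->
  (F.@[hcoord (pt x)] == 0) = (ev F x == 0).
Proof.
move=> hF x0; rewrite hcoord_ev; have [c c0 ->] := vpick_pt x0.
by rewrite (ev_homogZ _ _ hF) mulf_eq0 expf_eq0 (negPf c0) andbF.
Qed.

Lemma locus_pt d F x : F \is d.-homog -> x != 0 ->
  locus F (pt x) <-> ev F x = 0.
Proof.
move=> hF x0; have E := ev_pt_eq0 hF x0.
by split=> /eqP h; apply/eqP; [rewrite -E|rewrite E].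
Qed.

End Points.

Lemma subf_div (K : fieldType) (a b a' b' : K) : b != 0 -> b' != 0 ->
  a / b - a' / b' = (a * b' - a' * b) / (b * b').
Proof. by move=> b0 b'0; rewrite -mulNr addf_div // mulNr. Qed.

(** * Uniqueness of the intersection multiplicity *)

Section LocalIdeal.
Variables (k : fieldType) (P : proj_point k) (F G : {mpoly k[3]}).

Lemma mpoly_eval_neq0 (b : {mpoly k[3]}) v : b.@[v] != 0 -> tofrac b != 0.
Proof. by move=> h; rewrite tofrac_eq0; apply: contraNneq h => ->; rewrite meval0. Qed.

Lemma local_idealB x y :
  local_ideal P F G x -> local_ideal P F G y -> local_ideal P F G (x - y).
Proof.
move=> [d [a [b [ha hb hbP [u [v aE]] ->]]]] [d' [a' [b' [ha' hb' hb'P [u' [v' a'E]] ->]]]].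
exists (d + d')%N, (a * b' - a' * b), (b * b'); split.
- by apply: rpredB; [|rewrite addnC]; apply: dhomogM.
- exact: dhomogM.
- by rewrite mevalM mulf_neq0.
- exists (u * b' - u' * b), (v * b' - v' * b); rewrite aE a'E. ring.
- rewrite rmorphB !rmorphM /=.
  by apply: subf_div; apply: (mpoly_eval_neq0 (v := hcoord P)).
Qed.

Lemma local_idealZ c x :
  local_ideal P F G x -> local_ideal P F G (tofrac c%:MP * x).
Proof.
move=> [d [a [b [ha hb hbP [u [v aE]] ->]]]].
exists d, (c *: a), b; split=> //; first exact: dhomogZ.
  by exists (c *: u), (c *: v); rewrite aE scalerDr -!scalerAl.
by rewrite -mul_mpolyC rmorphM /= mulrA.
Qed.

Lemma local_ideal0 : local_ideal P F G 0.
Proof.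
exists 0%N, 0, 1; split; rewrite ?dhomog0 ?dhomog1 ?meval1 ?oner_eq0 //.
  by exists 0, 0; rewrite !mul0r addr0.
by rewrite rmorph0 mul0r.
Qed.

Lemma local_ideal_sum (I : finType) (f : I -> {fraction {mpoly k[3]}}) :
  (forall i, local_ideal P F G (f i)) -> local_ideal P F G (\sum_i f i).
Proof.
move=> hf; elim/big_ind: _ => [|x y hx hy|i _]; [exact: local_ideal0| |exact: hf].
rewrite -[y]opprK; apply: local_idealB hx _; rewrite -sub0r.
exact: local_idealB local_ideal0 hy.
Qed.

Lemma local_ring0 : local_ring P 0.
Proof.
by exists 0%N, 0, 1; rewrite dhomog0 dhomog1 meval1 oner_neq0 rmorph0 mul0r.
Qed.

(** Expressing the [e i] through the [e' j] modulo the ideal gives an n x m matrix. A row vector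
    killed by it is a relation among the [e i], hence zero by the uniqueness of the coordinates of
    0; so the rows are independent and n <= m. *)
Lemma inter_mult_leq n m :
  inter_mult_eq P F G n -> inter_mult_eq P F G m -> (n <= m)%N.
Proof.
move=> [e [he Ue]] [e' [he' Ue']].
have /choice[A hA] i : exists c : 'rV[k]_m,
    local_ideal P F G (e i - \sum_(j < m) tofrac (c 0 j)%:MP * e' j).
  by have [c [hc _]] := Ue' _ (he i); exists c.
pose B := \matrix_i A i.
rewrite (leq_trans _ (rank_leq_col B)) // row_leq_rank.
apply: inj_row_free => c cB.
have [c' [_ Uc]] := Ue 0 local_ring0.
rewrite -(Uc 0); last first.
  rewrite big1 ?subr0; first exact: local_ideal0.
  by move=> i _; rewrite mxE mpolyC0 rmorph0 mul0r.
apply/esym/Uc; rewrite sub0r -[X in - X]subr0 -sub0r.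
apply: local_idealB; first exact: local_ideal0.
have E : \sum_(j < m) tofrac ((c *m B) 0 j)%:MP * e' j = 0.
  by rewrite cB; apply: big1 => j _; rewrite mxE mpolyC0 rmorph0 mul0r.
rewrite -[X in _ - X]E.
have -> : \sum_(j < m) tofrac ((c *m B) 0 j)%:MP * e' j =
    \sum_(i < n) tofrac (c 0 i)%:MP * (\sum_(j < m) tofrac (A i 0 j)%:MP * e' j).
  under [RHS]eq_bigr do rewrite mulr_sumr.
  rewrite exchange_big; apply: eq_bigr => j _; rewrite mxE.
  rewrite !rmorph_sum mulr_suml; apply: eq_bigr => i _.
  by rewrite !mxE !rmorphM /= mulrA.
rewrite -sumrB; apply: local_ideal_sum => i; rewrite -mulrBr.
exact: local_idealZ.
Qed.

End LocalIdeal.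

Lemma mulf_div_cancel (K : fieldType) (c a b : K) : c != 0 ->
  (c * a) / (c * b) = a / b.
Proof. by move=> c0; rewrite -mulf_div divff // mul1r. Qed.

Lemma subf_div_eq (K : fieldType) (a b c d x y : K) :
  b != 0 -> d != 0 -> y != 0 -> a / b - c / d = x / y ->
  (a * d - c * b) * y == x * (b * d).
Proof.
by move=> b0 d0 y0; rewrite subf_div // => /eqP; rewrite eqr_div ?mulf_neq0.
Qed.

(** * Multiplicity as order of vanishing along a parametrized curve *)

Section Parametrization.
Variable k : fieldType.
Implicit Types (h : 'I_3 -> {poly k}) (F G a b q : {mpoly k[3]}).

Local Notation pull h := (mmap polyC h).

Lemma horner_pull h F t : (pull h F).[t] = F.@[fun i => (h i).[t]].
Proof.
rewrite mevalE /mmap horner_sum; apply: eq_bigr => m _.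
rewrite hornerM hornerC; congr (_ * _).
by rewrite /mmap1 horner_prod; apply: eq_bigr => i _; rewrite horner_exp.
Qed.

(* [h] parametrizes the plane curve [q = 0] by polynomials of degree at most
   [e], and forms of degree [d] restrict onto the polynomials of degree at most
   [e * d]. *)
Record good_param (e : nat) q h : Prop := GoodParam {
  param_eq0 : pull h q = 0;
  param_size : forall d a, a \is d.-homog -> (size (pull h a) <= (e * d).+1)%N;
  param_lift : forall d (w : {poly k}), (size w <= (e * d).+1)%N ->
    exists2 a, a \is d.-homog & pull h a = w;
  param_ker : forall d a, a \is d.-homog -> pull h a = 0 ->
    exists u, a = u * q
}.

(** [B] is invertible modulo (X - t0)^n, and [c] is the jet of the quotient A / B. *)
Lemma divp_jet n (t0 : k) (A B : {poly k}) : B.[t0] != 0 ->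
  exists c : 'rV[k]_n, ('X - t0%:P) ^+ n %| A - rVpoly c * B.
Proof.
move=> B0; have cop : coprimep B (('X - t0%:P) ^+ n).
  by apply: coprimep_expr; rewrite coprimep_XsubC.
have [[u v] /= uv] := Bezout_eq1_coprimepP _ _ cop.
exists (poly_rV ((A * u) %% (('X - t0%:P) ^+ n))).
rewrite poly_rV_K; last first.
  by rewrite -ltnS -(size_exp_XsubC n t0) ltn_modp expf_neq0 // polyXsubC_eq0.
set m := _ ^+ n in uv *; have {1}-> : A = A * u * B + A * v * m.
  by rewrite -!mulrA -mulrDr uv mulr1.
rewrite addrAC -mulrBl {1}[A * u](divp_eq _ m) addrK.
by rewrite dvdp_add ?dvdp_mulIr // -mulrA mulrC -mulrA dvdp_mulIl.
Qed.

Lemma rVpoly_jet_inj n (t0 : k) (B : {poly k}) (c : 'rV[k]_n) :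
  B.[t0] != 0 -> ('X - t0%:P) ^+ n %| rVpoly c * B -> c = 0.
Proof.
move=> B0; have cop : coprimep (('X - t0%:P) ^+ n) B.
  by rewrite coprimep_sym coprimep_expr // coprimep_XsubC.
rewrite Gauss_dvdpl // => hd; apply: (can_inj rVpolyK); rewrite linear0.
apply: contraTeq hd => c0; rewrite gtNdvdp // size_exp_XsubC ltnS.
exact: size_poly.
Qed.

Section InterMult.
Variables (P : proj_point k) (q F : {mpoly k[3]}) (e D n : nat).
Variables (h : 'I_3 -> {poly k}) (t0 c0 : k) (g : {poly k}).
Hypotheses (e_gt0 : (0 < e)%N) (hq : good_param e q h) (c0_neq0 : c0 != 0).
Hypothesis (hP : forall i, (h i).[t0] = c0 * hcoord P i).
Hypotheses (F_homog : F \is D.-homog).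
Hypothesis (pullF : pull h F = ('X - t0%:P) ^+ n * g).
Hypothesis (g_neq0 : g.[t0] != 0).

Lemma horner_pull_param d b : b \is d.-homog ->
  ((pull h b).[t0] == 0) = (b.@[hcoord P] == 0).
Proof.
move=> hb; rewrite horner_pull (meval_eq (v2 := fun i => (c0 *: vpick (val P)) 0 i)).
  by rewrite -/(ev b _) (ev_homogZ _ _ hb) mulf_eq0 expf_eq0 (negPf c0_neq0) andbF.
by move=> i; rewrite mxE hP.
Qed.

(** For the converse, let w (X - t0)^n be the pullback of [a]. The degree bounds allow lifting [g]
    and [w] to forms [c] and [v]; then c a - v F vanishes along the curve, so it is a multiple of
    [q]. As [g] does not vanish at [t0], [c] does not vanish at [P], and a / b = (c a) / (c b) lies
    in the ideal. *)
Lemma local_idealP x : local_ideal P q F x <->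
  exists d a b, [/\ a \is d.-homog, b \is d.-homog, b.@[hcoord P] != 0,
    ('X - t0%:P) ^+ n %| pull h a & x = tofrac a / tofrac b].
Proof.
split=> [[d [a [b [ha hb hbP [u [v aE]] xE]]]]|[d [a [b [ha hb hbP]]]]].
  exists d, a, b; split=> //.
  by rewrite aE rmorphD !rmorphM /= (param_eq0 hq) mulr0 add0r pullF mulrCA dvdp_mulr.
case/dvdpP=> w aE ->.
have sXn0 : ('X - t0%:P) ^+ n != 0 by rewrite expf_neq0 // polyXsubC_eq0.
have g0 : g != 0 by apply: contraNneq g_neq0 => ->; rewrite horner0.
have sg : (size g <= (e * D).+1)%N.
  apply: leq_trans (param_size hq F_homog).
  by rewrite pullF dvdp_leq ?mulf_neq0 // dvdp_mulIr.
have sw : (size w <= (e * d).+1)%N.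
  have [->|w0] := eqVneq w 0; first by rewrite size_poly0.
  apply: leq_trans (param_size hq ha).
  by rewrite aE dvdp_leq ?mulf_neq0 // dvdp_mulIl.
have [c hc cE] := param_lift hq sg; have [v hv vE] := param_lift hq sw.
have [||u uE] := param_ker hq (a := c * a - v * F) (d := D + d).
- by apply: rpredB; [|rewrite addnC]; apply: dhomogM.
- by rewrite rmorphB !rmorphM /= cE vE aE pullF; ring.
have cP : c.@[hcoord P] != 0 by rewrite -(horner_pull_param hc) cE.
exists (D + d)%N, (c * a), (c * b); split; rewrite ?dhomogM //.
- by rewrite mevalM mulf_neq0.
- by exists u, v; rewrite -uE subrK.
- rewrite !rmorphM /=; apply/esym/mulf_div_cancel.
  exact: mpoly_eval_neq0 cP.
Qed.

(* The jets of order [n] along the parametrization identify the quotient of the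
   local ring with the polynomials of degree less than [n]. *)
Lemma inter_mult_of_order : inter_mult_eq P q F n.
Proof.
(* A common denominator for the basis: its pullback is 1, so it is a unit at [P] and leaves the jets
   unchanged. *)
have [B hB BE] := param_lift hq (d := n) (w := 1) (ltac:(by rewrite size_poly1)).
have /choice[E hE] (i : 'I_n) : exists a, a \is n.-homog /\ pull h a = 'X^i.
  have [|a ha aE] := param_lift hq (d := n) (w := 'X^i); last by exists a.
  by rewrite size_polyXn ltnS (leq_trans (ltnW (ltn_ord i))) // leq_pmull.
have BP : B.@[hcoord P] != 0.
  by rewrite -(horner_pull_param hB) BE hornerE oner_neq0.
have tB0 := mpoly_eval_neq0 BP.
pose Ec (c : 'rV[k]_n) := \sum_i c 0 i *: E i.
have hEc c : Ec c \is n.-homog.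
  by apply: rpred_sum => i _; apply: dhomogZ; case: (hE i).
have pullEc c : pull h (Ec c) = rVpoly c.
  rewrite raddf_sum [RHS]poly_def; apply: eq_bigr => i _ /=.
  by rewrite mmapZ (proj2 (hE i)) mul_polyC valK.
exists (fun i => tofrac (E i) / tofrac B); split=> [i|x].
  by exists n, (E i), B; split=> //; case: (hE i).
have sumE (c : 'rV[k]_n) : \sum_(i < n) tofrac (c 0 i)%:MP * (tofrac (E i) / tofrac B) =
    tofrac (Ec c) / tofrac B.
  rewrite raddf_sum mulr_suml; apply: eq_bigr => i _.
  by rewrite -mul_mpolyC /= rmorphM /= mulrA.
move=> [d [a [b [ha hb hbP ->]]]].
have tb0 := mpoly_eval_neq0 hbP.
have pb0 : (pull h b).[t0] != 0 by rewrite (horner_pull_param hb).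
have [c hc] := divp_jet n (pull h a) pb0.
exists c; split=> [|c']; rewrite sumE.
  apply/local_idealP; exists (d + n)%N, (a * B - Ec c * b), (b * B); split.
  - by apply: rpredB; [|rewrite addnC]; apply: dhomogM.
  - exact: dhomogM.
  - by rewrite mevalM mulf_neq0.
  - by rewrite rmorphB !rmorphM /= BE mulr1 pullEc.
  - by rewrite rmorphB !rmorphM /=; exact: (subf_div _ _ tb0 tB0).
case/local_idealP => [d' [a' [b' [ha' hb' hb'P dv E']]]].
have pb'0 : (pull h b').[t0] != 0 by rewrite (horner_pull_param hb').
have {}E' : (a * B - Ec c' * b) * b' = a' * (b * B).
  apply/eqP; rewrite -tofrac_eq !rmorphM rmorphB !rmorphM /=.
  have tb'0 := mpoly_eval_neq0 hb'P.
  exact: (subf_div_eq tb0 tB0 tb'0 E').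
apply/eqP; rewrite -subr_eq0; apply/eqP/(rVpoly_jet_inj pb0).
have cop : coprimep (('X - t0%:P) ^+ n) (pull h b').
  by rewrite coprimep_sym coprimep_expr // coprimep_XsubC.
rewrite -(Gauss_dvdpl _ cop).
have -> : rVpoly (c - c') * pull h b * pull h b' =
   pull h ((a * B - Ec c' * b) * b') - (pull h a - rVpoly c * pull h b) * pull h b'.
  rewrite linearB /= !rmorphM rmorphB !rmorphM /= BE !pullEc; ring.
by rewrite dvdp_sub ?dvdp_mulr // E' rmorphM dvdp_mulr.
Qed.

End InterMult.

End Parametrization.

Local Notation pull h := (mmap polyC h).

Local Notation o0 := (ord0 : 'I_3).
Local Notation o1 := (lift ord0 ord0 : 'I_3).
Local Notation o2 := (lift ord0 (lift ord0 ord0) : 'I_3).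

Lemma sum_ord3 (V : nmodType) (f : 'I_3 -> V) : \sum_i f i = f o0 + f o1 + f o2.
Proof. by rewrite !big_ord_recl big_ord0 addr0 addrA. Qed.

Lemma prod_ord3 (R : pzSemiRingType) (f : 'I_3 -> R) : \prod_i f i = f o0 * f o1 * f o2.
Proof. by rewrite !big_ord_recl big_ord0 mulr1 mulrA. Qed.

Lemma forall_ord3 (P : 'I_3 -> Prop) : P o0 -> P o1 -> P o2 -> forall i, P i.
Proof.
by move=> h0 h1 h2 [[|[|[|//]]] hi];
  [move: h0|move: h1|move: h2]; congr P; apply: val_inj.
Qed.

Lemma dhomog_ind n (R : nzRingType) d (P : {mpoly R[n]} -> Prop) :
  P 0 -> (forall p q, P p -> P q -> P (p + q)) ->
  (forall c (m : 'X_{1..n}), mdeg m = d -> P (c *: 'X_[m])) ->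
  forall p, p \is d.-homog -> P p.
Proof.
move=> h0 hD hX p /dhomogP hp; rewrite [p]mpolyE big_seq.
by elim/big_ind: _ => // m mp; apply/hX/hp.
Qed.

Lemma rmorph_mmap n (R S T : nzRingType) (f : R -> S) (h : 'I_n -> S)
    (phi : {rmorphism S -> T}) (f' : R -> T) (h' : 'I_n -> T) p :
  (forall c, phi (f c) = f' c) -> (forall i, phi (h i) = h' i) ->
  phi (mmap f h p) = mmap f' h' p.
Proof.
move=> hf hh; rewrite /mmap rmorph_sum; apply: eq_bigr => m _.
rewrite rmorphM hf; congr (_ * _); rewrite /mmap1 rmorph_prod.
by apply: eq_bigr => i _; rewrite rmorphXn hh.
Qed.

Lemma homogX n (R : nzRingType) (i : 'I_n) : 'X_i \is [in R[n], 1.-homog].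
Proof. by rewrite dhomogX /= mdeg1. Qed.

(** * Linear changes of coordinates *)

Section LinearChange.
Variable k : fieldType.
Implicit Types (M N : 'M[k]_3) (F q : {mpoly k[3]}) (u h : 'I_3 -> {poly k}).

(** The indices are transposed so that [lin M F] is [F] composed with the action x -> [x *m M] on
    row vectors. *)
Definition linforms M : 3.-tuple {mpoly k[3]} := [tuple \sum_j M j i *: 'X_j | i < 3].
Local Notation lin M F := (F \mPo linforms M).

Lemma ev_lin M F x : ev (lin M F) x = ev F (x *m M).
Proof.
rewrite /ev comp_mpoly_meval; apply: meval_eq => i.
rewrite tnth_mktuple raddf_sum mxE /=; apply: eq_bigr => j _.
by rewrite mevalZ mevalXU mulrC.
Qed.

Lemma linXU M i : lin M 'X_i = \sum_j M j i *: 'X_j.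
Proof. by rewrite comp_mpolyXU -tnth_nth tnth_mktuple. Qed.

Lemma lin_homog d M F : F \is d.-homog -> lin M F \is d.-homog.
Proof.
move: F; apply: dhomog_ind => [|p q hp hq|c m <-].
- by rewrite raddf0 dhomog0.
- by rewrite raddfD rpredD.
rewrite comp_mpolyZ comp_mpolyX; apply: dhomogZ; rewrite mdegE !prod_ord3 sum_ord3.
by rewrite !dhomogM //; rewrite -[X in X.-homog]mul1n; apply: dhomogMn;
  rewrite tnth_mktuple rpred_sum // => j _; rewrite dhomogZ // homogX.
Qed.

Lemma lin_comp M N F : lin M (lin N F) = lin (M *m N) F.
Proof.
apply: rmorph_mmap => [c|i]; first exact: comp_mpolyC.
rewrite !tnth_mktuple raddf_sum /=; under eq_bigr do rewrite comp_mpolyZ linXU scaler_sumr.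
rewrite exchange_big; apply: eq_bigr => j _ /=; rewrite mxE scaler_suml.
by apply: eq_bigr => l _; rewrite scalerA mulrC.
Qed.

Lemma lin1 F : lin 1%:M F = F.
Proof.
rewrite -[RHS]comp_mpoly_id; congr comp_mpoly; apply: eq_from_tnth => i.
rewrite !tnth_mktuple (bigD1 i) //= mxE eqxx scale1r big1 ?addr0 // => j ji.
by rewrite mxE (negPf ji) scale0r.
Qed.

Definition param_mul u M : 'I_3 -> {poly k} := fun i => \sum_j M j i *: u j.

Lemma pull_lin u M F : pull (param_mul u M) F = pull u (lin M F).
Proof.
apply/esym/rmorph_mmap => [c|i]; first exact: mmapC.
rewrite tnth_mktuple raddf_sum; apply: eq_bigr => j _ /=.
by rewrite mmapZ mmapX mmap1U mul_polyC.
Qed.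

Lemma good_param_mul e q u M : M \in unitmx -> good_param e q u ->
  good_param e (lin (invmx M) q) (param_mul u M).
Proof.
move=> uM [h0 hs hl hk]; split.
- by rewrite pull_lin lin_comp mulmxV // lin1.
- by move=> d a ha; rewrite pull_lin hs // lin_homog.
- move=> d w /hl [a ha aw]; exists (lin (invmx M) a); first exact: lin_homog.
  by rewrite pull_lin lin_comp mulmxV // lin1.
move=> d a ha; rewrite pull_lin => /(hk d _ (lin_homog M ha)) [v hv].
exists (lin (invmx M) v); rewrite -rmorphM /= -hv lin_comp mulVmx //.
by rewrite lin1.
Qed.

End LinearChange.
Local Notation lin M F := (F \mPo linforms M).

(** * The standard conic and the tangent line z = 0 *)

Section StandardParams.
Variable k : fieldType.

Lemma mpolyX3 (m : 'X_{1..3}) :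
  'X_[m] = 'X_o0 ^+ m o0 * 'X_o1 ^+ m o1 * 'X_o2 ^+ m o2 :> {mpoly k[3]}.
Proof. by rewrite mpolyXE_id prod_ord3. Qed.

Lemma mdeg3 (m : 'X_{1..3}) : mdeg m = (m o0 + m o1 + m o2)%N.
Proof. by rewrite mdegE !big_ord_recl big_ord0 addn0 addnA. Qed.

Definition conic_form : {mpoly k[3]} := 'X_o0 * 'X_o2 - 'X_o1 ^+ 2.
Definition conic_param : 'I_3 -> {poly k} := fun i => 'X ^+ i.
(** The line z = 0, which in the coordinates of a frame is the tangent to the curve at (1, 0, 0). *)
Definition line_param : 'I_3 -> {poly k} := fun i => if i == o2 then 0 else 'X ^+ i.

Lemma conic_paramE : (conic_param o0 = 1) * (conic_param o1 = 'X) * (conic_param o2 = 'X^2).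
Proof. by []. Qed.

Lemma line_paramE : (line_param o0 = 1) * (line_param o1 = 'X) * (line_param o2 = 0).
Proof. by []. Qed.

(** The normal form, modulo x z = y^2, of the monomials of degree [d] that restrict to t^e: the
    exponent of y is at most 1. *)
Definition conic_mon (d e : nat) : {mpoly k[3]} :=
  'X_o0 ^+ (d - uphalf e) * 'X_o1 ^+ odd e * 'X_o2 ^+ e./2.
Definition line_mon (d e : nat) : {mpoly k[3]} := 'X_o0 ^+ (d - e) * 'X_o1 ^+ e.

Lemma homogXn i n : 'X_i ^+ n \is [in k[3], n.-homog].
Proof. by rewrite -[X in X.-homog]mul1n dhomogMn // homogX. Qed.

Lemma conic_mon_homog d e : (e <= d.*2)%N -> conic_mon d e \is d.-homog.
Proof.
move=> le; have -> : d = (d - uphalf e + odd e + e./2)%N by lia.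
rewrite {1}/conic_mon.
have -> : (d - uphalf e + odd e + e./2 - uphalf e = d - uphalf e)%N by lia.
by rewrite !dhomogM ?homogXn.
Qed.

Lemma pullXU u i : pull u ('X_i : {mpoly k[3]}) = u i.
Proof. by rewrite mmapX mmap1U. Qed.

Lemma pull_conic_mon d e : pull conic_param (conic_mon d e) = 'X^e.
Proof.
rewrite !rmorphM !rmorphXn /= !pullXU !conic_paramE expr1n mul1r.
by rewrite -exprM -exprD; congr ('X^_); lia.
Qed.

Lemma pull_line_mon d e : pull line_param (line_mon d e) = 'X^e.
Proof.
by rewrite !rmorphM !rmorphXn /= !pullXU !line_paramE expr1n mul1r.
Qed.

(** Split y^b into y^(b mod 2) and a power of y^2; x z - y^2 divides (x z)^r - (y^2)^r. *)
Lemma conic_mon_modulo (m : 'X_{1..3}) : exists v,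
  'X_[m] = v * conic_form + conic_mon (mdeg m) (m o1 + (m o2).*2).
Proof.
rewrite /conic_mon mpolyX3 mdeg3.
set a := m o0; set b := m o1; set c := m o2.
pose r := b./2; pose x : {mpoly k[3]} := 'X_o0 ^+ a * 'X_o1 ^+ odd b * 'X_o2 ^+ c.
have -> : odd (b + c.*2) = odd b by lia.
have -> : (b + c.*2)./2 = (r + c)%N by rewrite /r; lia.
have -> : (a + b + c - uphalf (b + c.*2) = a + r)%N by rewrite /r; lia.
have -> : 'X_o1 ^+ b = 'X_o1 ^+ odd b * ('X_o1 ^+ 2) ^+ r :> {mpoly k[3]}.
  by rewrite -exprM -exprD; congr ('X_o1 ^+ _); rewrite /r; lia.
have := subrXX ('X_o0 * 'X_o2 : {mpoly k[3]}) ('X_o1 ^+ 2) r.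
set S := \sum_(i < r) _ => hS; exists (- x * S).
have -> : - x * S * conic_form = - x * (conic_form * S) by rewrite mulrAC mulrA.
rewrite /conic_form -hS /x !exprMn !exprD; ring.
Qed.

(** A form is a multiple of x z - y^2 plus the combination of normal monomials read off its
    pullback. This one decomposition gives the degree bound, the lifting and the kernel. *)
Lemma conic_good_param : good_param 2 conic_form conic_param.
Proof.
pose lift d (w : {poly k}) := \sum_(e < d.*2.+1) w`_e *: conic_mon d e.
have liftD d w w' : lift d (w + w') = lift d w + lift d w'.
  by rewrite -big_split; apply: eq_bigr => e _ /=; rewrite coefD scalerDl.
have lift_homog d w : lift d w \is d.-homog.
  by apply: rpred_sum => e _; rewrite dhomogZ // conic_mon_homog // -ltnS.
have decomp d a : a \is d.-homog -> (size (pull conic_param a) <= (2 * d).+1)%N /\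
    exists v, a = v * conic_form + lift d (pull conic_param a).
  move: a; apply: dhomog_ind => [|p q [hp [v vE]] [hq [w wE]]|c m <-].
  - rewrite raddf0 size_poly0; split=> //; exists 0.
    by rewrite mul0r add0r /lift big1 // => e _; rewrite coef0 scale0r.
  - rewrite raddfD; split; first by rewrite (leq_trans (size_polyD _ _)) // geq_max hp.
    by exists (v + w); rewrite liftD {1}vE {1}wE mulrDl addrACA.
  have [v vE] := conic_mon_modulo m.
  have le : (m o1 + (m o2).*2 < (mdeg m).*2.+1)%N by rewrite mdeg3; lia.
  have pE : pull conic_param 'X_[m] = 'X^(m o1 + (m o2).*2).
    rewrite vE rmorphD rmorphM /= pull_conic_mon /conic_form rmorphB rmorphM rmorphXn /=.
    by rewrite !pullXU !conic_paramE mul1r subrr mulr0 add0r.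
  rewrite mmapZ pE mul_polyC; split.
    by rewrite (leq_trans (size_scale_leq _ _)) // size_polyXn mul2n.
  exists (c *: v); rewrite {1}vE scalerDr scalerAl; congr (_ + _).
  rewrite /lift (bigD1 (Ordinal le)) //= coefZ coefXn eqxx mulr1 big1 ?addr0 //.
  by move=> e he; rewrite coefZ coefXn -(inj_eq val_inj) in he *; rewrite (negPf he) mulr0 scale0r.
split.
- by rewrite rmorphB rmorphM rmorphXn /= !pullXU !conic_paramE mul1r subrr.
- by move=> d a /decomp [].
- move=> d w sw; exists (lift d w) => //; rewrite raddf_sum.
  under eq_bigr do rewrite /= mmapZ pull_conic_mon mul_polyC.
  by rewrite -poly_def; apply/polyP => i; rewrite coef_poly -mul2n; case: ltnP => // h;
    rewrite nth_default // (leq_trans sw).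
move=> d a /decomp [_ [v aE]] a0; exists v.
by rewrite aE a0 /lift big1 ?addr0 // => e _; rewrite coef0 scale0r.
Qed.

Lemma line_mon_modulo (m : 'X_{1..3}) : exists v,
  'X_[m] = v * 'X_o2 + (m o2 == 0%N)%:R *: line_mon (mdeg m) (m o1).
Proof.
rewrite mpolyX3; have [z0|z0] := eqVneq (m o2) 0%N.
  exists 0; rewrite mul0r add0r scale1r z0 mulr1 /line_mon mdeg3 z0.
  by rewrite addn0 addnK.
exists ('X_o0 ^+ m o0 * 'X_o1 ^+ m o1 * 'X_o2 ^+ (m o2).-1).
by rewrite scale0r addr0 -[RHS]mulrA -exprSr prednK // lt0n.
Qed.

Lemma line_good_param : good_param 1 'X_o2 line_param.
Proof.
pose lift d (w : {poly k}) := \sum_(e < d.+1) w`_e *: line_mon d e.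
have liftD d w w' : lift d (w + w') = lift d w + lift d w'.
  by rewrite -big_split; apply: eq_bigr => e _ /=; rewrite coefD scalerDl.
have lift_homog d w : lift d w \is d.-homog.
  apply: rpred_sum => e _; rewrite dhomogZ // -[d in d.-homog](@subnK e) -1?ltnS //.
  by rewrite dhomogM ?homogXn.
have decomp d a : a \is d.-homog -> (size (pull line_param a) <= (1 * d).+1)%N /\
    exists v, a = v * 'X_o2 + lift d (pull line_param a).
  move: a; apply: dhomog_ind => [|p q [hp [v vE]] [hq [w wE]]|c m <-].
  - rewrite raddf0 size_poly0; split=> //; exists 0.
    by rewrite mul0r add0r /lift big1 // => e _; rewrite coef0 scale0r.
  - rewrite raddfD; split; first by rewrite (leq_trans (size_polyD _ _)) // geq_max hp.
    by exists (v + w); rewrite liftD {1}vE {1}wE mulrDl addrACA.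
  have [v vE] := line_mon_modulo m.
  have le : (m o1 < (mdeg m).+1)%N by rewrite mdeg3; lia.
  have pE : pull line_param 'X_[m] = (m o2 == 0%N)%:R *: 'X^(m o1).
    rewrite vE rmorphD rmorphM /= mmapZ pull_line_mon pullXU line_paramE.
    by rewrite mulr0 add0r mul_polyC.
  rewrite mmapZ pE mul_polyC; split.
    by rewrite !(leq_trans (size_scale_leq _ _)) // size_polyXn mul1n.
  exists (c *: v); rewrite {1}vE scalerDr scalerAl; congr (_ + _).
  rewrite /lift (bigD1 (Ordinal le)) //= !coefZ coefXn eqxx mulr1 big1 ?addr0 ?scalerA //.
  by move=> e he; rewrite !coefZ coefXn -(inj_eq val_inj) in he *; rewrite (negPf he) !mulr0 scale0r.
split.
- by rewrite pullXU line_paramE.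
- by move=> d a /decomp [].
- move=> d w sw; exists (lift d w) => //; rewrite raddf_sum.
  under eq_bigr do rewrite /= mmapZ pull_line_mon mul_polyC.
  by rewrite -poly_def; apply/polyP => i; rewrite coef_poly; case: ltnP => // h;
    rewrite nth_default // (leq_trans sw) // mul1n.
move=> d a /decomp [_ [v aE]] a0; exists v.
by rewrite aE a0 /lift big1 ?addr0 // => e _; rewrite coef0 scale0r.
Qed.

End StandardParams.

(** * Hermitian forms and their totally tangent conics *)

Section Vectors3.
Variable k : fieldType.
Implicit Types (x y : 'rV[k]_3).

Definition row3 (a b c : k) : 'rV[k]_3 := \row_j nth 0 [:: a; b; c] j.
Definition mat3 x y z : 'M[k]_3 := \matrix_(i, j) nth 0 [:: x; y; z] i 0 j.

Lemma row3E a b c : (row3 a b c 0 o0 = a) * (row3 a b c 0 o1 = b) * (row3 a b c 0 o2 = c).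
Proof. by rewrite !mxE. Qed.

Lemma row3P x y : x 0 o0 = y 0 o0 -> x 0 o1 = y 0 o1 -> x 0 o2 = y 0 o2 -> x = y.
Proof. by move=> h0 h1 h2; apply/rowP; apply: forall_ord3. Qed.

Lemma row_mat3 x y z :
  (row o0 (mat3 x y z) = x) * (row o1 (mat3 x y z) = y) * (row o2 (mat3 x y z) = z).
Proof. by split; [split|]; apply/rowP => j; rewrite !mxE. Qed.

Lemma mul_mat3 u x y z : u *m mat3 x y z = u 0 o0 *: x + u 0 o1 *: y + u 0 o2 *: z.
Proof. by apply/rowP => j; rewrite !mxE sum_ord3 !mxE. Qed.

Lemma mat3_mul x y z (A : 'M_3) : mat3 x y z *m A = mat3 (x *m A) (y *m A) (z *m A).
Proof.
by apply/row_matrixP; apply: forall_ord3; rewrite row_mul !row_mat3.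
Qed.

Lemma mat3_eta (A : 'M_3) : A = mat3 (row o0 A) (row o1 A) (row o2 A).
Proof. by apply/row_matrixP; apply: forall_ord3; rewrite !row_mat3. Qed.

Lemma row3_mul a b c (A : 'M[k]_3) :
  row3 a b c *m A = a *: row o0 A + b *: row o1 A + c *: row o2 A.
Proof. by rewrite {1}[A]mat3_eta mul_mat3 !row3E. Qed.

End Vectors3.

Section Hermitian.
Variables (k : fieldType) (char5 : 5%N \in [pchar k]).
Implicit Types (M N H : 'M[k]_3) (x y : 'rV[k]_3).

Definition frob : {rmorphism k -> k} := pFrobenius_aut char5.
Lemma frobE a : frob a = a ^+ 5. Proof. by []. Qed.

Definition ctr m n (A : 'M[k]_(m, n)) : 'M[k]_(n, m) := (map_mx frob A)^T.

Lemma ctrM m n p (A : 'M[k]_(m, n)) (B : 'M_(n, p)) : ctr (A *m B) = ctr B *m ctr A.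
Proof. by rewrite /ctr map_mxM trmx_mul. Qed.

Lemma ctr_unit n (A : 'M[k]_n) : (ctr A \in unitmx) = (A \in unitmx).
Proof. by rewrite /ctr unitmx_tr map_unitmx. Qed.

Definition hform H : {mpoly k[3]} := \sum_i \sum_j H i j *: ('X_i * 'X_j ^+ 5).

Lemma hform_homog H : hform H \is 6.-homog.
Proof.
apply: rpred_sum => i _; apply: rpred_sum => j _; apply: dhomogZ.
exact: dhomogM (homogX _ _) (homogXn _ _ _).
Qed.

Lemma ev_hform H x : ev (hform H) x = (x *m H *m ctr x) 0 0.
Proof.
rewrite /ev /hform raddf_sum mxE; under [RHS]eq_bigr do rewrite !mxE mulr_suml.
rewrite exchange_big; apply: eq_bigr => i _; rewrite raddf_sum.
apply: eq_bigr => j _ /=; rewrite mevalZ mevalM rmorphXn /= !mevalXU frobE.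
by rewrite mulrCA mulrA.
Qed.

(** In characteristic 5 the fifth power of a linear form is a linear combination of the X_b^5, so
    substitution acts on [H] as on the matrix of a sesquilinear form. *)
Lemma lin_hform M H : lin M (hform H) = hform (M *m H *m ctr M).
Proof.
have chP : 5%N \in [pchar {mpoly k[3]}].
  exact: (rmorph_pchar [the {rmorphism k -> {mpoly k[3]}} of @mpolyC 3 k]) char5.
have lin5 (j : 'I_3) : lin M ('X_j ^+ 5) = \sum_b (M b j ^+ 5) *: 'X_b ^+ 5.
  rewrite rmorphXn /= linXU -(pFrobenius_autE chP) rmorph_sum; apply: eq_bigr => b _.
  by rewrite /= pFrobenius_autE exprZn.
transitivity (\sum_a \sum_b \sum_i \sum_j
    (M a i * H i j * M b j ^+ 5) *: ('X_a * 'X_b ^+ 5 : {mpoly k[3]})).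
  rewrite raddf_sum.
  under eq_bigr => i _.
    rewrite raddf_sum /=; under eq_bigr => j _.
      rewrite comp_mpolyZ rmorphM /= linXU lin5 mulr_suml scaler_sumr.
      under eq_bigr => a _.
        rewrite mulr_sumr scaler_sumr.
        under eq_bigr => b _ do rewrite -scalerAl -scalerAr !scalerA mulrAC [_ * M a i]mulrC.
        over.
      over.
    rewrite exchange_big; over.
  rewrite exchange_big; apply: eq_bigr => a _ /=.
  under eq_bigr do rewrite exchange_big.
  rewrite exchange_big; apply: eq_bigr => b _; apply: eq_bigr => i _.
  by apply: eq_bigr => j _; rewrite mulrA.
apply: eq_bigr => a _; apply: eq_bigr => b _.
rewrite mxE scaler_suml exchange_big; apply: eq_bigr => j _ /=.
by rewrite -scaler_suml !mxE frobE mulr_suml.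
Qed.

Definition stdH : 'M[k]_3 :=
  mat3 (row3 0 0 1) (row3 0 3%:R 0) (row3 1 0 0).

(* Equivalently, the curve [hform H = 0], in the coordinates whose basis is the
   rows of [M], is [x z^5 - 2 y^6 + z x^5 = 0]; the conic [x z = y^2] is then
   totally tangent to it, at the points of the conic with parameter in P^1(F_5). *)
Definition frame H M := exists2 l, l != 0 & M *m H *m ctr M = l *: stdH.

End Hermitian.

Section Cards.
Local Open Scope classical_set_scope.
Local Open Scope card_scope.

Lemma card_image_seq (T : eqType) (U : Type) (s : seq T) (f : T -> U) (A : set U) :
  uniq s -> {in s &, injective f} ->
  (forall y, A y <-> exists2 x, x \in s & y = f x) -> A #= `I_(size s).
Proof.
case: s => [|x0 s] us fi hA.
  suff -> : A = set0 by rewrite II0.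
  by apply/seteqP; split=> y // /hA [].
have -> : A = [set f (nth x0 (x0 :: s) i) | i in `I_(size (x0 :: s))].
  apply/seteqP; split=> y.
    move=> /hA [x xs ->]; exists (index x (x0 :: s)); first by move: xs; rewrite -index_mem.
    by rewrite nth_index.
  by move=> [i hi <-]; apply/hA; exists (nth x0 (x0 :: s) i); rewrite ?mem_nth.
apply: inj_card_eq => i j; rewrite !inE /= => hi hj /fi.
rewrite !mem_nth // => /(_ isT isT)/eqP.
by rewrite nth_uniq // => /eqP.
Qed.

Lemma card_II_inj (U : Type) (A : set U) n m : A #= `I_n -> A #= `I_m -> n = m.
Proof. by move=> hn hm; apply/card_eq_II; rewrite -(card_eql hn). Qed.

End Cards.

(** * The conic attached to a frame *)

Section Frames.
Local Open Scope classical_set_scope.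
Local Open Scope card_scope.
Variables (k : fieldType) (char5 : 5%N \in [pchar k]).
Implicit Types (M N H : 'M[k]_3) (x y : 'rV[k]_3).
Notation frame := (frame char5).
Notation frob := (frob char5).
Notation ctr := (ctr char5).

Lemma five0 : 5%:R = 0 :> k. Proof. exact: pcharf0 char5. Qed.

Lemma two_neq0 : 2%:R != 0 :> k.
Proof. by rewrite -(dvdn_pcharf char5). Qed.

Lemma three_neq0 : 3%:R != 0 :> k.
Proof. by rewrite -(dvdn_pcharf char5). Qed.

Lemma three_mtwo : 3%:R = - 2%:R :> k.
Proof. by apply/eqP; rewrite -subr_eq0 opprK -natrD five0. Qed.

Lemma mul_stdH x : x *m stdH k = row3 (x 0 o2) (3%:R * x 0 o1) (x 0 o0).
Proof.
rewrite mul_mat3; apply: row3P; rewrite !row3E !mxE /= ?mulr0 ?mulr1 ?addr0 ?add0r //.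
by rewrite mulrC.
Qed.

Lemma stdH_unit : stdH k \in unitmx.
Proof.
apply: (proj1 (mulmx1_unit (B := mat3 (row3 0 0 1) (row3 0 2%:R 0) (row3 1 0 0)) _)).
rewrite [stdH k]/stdH mat3_mul; apply/row_matrixP; apply: forall_ord3;
  rewrite row1 !row_mat3 row3_mul !row_mat3; apply: row3P;
  rewrite !mxE /= ?mulr0 ?mul0r ?mulr1 ?addr0 ?add0r //.
have -> : 3%:R * 2%:R = 1 + 5%:R :> k by ring.
by rewrite five0 addr0.
Qed.

Lemma frame_unit H M : frame H M -> M \in unitmx.
Proof.
move=> [l l0 e]; have : M *m H *m ctr M \in unitmx.
  by rewrite e unitmxZ ?unitfE // stdH_unit.
by rewrite !unitmx_mul => /andP[/andP[]].
Qed.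

Lemma frame_mul H M N : frame H M -> frame (stdH k) N -> frame H (N *m M).
Proof.
move=> [l l0 e] [l' l'0 e']; exists (l * l'); first by rewrite mulf_neq0.
rewrite ctrM !mulmxA -(mulmxA N M) -(mulmxA N (M *m H)) e.
by rewrite -scalemxAr -scalemxAl e' scalerA.
Qed.

Lemma ctrZ m n c (A : 'M[k]_(m, n)) : ctr (c *: A) = frob c *: ctr A.
Proof. by rewrite /ctr map_mxZ linearZ. Qed.

Lemma frameZ H c M : c != 0 -> frame H M -> frame H (c *: M).
Proof.
move=> c0 [l l0 e]; exists (c * frob c * l).
  by rewrite !mulf_neq0 // fmorph_eq0.
by rewrite ctrZ -scalemxAl -scalemxAl -scalemxAr e !scalerA.
Qed.

(* [None] is the point at infinity of the conic. *)
Definition vpt (o : option k) : 'rV[k]_3 :=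
  if o is Some s then row3 1 s (s ^+ 2) else row3 0 0 1.

Lemma vpt_neq0 o : vpt o != 0.
Proof.
case: o => [s|]; apply/eqP => /rowP.
  by move/(_ o0)/eqP; rewrite row3E mxE oner_eq0.
by move/(_ o2)/eqP; rewrite row3E mxE oner_eq0.
Qed.

Lemma mul_unit_neq0 x M : M \in unitmx -> (x *m M == 0) = (x == 0).
Proof.
move=> uM; apply/eqP/eqP => [/(congr1 (fun y => y *m invmx M))|->].
  by rewrite mulmxK // mul0mx.
by rewrite mul0mx.
Qed.

Lemma vptM_neq0 o M : M \in unitmx -> vpt o *m M != 0.
Proof. by move=> uM; rewrite mul_unit_neq0 ?vpt_neq0. Qed.

Lemma pt_mul_inj M x y : M \in unitmx -> x != 0 -> y != 0 ->
  pt (x *m M) = pt (y *m M) <-> pt x = pt y.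
Proof.
move=> uM x0 y0; rewrite !pt_eqP ?mul_unit_neq0 //; split=> -[c c0].
  rewrite scalemxAl => /(congr1 (fun y => y *m invmx M)); rewrite !mulmxK // => ->.
  by exists c.
by move=> ->; exists c; rewrite // scalemxAl.
Qed.

Lemma pt_vpt_inj o o' : pt (vpt o) = pt (vpt o') -> o = o'.
Proof.
move/pt_eqP => /(_ (vpt_neq0 _) (vpt_neq0 _)) [c c0 /rowP e].
move: (e o0) (e o1); case: o o' {e} => [s|] [s'|] //;
  rewrite !mxE /= ?mulr0 ?mulr1.
- by move=> <-; rewrite mul1r => ->.
- by move=> /esym/eqP; rewrite (negPf c0).
- by move=> /eqP; rewrite oner_eq0.
Qed.

Lemma vptM_inj M o o' : M \in unitmx -> pt (vpt o *m M) = pt (vpt o' *m M) -> o = o'.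
Proof. by move=> uM /pt_mul_inj; rewrite !vpt_neq0 => /(_ uM isT isT) /pt_vpt_inj. Qed.

Definition cset M : set (proj_point k) := [set P | exists o, P = pt (vpt o *m M)].

Definition conic_eq M : {mpoly k[3]} := lin (invmx M) (conic_form k).

Lemma ev_conic_form x : ev (conic_form k) x = x 0 o0 * x 0 o2 - x 0 o1 ^+ 2.
Proof. by rewrite /ev /conic_form mevalB mevalM rmorphXn /= !mevalXU. Qed.

Lemma conic_form_homog : conic_form k \is 2.-homog.
Proof. by rewrite rpredB ?homogXn // (dhomogM (homogX _ _) (homogX _ _)). Qed.

Lemma conic_eq_homog M : conic_eq M \is 2.-homog.
Proof. exact/lin_homog/conic_form_homog. Qed.

Lemma locus_conic_eq M : M \in unitmx -> locus (conic_eq M) = cset M.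
Proof.
move=> uM; apply/seteqP; split=> [P|P [o ->]].
  case: (pt_surj P) => y; have [x ->] : exists x, y = x *m M.
    by exists (y *m invmx M); rewrite mulmxKV.
  rewrite mul_unit_neq0 // => x0 ->.
  rewrite (locus_pt (conic_eq_homog M)) ?mul_unit_neq0 // ev_lin mulmxK //.
  rewrite ev_conic_form => /eqP; rewrite subr_eq0 => /eqP e.
  have [z0|z0] := eqVneq (x 0 o0) 0.
    have z1 : x 0 o1 = 0 by apply/eqP; rewrite -sqrf_eq0 -e z0 mul0r.
    have xE : x = x 0 o2 *: vpt None.
      by apply: row3P; rewrite [RHS]mxE ?row3E ?mulr0 ?mulr1.
    have z2 : x 0 o2 != 0 by apply: contraNneq x0 => z2; rewrite xE z2 scale0r.
    by exists None; rewrite xE -scalemxAl ptZ // vptM_neq0.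
  exists (Some (x 0 o1 / x 0 o0)).
  have xE : x = x 0 o0 *: vpt (Some (x 0 o1 / x 0 o0)).
    apply: row3P; rewrite [RHS]mxE ?row3E ?mulr1 // mulrC ?divfK //.
    by rewrite expr_div_n -e expr2 -mulf_div divff // mul1r divfK.
  by rewrite {1}xE -scalemxAl ptZ // vptM_neq0.
apply/(locus_pt (conic_eq_homog M)); first exact: vptM_neq0.
rewrite ev_lin mulmxK // ev_conic_form; case: o => [s|]; rewrite /= !row3E.
  by rewrite mul1r subrr.
by rewrite mul0r expr0n subr0.
Qed.

Definition rational (o : option k) : Prop := if o is Some s then s ^+ 5 = s else True.

(** At (1, s, s^2) the equation takes the value s^10 - 2 s^6 + s^2 = (s^5 - s)^2. *)
Lemma ev_hform_frame H M l o : M *m H *m ctr M = l *: stdH k ->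
  ev (hform H) (vpt o *m M) = if o is Some s then l * (s ^+ 5 - s) ^+ 2 else 0.
Proof.
move=> e; rewrite ev_hform ctrM !mulmxA -(mulmxA (vpt o)) -(mulmxA (vpt o)) e.
rewrite -scalemxAr -scalemxAl mxE mul_stdH mxE sum_ord3 !mxE /= !frobE.
case: o => [s|] /=; rewrite !row3E ?expr0n /= ?(mulr0, mul0r, addr0) //.
by rewrite three_mtwo expr1n; congr (l * _); ring.
Qed.

Lemma cset_herm H M P : frame H M ->
  (cset M `&` locus (hform H)) P <-> exists2 o, rational o & P = pt (vpt o *m M).
Proof.
move=> fM; have uM := frame_unit fM; case: fM => l l0 e.
have key o : locus (hform H) (pt (vpt o *m M)) <-> rational o.
  rewrite (locus_pt (hform_homog H)) ?vptM_neq0 // (ev_hform_frame _ e).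
  case: o => [s|] //=; split=> [/eqP|->]; last by rewrite subrr expr0n mulr0.
  by rewrite mulf_eq0 (negPf l0) sqrf_eq0 subr_eq0 => /eqP.
split=> [[[o ->] /key ho]|[o ho ->]]; first by exists o.
by split; [exists o|apply/key].
Qed.

(** The numbering of [params]: infinity is number 0 and the parameter j is number j + 1. *)
Definition rparam (i : nat) : option k := if i is j.+1 then Some j%:R else None.

Lemma rparam_inj : {in iota 0 6 &, injective rparam}.
Proof.
have h a b : (a <= b < 5)%N -> a%:R = b%:R :> k -> a = b.
  move=> hab /eqP; rewrite eq_sym -subr_eq0 -natrB; last by lia.
  by rewrite -(dvdn_pcharf char5) => /dvdnP [[|c]]; lia.
move=> [|i] [|j]; rewrite !mem_iota //= => hi hj [] e; congr _.+1.
by case: (leqP i j) => hij; [apply: h e; lia|apply/esym/h; [lia|]].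
Qed.

Lemma rationalP o : rational o <-> exists2 i, i \in iota 0 6 & o = rparam i.
Proof.
split=> [|[[|i] hi ->] //=]; last first.
  by rewrite -!frobE ?rmorph_nat.
case: o => [s|]; last by exists 0%N.
move=> /= hs; have : s * (s - 1) * (s - 2%:R) * (s - 3%:R) * (s - 4%:R) = 0.
  (* The expanded product differs from s^5 - s by this multiple of 5. *)
  transitivity (s ^+ 5 - s + 5%:R * (- 2%:R * s ^+ 4 + 7%:R * s ^+ 3 - 10%:R * s ^+ 2 + 5%:R * s)); first by ring.
  by rewrite hs subrr five0 mul0r addr0.
move/eqP; rewrite !mulf_eq0 !subr_eq0 -!orbA => /or4P[|||/orP[]] /eqP ->.
- by exists 1%N. - by exists 2%N. - by exists 3%N. - by exists 4%N. - by exists 5%N.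
Qed.

End Frames.

(** * Ternary quadratic forms and their polar matrices *)

Section Quadratic.
Local Open Scope classical_set_scope.
Local Open Scope card_scope.
Variable k : fieldType.
Implicit Types (S M : 'M[k]_3).

(** [S] need not be symmetric; tangents and singular points are read off the polar matrix S +
    S^T. *)
Definition quad S : {mpoly k[3]} := \sum_i \sum_j S i j *: ('X_i * 'X_j).

Lemma quadD S T : quad (S + T) = quad S + quad T.
Proof.
rewrite -big_split; apply: eq_bigr => i _; rewrite -big_split.
by apply: eq_bigr => j _; rewrite mxE scalerDl.
Qed.

Lemma quadZ c S : quad (c *: S) = c *: quad S.
Proof.
rewrite scaler_sumr; apply: eq_bigr => i _; rewrite scaler_sumr.
by apply: eq_bigr => j _; rewrite mxE scalerA.
Qed.

Lemma quad_tr S : quad S^T = quad S.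
Proof.
rewrite /quad exchange_big; apply: eq_bigr => i _; apply: eq_bigr => j _.
by rewrite mxE mulrC.
Qed.

Lemma quad_surj q : q \is 2.-homog -> exists S, q = quad S.
Proof.
move: q; apply: dhomog_ind => [|p q [S ->] [T ->]|c m].
- by exists (0 *: 0); rewrite quadZ scale0r.
- by exists (S + T); rewrite quadD.
have hX i j : exists S, c *: ('X_i * 'X_j) = quad S.
  exists (c *: delta_mx i j); rewrite quadZ /quad (bigD1 i) //= (bigD1 j) //=.
  rewrite mxE !eqxx scale1r big1 => [|b bj]; last by rewrite mxE (negPf bj) andbF scale0r.
  rewrite addr0 big1 ?addr0 // => a ai; rewrite big1 // => b _.
  by rewrite mxE (negPf ai) scale0r.
move=> m2; have [i mi] : exists i, (0 < m i)%N.
  apply/existsP; rewrite -[X in is_true X]negbK negb_exists; apply/negP => /forallP h.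
  move: m2; rewrite mdegE big1 // => i _; by have := h i; rewrite lt0n negbK => /eqP.
have mE : m = (U_(i) + (m - U_(i)))%MM by rewrite addmC submK // lep1mP -lt0n.
have : mdeg (m - U_(i)) == 1%N by move: m2; rewrite {1}mE mdegD mdeg1 add1n => -[->].
by case/mdeg1P => j jE; rewrite mE (eqP jE) mpolyXD; apply: hX.
Qed.

Lemma lin_quad M S : lin M (quad S) = quad (M *m S *m M^T).
Proof.
transitivity (\sum_a \sum_b \sum_i \sum_j
    (M a i * S i j * M b j) *: ('X_a * 'X_b : {mpoly k[3]})).
  rewrite raddf_sum.
  under eq_bigr => i _.
    rewrite raddf_sum /=; under eq_bigr => j _.
      rewrite comp_mpolyZ rmorphM /= !linXU mulr_suml scaler_sumr.
      under eq_bigr => a _.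
        rewrite mulr_sumr scaler_sumr.
        under eq_bigr => b _ do rewrite -scalerAl -scalerAr !scalerA mulrAC [_ * M a i]mulrC.
        over.
      over.
    rewrite exchange_big; over.
  rewrite exchange_big; apply: eq_bigr => a _ /=.
  under eq_bigr do rewrite exchange_big.
  rewrite exchange_big; apply: eq_bigr => b _; apply: eq_bigr => i _.
  by apply: eq_bigr => j _; rewrite mulrA.
apply: eq_bigr => a _; apply: eq_bigr => b _.
rewrite mxE scaler_suml exchange_big; apply: eq_bigr => j _ /=.
by rewrite -scaler_suml !mxE mulr_suml.
Qed.

Lemma ev_quad S x : ev (quad S) x = (x *m S *m x^T) 0 0.
Proof.
rewrite /ev /quad raddf_sum mxE; under [RHS]eq_bigr do rewrite !mxE mulr_suml.
rewrite exchange_big; apply: eq_bigr => i _; rewrite raddf_sum.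
apply: eq_bigr => j _ /=; rewrite mevalZ mevalM !mevalXU.
by rewrite mulrCA mulrA.
Qed.

Lemma mderivXU (i l : 'I_3) : 'X_i^`M(l) = (i == l)%:R%:MP :> {mpoly k[3]}.
Proof.
rewrite mderivX mnm1E; have [->|il] := eqVneq i l; last by rewrite scale0r.
have -> : (U_(l) - U_(l) = 0 :> 'X_{1..3})%MM by apply/mnmP => a; rewrite mnmBE subnn mnm0E.
by rewrite scale1r mpolyX0.
Qed.

Lemma sum_delta (f : 'I_3 -> k) l : \sum_i f i * (i == l)%:R = f l.
Proof.
rewrite (bigD1 l) //= eqxx mulr1 big1 ?addr0 // => i il.
by rewrite (negPf il) mulr0.
Qed.

Lemma ev_mderiv_quad S l x : ev (quad S)^`M(l) x = (x *m (S + S^T)) 0 l.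
Proof.
rewrite /quad raddf_sum /ev raddf_sum /=.
transitivity (\sum_i \sum_j (S i j * x 0 j * (i == l)%:R + S i j * x 0 i * (j == l)%:R)).
  apply: eq_bigr => i _. rewrite (linear_sum (mderiv l)) /= raddf_sum; apply: eq_bigr => j _ /=.
  rewrite mderivZ mderivM !mderivXU mevalZ mevalD !mevalM !mevalC !mevalXU; ring.
under eq_bigr do rewrite big_split -mulr_suml sum_delta.
rewrite big_split sum_delta mulmxDr [RHS]mxE addrC; congr (_ + _).
  by rewrite mxE; apply: eq_bigr => i _; rewrite mxE mulrC.
by rewrite mxE; apply: eq_bigr => i _; rewrite mulrC.
Qed.

End Quadratic.

Section TangentConics.
Local Open Scope classical_set_scope.
Local Open Scope card_scope.
Variables (k : fieldType) (char5 : 5%N \in [pchar k]).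
Implicit Types (M N H : 'M[k]_3) (x y : 'rV[k]_3).
Notation frame := (frame char5).
Notation frob := (frob char5).
Notation ctr := (ctr char5).
Local Notation pull h := (mmap polyC h).

Definition conicC : 'M[k]_3 := mat3 (row3 0 0 1) (row3 0 (- 1) 0) (row3 0 0 0).

Lemma conic_form_quad : conic_form k = quad conicC.
Proof.
rewrite /quad !sum_ord3 !mxE /= !(scale0r, scale1r, scaleN1r, addr0, add0r).
by rewrite /conic_form expr2.
Qed.

(** As -2 = 3, one matrix is both the Hermitian matrix of the curve and the polar matrix of the
    conic. *)
Lemma conicC_sym : conicC + conicC^T = stdH k.
Proof.
apply/matrixP; apply: forall_ord3; apply: forall_ord3;
  rewrite !mxE /= ?addr0 ?add0r //.
by rewrite (three_mtwo char5) -opprD.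
Qed.

(** The factors X_j^5 have zero derivative, so only the linear factors contribute. *)
Lemma mderiv_hform H l x : ev (hform H)^`M(l) x = (H *m ctr x) l 0.
Proof.
rewrite /hform raddf_sum /ev raddf_sum /=.
transitivity (\sum_i (\sum_j H i j * x 0 j ^+ 5) * (i == l)%:R).
  apply: eq_bigr => i _; rewrite (linear_sum (mderiv l)) /= raddf_sum mulr_suml; apply: eq_bigr => j _ /=.
  rewrite mderivZ mderivM !exprS expr0 mulr1 !mderivM !mderivXU mevalZ.
  rewrite !(mevalD, mevalM, mevalC, mevalXU).
  transitivity (H i j * x 0 j ^+ 5 * (i == l)%:R +
    5%:R * (H i j * x 0 i * x 0 j ^+ 4 * (j == l)%:R)); first by ring.
  rewrite (five0 char5); ring.
rewrite sum_delta mxE; apply: eq_bigr => j _; by rewrite !mxE.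
Qed.

Lemma good_paramZ e (q : {mpoly k[3]}) h c : c != 0 -> good_param e q h -> good_param e (c *: q) h.
Proof.
move=> c0 [h0 h1 h2 h3]; split=> //; first by rewrite mmapZ h0 mulr0.
move=> d a ha /(h3 d _ ha) [u ->]; exists (c^-1 *: u).
by rewrite -scalerAl -scalerAr scalerA mulVf // scale1r.
Qed.

Lemma inter_mult_param P (q F : {mpoly k[3]}) e D n h s x g :
  good_param e q h -> (0 < e)%N -> x != 0 -> P = pt x ->
  (forall i, (h i).[s] = x 0 i) -> F \is D.-homog ->
  pull h F = ('X - s%:P) ^+ n * g -> g.[s] != 0 -> inter_mult_eq P q F n.
Proof.
move=> hq e0 x0 -> hs hF pF g0; have [c c0 cE] := vpick_pt x0.
apply: (inter_mult_of_order (c0 := c^-1) e0 hq _ _ hF pF g0).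
  by rewrite invr_eq0.
by move=> i; rewrite hs /hcoord cE mxE mulKf.
Qed.

Lemma horner_conic_param M s i :
  (param_mul (@conic_param k) M i).[s] = (vpt (Some s) *m M) 0 i.
Proof.
rewrite /param_mul horner_sum mxE; apply: eq_bigr => j _.
rewrite hornerZ mulrC; congr (_ * _); move: j; apply: forall_ord3;
by rewrite ?row3E conic_paramE !hornerE.
Qed.

Lemma horner_line_param M i :
  (param_mul (@line_param k) M i).[0] = (row o0 M) 0 i.
Proof.
rewrite /param_mul sum_ord3 !line_paramE !hornerE mxE.
by rewrite ?mulr1 ?mulr0 ?addr0.
Qed.

Lemma pull_hform u H : pull u (hform H) = \sum_i \sum_j H i j *: (u i * u j ^+ 5).
Proof.
rewrite raddf_sum; apply: eq_bigr => i _; rewrite raddf_sum; apply: eq_bigr => j _.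
by rewrite /= mmapZ rmorphM rmorphXn /= !pullXU mul_polyC.
Qed.

Lemma pull_conic_stdH l :
  pull (@conic_param k) (hform (l *: stdH k)) = l *: ('X ^+ 5 - 'X) ^+ 2.
Proof.
rewrite pull_hform !sum_ord3 !mxE /= !conic_paramE.
rewrite !(mulr0, mulr1, scale0r, addr0, add0r) (three_mtwo char5).
rewrite -!mul_polyC rmorphM rmorphN rmorph_nat /=; ring.
Qed.

Lemma pull_line_stdH l :
  pull (@line_param k) (hform (l *: stdH k)) = (l * 3%:R) *: 'X ^+ 6.
Proof.
rewrite pull_hform !sum_ord3 !mxE /= !line_paramE.
rewrite !(mulr0, mulr1, scale0r, addr0, add0r, mul0r, expr0n, scaler0).
by rewrite -exprS.
Qed.

(** In the coordinates of the frame this is the point (1, 0, 0) with tangent z = 0, on which the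
    equation of the curve restricts to a multiple of y^6. *)
Lemma weierstrass_row0 H M : frame H M -> weierstrass (hform H) (pt (row o0 M)).
Proof.
move=> fM; have uM := frame_unit fM; have [l l0 e] := fM.
have rE : row o0 M = vpt (Some 0) *m M.
  by rewrite row3_mul expr0n !scale0r scale1r !addr0.
have r0 : row o0 M != 0 by rewrite rE vptM_neq0.
split.
  have [_] : (cset M `&` locus (hform H)) (pt (row o0 M)); last by [].
  by apply/(cset_herm _ fM); exists (Some 0); rewrite ?rE //= expr0n.
have [c c0 cE] := vpick_pt r0.
have -> : tangent_form (hform H) (pt (row o0 M)) =
    (frob c * l) *: lin (invmx M) 'X_o2.
  (* The gradient at row 0 is proportional to the third column of [invmx M], the linear form giving
     the coordinate z in the frame. *)
  have eH : H *m ctr (row o0 M) = l *: col o2 (invmx M).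
    apply: (can_inj (mulKmx uM)); rewrite -scalemxAr colE mulKVmx //.
    rewrite rowE ctrM !mulmxA e -scalemxAl; congr (_ *: _).
    have -> : ctr (delta_mx 0 o0) = delta_mx o0 0 :> 'cV[k]_3.
      by apply/matrixP => i j; rewrite !mxE andbC frobE; case: (_ && _); rewrite ?expr1n ?expr0n.
    rewrite -colE; apply/matrixP; apply: forall_ord3 => j; rewrite (ord1 j) !mxE //=.
  rewrite linXU scaler_sumr; apply: eq_bigr => i _; rewrite scalerA; congr (_ *: _).
  by rewrite hcoord_ev cE mderiv_hform ctrZ -scalemxAr mxE eH !mxE mulrA.
have c'0 : frob c * l != 0 by rewrite mulf_neq0 // fmorph_eq0.
apply: (inter_mult_param (s := 0) (x := row o0 M) (D := 6)
  (good_paramZ c'0 (good_param_mul uM (line_good_param k)))) => //.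
- exact: horner_line_param.
- exact: hform_homog.
- by rewrite pull_lin lin_hform e pull_line_stdH subr0 -mul_polyC mulrC.
- by rewrite hornerC mulf_neq0 // three_neq0.
Qed.

End TangentConics.

(** * Every frame gives a totally tangent conic *)

Section Existence.
Local Open Scope classical_set_scope.
Local Open Scope card_scope.
Variables (k : fieldType) (char5 : 5%N \in [pchar k]).
Implicit Types (M N H : 'M[k]_3) (x y : 'rV[k]_3).
Notation frame := (frame char5).
Notation frob := (frob char5).
Notation ctr := (ctr char5).
Local Notation pull h := (mmap polyC h).

(** The substitution of 1 / s for s, a symmetry of both the conic and the standard form. It carries
    statements proved at finite parameters over to infinity. *)
Definition revm : 'M[k]_3 := mat3 (row3 0 0 1) (row3 0 1 0) (row3 1 0 0).

Lemma mul_revm x : x *m revm = row3 (x 0 o2) (x 0 o1) (x 0 o0).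
Proof.
rewrite mul_mat3; apply: row3P; rewrite row3E !mxE /= ?mulr0 ?mulr1 ?addr0 ?add0r //.
Qed.

Lemma revmK : revm *m revm = 1%:M.
Proof.
apply/row_matrixP; apply: forall_ord3; rewrite row_mul row1 !row_mat3 mul_revm !row3E;
  by apply: row3P; rewrite !mxE.
Qed.

Lemma revm_unit : revm \in unitmx.
Proof. exact: proj1 (mulmx1_unit revmK). Qed.

Lemma tr_revm : revm^T = revm.
Proof. by apply/matrixP; apply: forall_ord3; apply: forall_ord3; rewrite !mxE. Qed.

Lemma vpt_revm s : s != 0 ->
  (vpt (Some s) *m revm = s ^+ 2 *: vpt (Some s^-1)) *
  (vpt (Some 0) *m revm = vpt None) * (vpt None *m revm = vpt (Some (0 : k))).
Proof.
move=> s0; split; [split|]; rewrite mul_revm !row3E; apply: row3P;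
  rewrite ?mxE /= ?mulr1 ?expr0n //.
  by rewrite expr2 mulfK.
by rewrite exprVn mulfV // expf_neq0.
Qed.

Lemma ctr_revm : ctr revm = revm.
Proof.
apply/matrixP; apply: forall_ord3; apply: forall_ord3;
by rewrite !mxE /= frobE ?expr0n ?expr1n.
Qed.

Lemma frame_revm : frame (stdH k) revm.
Proof.
exists 1; rewrite ?oner_neq0 // scale1r ctr_revm.
apply/row_matrixP; apply: forall_ord3; rewrite !row_mul !row_mat3 mul_stdH mul_revm !row3E;
by rewrite ?mulr0 ?mulr1.
Qed.

Lemma mul_conicC x : x *m conicC k = row3 0 (- x 0 o1) (x 0 o0).
Proof.
by rewrite mul_mat3; apply: row3P; rewrite row3E !mxE /= ?mulr0 ?mulr1 ?mulrN1 ?addr0 ?add0r.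
Qed.

Lemma lin_revm : lin revm (conic_form k) = conic_form k.
Proof.
rewrite conic_form_quad lin_quad tr_revm -[RHS]quad_tr; congr quad.
apply/row_matrixP; apply: forall_ord3; rewrite !row_mul !row_mat3 mul_conicC mul_revm !row3E;
by apply: row3P; rewrite !mxE /= ?oppr0.
Qed.

Lemma conic_eq_revm M : M \in unitmx -> conic_eq (revm *m M) = conic_eq M.
Proof.
move=> uM; rewrite /conic_eq; have -> : invmx (revm *m M) = invmx M *m revm.
  have uR := revm_unit; apply: (can_inj (mulKmx (_ : revm *m M \in unitmx))).
    by rewrite unitmx_mul uR.
  by rewrite mulmxV ?unitmx_mul ?uR // mulmxA mulmxK // revmK.
by rewrite -lin_comp lin_revm.
Qed.

Lemma cset_revm M : M \in unitmx -> cset (revm *m M) = cset M.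
Proof.
move=> uM; rewrite -!locus_conic_eq ?conic_eq_revm //.
by rewrite unitmx_mul revm_unit.
Qed.

Lemma poly_five0 : 5%:R = 0 :> {poly k}.
Proof. by rewrite -polyC_natr (five0 char5). Qed.

(** X^5 - X is invariant under translation by an element of F_5. *)
Lemma XpsubX_factor (s : k) : s ^+ 5 = s ->
  'X ^+ 5 - 'X = ('X - s%:P) * (('X - s%:P) ^+ 4 - 1).
Proof.
move=> hs; have hs' : s%:P ^+ 5 = s%:P by rewrite -rmorphXn /= hs.
apply/eqP; rewrite -subr_eq0; apply/eqP.
transitivity (s%:P ^+ 5 - s%:P + 5%:R * (s%:P * 'X^4 - 2%:R * s%:P ^+ 2 * 'X^3 +
   2%:R * s%:P ^+ 3 * 'X^2 - s%:P ^+ 4 * 'X)); first by ring.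
by rewrite hs' subrr poly_five0 mul0r addr0.
Qed.

Lemma inter_mult_cset H M o : frame H M -> rational o ->
  inter_mult_eq (pt (vpt o *m M)) (conic_eq M) (hform H) 2.
Proof.
move=> fM ho; have key N s : frame H N -> s ^+ 5 = s ->
    inter_mult_eq (pt (vpt (Some s) *m N)) (conic_eq N) (hform H) 2.
  move=> fN hs; have uN := frame_unit fN; have [l l0 e] := fN.
  apply: (inter_mult_param (s := s) (x := vpt (Some s) *m N) (D := 6)
    (g := l *: (('X - s%:P) ^+ 4 - 1) ^+ 2)
    (good_param_mul uN (conic_good_param k))) => //.
  - exact: vptM_neq0.
  - exact: horner_conic_param.
  - exact: hform_homog.
  - rewrite pull_lin lin_hform e pull_conic_stdH // (XpsubX_factor hs).
    by rewrite exprMn scalerAr.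
  - by rewrite !hornerE subrr expr0n /= sub0r -mulrA mulrNN !mulr1.
case: o ho => [s|_]; first exact: key.
have uM := frame_unit fM; rewrite -(vpt_revm (oner_neq0 k)) -mulmxA -conic_eq_revm //.
apply: key; last by rewrite expr0n.
exact: frame_mul fM frame_revm.
Qed.

Definition rpt M i := pt (vpt (rparam k i) *m M).

Lemma rpt_inj M : M \in unitmx -> {in iota 0 6 &, injective (rpt M)}.
Proof.
by move=> uM i j hi hj /(vptM_inj uM) /(rparam_inj char5); apply.
Qed.

Lemma cset_rpt H M P : frame H M ->
  (cset M `&` locus (hform H)) P <-> exists2 i, i \in iota 0 6 & P = rpt M i.
Proof.
move=> fM; rewrite (cset_herm _ fM); split=> [[o /(rationalP char5) [i hi ->] ->]|[i hi ->]].
  by exists i.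
by exists (rparam k i) => //; apply/(rationalP char5); exists i.
Qed.

Lemma nonsingular_conic_eq M : M \in unitmx -> nonsingular (conic_eq M).
Proof.
move=> uM P _; rewrite /conic_eq conic_form_quad lin_quad.
set S := _ *m _ *m _; apply: contrapT => h.
have : vpick (val P) *m (S + S^T) = 0.
  apply/rowP => i; rewrite [RHS]mxE -ev_mderiv_quad; apply/eqP; apply: contrapT => /negP hi.
  by apply: h; exists i.
have -> : S + S^T = invmx M *m stdH k *m (invmx M)^T.
  rewrite -(conicC_sym char5) mulmxDr mulmxDl; congr (_ + _).
  by rewrite /S !trmx_mul trmxK mulmxA.
move/eqP; rewrite mul_unit_neq0 ?(negPf (vpick_neq0 P)) //.
by rewrite !unitmx_mul unitmx_tr unitmx_inv uM (stdH_unit char5).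
Qed.

Lemma cset_totally_tangent H M : frame H M ->
  totally_tangent_conics (hform H) (cset M).
Proof.
move=> fM; have uM := frame_unit fM; exists (conic_eq M); split.
- exact: conic_eq_homog.
- exact: nonsingular_conic_eq.
- by rewrite locus_conic_eq.
- exact: (card_image_seq (iota_uniq 0 6) (rpt_inj uM) (fun P => cset_rpt P fM)).
- by move=> P /(cset_herm P fM) [o ho ->]; apply: inter_mult_cset.
Qed.

(** The equation of the second conic pulls back along the first to a polynomial of degree at most 4
    that vanishes at the parameters 0, ..., 4. It is therefore zero, and the equation is a multiple
    of that of the first conic. *)
Lemma cset_sub_rpt A B : A \in unitmx -> B \in unitmx ->
  {in iota 0 6, forall i, cset B (rpt A i)} -> cset A `<=` cset B.
Proof.
move=> uA uB h; have hev o : cset B (pt (vpt o *m A)) <-> ev (lin A (conic_eq B)) (vpt o) = 0.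
  by rewrite -locus_conic_eq // (locus_pt (conic_eq_homog B)) ?vptM_neq0 // ev_lin.
have hAB : lin A (conic_eq B) \is 2.-homog by apply/lin_homog/conic_eq_homog.
have [|u uE] := param_ker (conic_good_param k) hAB.
  apply: (@roots_geq_poly_eq0 _ _ [seq i%:R | i <- iota 0 5]).
  - apply/allP => _ /mapP [i hi ->]; rewrite /root horner_pull; apply/eqP.
    have hB : cset B (rpt A i.+1) by apply: h; move: hi; rewrite !mem_iota; lia.
    rewrite -(proj1 (hev (rparam k i.+1)) hB).
    apply: meval_eq; apply: forall_ord3;
    by rewrite ?row3E conic_paramE !hornerE.
  - rewrite map_inj_in_uniq ?iota_uniq // => i j hi hj e.
    suff [] : i.+1 = j.+1 by [].
    by apply: (rparam_inj char5); rewrite /= ?e //; move: hi hj; rewrite !mem_iota; lia.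
  by rewrite size_map size_iota (param_size (conic_good_param k) hAB).
move=> P [o ->]; apply/hev; rewrite uE /ev mevalM -[X in _ * X]/(ev _ _) ev_conic_form.
case: o => [s|]; rewrite !row3E; first by rewrite mul1r subrr mulr0.
by rewrite mul0r expr0n subr0 mulr0.
Qed.

(** The matching of contact points is an injection between sets of six elements, hence onto, which
    supplies the hypothesis for the reverse inclusion. *)
Lemma cset_eq_rpt A B : A \in unitmx -> B \in unitmx ->
  {in iota 0 6, forall i, exists2 j, j \in iota 0 6 & rpt A i = rpt B j} ->
  cset A = cset B.
Proof.
move=> uA uB h; apply/seteqP; split; apply: cset_sub_rpt => // i hi.
  by have [j _ ->] := h i hi; exists (rparam k j).
have /choice [f hf] (a : 'I_6) : exists b : 'I_6, rpt A a = rpt B b.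
  have [|j] := h a; first by rewrite mem_iota ltn_ord.
  by rewrite mem_iota => hj e; exists (Ordinal hj).
have fi : injective f.
  move=> a b e; apply/val_inj/(rpt_inj uA); rewrite ?mem_iota ?ltn_ord //.
  by rewrite !hf e.
move: hi; rewrite mem_iota => hi.
have /mapP [a _ e] := injF_onto fi (Ordinal hi).
by exists (rparam k a); rewrite -[RHS]/(rpt A a) hf -e.
Qed.

End Existence.

(** * Every totally tangent conic comes from a frame *)

Section Classification.
Local Open Scope classical_set_scope.
Local Open Scope card_scope.
Variables (k : closedFieldType) (char5 : 5%N \in [pchar k]).
Implicit Types (M N H A S : 'M[k]_3) (x y : 'rV[k]_3).
Notation frame := (frame char5).
Notation frob := (frob char5).
Notation ctr := (ctr char5).
Local Notation pull h := (mmap polyC h).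

Lemma root_exists n (a : k) : (0 < n)%N -> exists c, c ^+ n = a.
Proof.
move=> n0; have : size ('X^n - a%:P) != 1 by rewrite size_XnsubC // eqSS -lt0n.
by case/closed_rootP => c; rewrite rootE hornerD hornerN hornerC hornerXn subr_eq0 => /eqP; exists c.
Qed.

Lemma gram_entry A M i j :
  (M *m A *m M^T) i j = (row i M *m A *m (row j M)^T) 0 0.
Proof. by rewrite tr_row -!row_mul !mxE; apply: eq_bigr => a _; rewrite !mxE. Qed.

Lemma mat3E x y z j :
  (mat3 x y z o0 j = x 0 j) * (mat3 x y z o1 j = y 0 j) * (mat3 x y z o2 j = z 0 j).
Proof. by rewrite !mxE. Qed.

(* The middle row is the pole of the line joining [x] and [z]. *)
Lemma hyperbolic_frame A x z : A \in unitmx -> A^T = A -> x != 0 -> z != 0 ->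
  pt x <> pt z -> x *m A *m x^T = 0 -> z *m A *m z^T = 0 ->
  exists M b, [/\ M \in unitmx, b != 0, row o0 M = x, row o2 M = z &
    M *m A *m M^T = b *: stdH k].
Proof.
move=> uA sA x0 z0 xz xx zz.
have symA u v : u *m A *m v^T = (v *m A *m u^T)^T.
  by rewrite !trmx_mul trmxK sA mulmxA.
have [y [y0 yx yz]] : exists y, [/\ y != 0, y *m A *m x^T = 0 & y *m A *m z^T = 0].
  pose B := row_mx (A *m x^T) (A *m z^T).
  have : kermx B != 0.
    rewrite kermx_eq0 -row_leq_rank -ltnNge (leq_ltn_trans (rank_leq_col B)) //.
  case/rowV0Pn => y /sub_kermxP; rewrite mul_mx_row => /eqP.
  by rewrite row_mx_eq0 !mulmxA => /andP[/eqP yx /eqP yz] y0; exists y.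
pose b := (x *m A *m z^T) 0 0.
have xzE : x *m A *m z^T = b%:M by rewrite [LHS]mx11_scalar.
have zxE : z *m A *m x^T = b%:M by rewrite symA xzE tr_scalar_mx.
(* Otherwise [x] and [z] span a totally isotropic plane, whose dimension 2 is too large for a
   nondegenerate form in three variables. *)
have b0 : b != 0.
  apply/negP => /eqP b0.
  pose X := col_mx x z.
  have : X *m (A *m X^T) = 0.
    rewrite mulmxA mul_col_mx tr_col_mx mul_col_row xx zz xzE zxE b0.
    by rewrite (_ : 0%:M = 0) ?block_mx0 //; apply/matrixP => i j; rewrite !mxE mul0rn.
  have rX : row_free X.
    apply: inj_row_free => v; rewrite -[v]hsubmxK mul_row_col.
    rewrite [lsubmx v]mx11_scalar [rsubmx v]mx11_scalar !mul_scalar_mx.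
    set a := lsubmx v 0 0; set c := rsubmx v 0 0 => e.
    have c0 : c = 0.
      apply/eqP; apply: contra_notT (xz) => c0.
      have zE : z = (- (a / c)) *: x.
        apply: (scalerI c0); rewrite scalerA mulrN mulrCA divff // mulr1 scaleNr.
        by apply/eqP; rewrite -addr_eq0 addrC e.
      rewrite {1}zE ptZ //; apply: contraNneq z0 => ac0; by rewrite zE ac0 scale0r.
    move: e; rewrite c0 scale0r addr0 => /eqP; rewrite scaler_eq0 (negPf x0) orbF => /eqP ->.
    by rewrite (_ : 0%:M = 0) ?row_mx0 //; apply/matrixP => i j; rewrite !mxE mul0rn.
  move/mulmx0_rank_max; rewrite -[X in (_ + X <= _)%N]mxrank_tr trmx_mul trmxK mxrankMfree; last first.
    by rewrite row_free_unit unitmx_tr.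
  by rewrite (eqP rX).
have sc0 (c : k) : c *: (b%:M : 'M_1) = 0 -> c = 0.
  move=> /matrixP/(_ 0 0)/eqP.
  by rewrite !mxE eqxx mulr1n mulf_eq0 (negPf b0) orbF => /eqP.
have uM (v : 'rV[k]_3) : v *m mat3 x y z = 0 -> v = 0.
  rewrite mul_mat3 => hv.
  have hx (u : 'rV[k]_3) : v 0 o0 *: (x *m A *m u^T) + v 0 o1 *: (y *m A *m u^T) +
      v 0 o2 *: (z *m A *m u^T) = 0.
    by rewrite !scalemxAl -!mulmxDl hv !mul0mx.
  have := hx z; rewrite xzE yz zz !scaler0 !addr0 => /sc0 v0.
  have := hx x; rewrite zxE yx xx !scaler0 !add0r => /sc0 v2.
  move: hv => /eqP; rewrite v0 v2 !scale0r add0r addr0 scaler_eq0 (negPf y0) orbF => /eqP v1.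
  by apply: row3P; rewrite mxE.
pose g := (y *m A *m y^T) 0 0.
have yyE : y *m A *m y^T = g%:M by rewrite [LHS]mx11_scalar.
have xy : x *m A *m y^T = 0 by rewrite symA yx trmx0.
have zy : z *m A *m y^T = 0 by rewrite symA yz trmx0.
(* Being orthogonal to [x] and [z], an isotropic [y] would lie in the radical. *)
have g0 : g != 0.
  apply: contraNneq y0 => g0.
  have uN : A *m (mat3 x y z)^T \in unitmx.
    by rewrite unitmx_mul uA unitmx_tr -row_free_unit; apply: inj_row_free.
  rewrite -(mul_unit_neq0 y uN); apply/eqP/rowP.
  have yM j : (y *m (A *m (mat3 x y z)^T)) 0 j = (y *m A *m (row j (mat3 x y z))^T) 0 0.
    by rewrite mulmxA !mxE; apply: eq_bigr => a _; rewrite !mxE.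
  by apply: forall_ord3; rewrite yM row_mat3 ?yx ?yz ?yyE ?g0 !mxE ?mul0rn.
(* Scaling [y] by [m] makes its square -2 b = 3 b, the middle entry of [b *: stdH k]. *)
have [m mE] : exists m, m ^+ 2 = - 2%:R * b / g by apply: root_exists.
have m0 : m != 0.
  by rewrite -sqrf_eq0 mE !mulf_neq0 ?invr_eq0 ?oppr_eq0 ?(two_neq0 char5).
exists (mat3 x (m *: y) z), b; split=> //.
- rewrite -row_free_unit; apply: inj_row_free => v.
  have -> : v *m mat3 x (m *: y) z = row3 (v 0 o0) (v 0 o1 * m) (v 0 o2) *m mat3 x y z.
    by rewrite !mul_mat3 !row3E scalerA.
  move/uM => /rowP e; apply: row3P; rewrite mxE.
  + by have := e o0; rewrite row3E mxE.
  + by have /eqP := e o1; rewrite row3E mxE mulf_eq0 (negPf m0) orbF => /eqP.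
  + by have := e o2; rewrite row3E mxE.
- by rewrite row_mat3.
- by rewrite row_mat3.
apply/matrixP; apply: forall_ord3; apply: forall_ord3; rewrite gram_entry !row_mat3.
all: rewrite ?linearZ /= -?scalemxAl ?xx ?zz ?xzE ?zxE ?yx ?yz ?xy ?zy ?yyE.
all: rewrite !mxE /= ?mulr0 ?mulr1 ?mulr1n //.
by rewrite mulrA -expr2 mE divfK // (three_mtwo char5) mulrC.
Qed.

(** The multiplicity of the root [s] of the pullback is an intersection multiplicity by
    [inter_mult_param], and that number is unique. *)
Lemma inter_mult_order2 M q H s b : M \in unitmx -> b != 0 ->
  q = b *: conic_eq M -> pull (param_mul (@conic_param k) M) (hform H) != 0 ->
  inter_mult_eq (pt (vpt (Some s) *m M)) q (hform H) 2 ->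
  exists2 g, g.[s] != 0 &
    pull (param_mul (@conic_param k) M) (hform H) = ('X - s%:P) ^+ 2 * g.
Proof.
move=> uM b0 -> G0 h2; set G := pull _ _ in G0 *.
have [m [g]] := multiplicity_XsubC G s; rewrite G0 /= => gs GE.
suff m2 : m = 2%N by exists g; rewrite // mulrC -m2.
have hm : inter_mult_eq (pt (vpt (Some s) *m M)) (b *: conic_eq M) (hform H) m.
  apply: (inter_mult_param (s := s) (x := vpt (Some s) *m M) (D := 6) (g := g)
    (good_paramZ b0 (good_param_mul uM (conic_good_param k)))) => //.
  - exact: vptM_neq0.
  - exact: horner_conic_param.
  - exact: hform_homog.
  - by rewrite -/G GE mulrC.
by apply/eqP; rewrite eqn_leq !(inter_mult_leq hm h2, inter_mult_leq h2 hm).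
Qed.

Lemma pull_conic_hform H : pull (@conic_param k) (hform H) =
  H o0 o0 *: 'X^0 + H o0 o1 *: 'X^5 + H o0 o2 *: 'X^10 +
  (H o1 o0 *: 'X^1 + H o1 o1 *: 'X^6 + H o1 o2 *: 'X^11) +
  (H o2 o0 *: 'X^2 + H o2 o1 *: 'X^7 + H o2 o2 *: 'X^12).
Proof.
rewrite pull_hform !sum_ord3 !conic_paramE -!exprM !expr1n !mulr1 !mul1r.
by rewrite -!exprS -!exprD.
Qed.

Lemma coef_pull_conic H n : (pull (@conic_param k) (hform H))`_n =
  H o0 o0 * (n == 0)%:R + H o0 o1 * (n == 5)%:R + H o0 o2 * (n == 10)%:R +
  (H o1 o0 * (n == 1)%:R + H o1 o1 * (n == 6)%:R + H o1 o2 * (n == 11)%:R) +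
  (H o2 o0 * (n == 2)%:R + H o2 o1 * (n == 7)%:R + H o2 o2 * (n == 12)%:R).
Proof. by rewrite pull_conic_hform !coefD !coefZ !coefXn. Qed.

Ltac coef_simpl := rewrite coef_pull_conic /= ?(mulr0, mulr1, addr0, add0r).

Lemma pull_conic_neq0 H : H \in unitmx -> pull (@conic_param k) (hform H) != 0.
Proof.
move=> uH; apply: contraL (uH) => /eqP G0.
suff -> : H = 0 by rewrite unitmxE det0 unitr0.
have h n : (pull (@conic_param k) (hform H))`_n = 0 by rewrite G0 coef0.
apply/matrixP; apply: forall_ord3; apply: forall_ord3; rewrite [RHS]mxE;
[have := h 0%N|have := h 5%N|have := h 10%N|have := h 1%N|have := h 6%N|have := h 11%N|
 have := h 2%N|have := h 7%N|have := h 12%N]; by coef_simpl.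
Qed.

(** The first column of [H] holds the coefficients of 1, t and t^2 in the pullback. *)
Lemma order2_entries H g :
  pull (@conic_param k) (hform H) = ('X - 0%:P) ^+ 2 * g -> g.[0] != 0 ->
  [/\ H o0 o0 = 0, H o1 o0 = 0 & H o2 o0 != 0].
Proof.
rewrite subr0 mulrC horner_coef0 => e g0.
have := coefMXn 2 g 2; have := coefMXn 2 g 1; have := coefMXn 2 g 0.
by rewrite -e /=; coef_simpl; coef_simpl; coef_simpl => -> -> ->.
Qed.

(** From the top: t^9 has coefficient 2 f_4 and then t^8 has 2 f_3; the constant term is f_0^2,
    after which t^4 has f_2^2. Only f_1 remains free. *)
Lemma sqr_quintic (f : {poly k}) : f \is monic -> size f = 6%N ->
  (f ^+ 2)`_0 = 0 -> (f ^+ 2)`_4 = 0 -> (f ^+ 2)`_8 = 0 -> (f ^+ 2)`_9 = 0 ->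
  f = 'X^5 + f`_1 *: 'X.
Proof.
move=> /monicP + sf; rewrite /lead_coef sf /= => f5.
have hbig n : (5 < n)%N -> f`_n = 0 by move=> hn; rewrite nth_default // sf.
rewrite expr2 !coefM !big_ord_recl !big_ord0 /= /bump /= f5 ?(hbig 6, hbig 7, hbig 8, hbig 9) //.
rewrite !subn0 !subnn ?(mulr0, mul0r, addr0, add0r, mulr1, mul1r) => h0 h4 h8 h9.
have two := two_neq0 char5.
have a0 : f`_0 = 0 by move/eqP: h0; rewrite mulf_eq0 orbb => /eqP.
have {}h9 : f`_4 + f`_4 = 0 by exact: h9.
have {}h8 : f`_3 + (f`_4 * f`_4 + f`_3) = 0 by exact: h8.
have {}h4 : f`_0 * f`_4 + (f`_1 * f`_3 + (f`_2 * f`_2 + (f`_3 * f`_1 + f`_4 * f`_0))) = 0.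
  by exact: h4.
have a4 : f`_4 = 0.
  by apply: (mulfI two); rewrite mulr0 -[RHS]h9; ring.
have a3 : f`_3 = 0.
  by apply: (mulfI two); rewrite mulr0 -[RHS]h8 a4; ring.
have a2 : f`_2 = 0.
  by apply/eqP; rewrite -sqrf_eq0 -[X in _ == X]h4 a0 a3 a4; apply/eqP; ring.
apply/polyP => i; rewrite coefD coefZ coefX coefXn.
move: i => [|[|[|[|[|[|i]]]]]] /=; rewrite ?(mulr0, mulr1, addr0, add0r) //.
by rewrite hbig.
Qed.

Lemma double_roots (G : {poly k}) : G != 0 ->
  (forall s, root G s -> exists2 g, g.[s] != 0 & G = ('X - s%:P) ^+ 2 * g) ->
  exists (c : k) (f : {poly k}), [/\ c != 0, f \is monic & G = c *: f ^+ 2].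
Proof.
move=> G0 hG; have [r GE] := closed_field_poly_normal G.
have c0 : lead_coef G != 0 by rewrite lead_coef_eq0.
have cnt s : s \in r -> count_mem s r = 2%N.
  move=> sr; have [|g gs e] := hG s.
    by rewrite GE rootZ // root_prod_XsubC.
  rewrite -mu_prod_XsubC.
  have -> : \prod_(z <- r) ('X - z%:P) = (lead_coef G)^-1 *: G.
    by rewrite {2}GE scalerA mulVf // scale1r.
  rewrite [in X in mup _ X]e -mul_polyC mupMr; last by rewrite rootC invr_eq0 -e.
  by rewrite mupMl ?rootE // mup_XsubCX eqxx.
exists (lead_coef G); exists (\prod_(z <- undup r) ('X - z%:P)); split=> //.
  exact: monic_prod_XsubC.
rewrite {1}GE expr2 -big_cat; congr (_ *: _); apply: perm_big.
apply/allP => s _; apply/eqP; rewrite count_cat (count_uniq_mem _ (undup_uniq r)) mem_undup.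
have [sr|sr] := boolP (s \in r); first by rewrite cnt.
by rewrite (count_memPn sr).
Qed.

(** A vector [v] in the kernel of S + S^T makes the gradient vanish, and 2 q(v) = v (S + S^T) v^T
    puts its point on the conic: it would be singular. *)
Lemma nonsingular_quad_unit S : nonsingular (quad S) -> S + S^T \in unitmx.
Proof.
move=> ns; rewrite -row_free_unit; apply: inj_row_free => v vA.
apply/eqP; apply: contraT => v0.
have [c c0 cE] := vpick_pt v0.
have q2 : 2 * ev (quad S) v = 0.
  rewrite ev_quad mulr_natl mulr2n.
  have e : v *m S^T *m v^T = (v *m S *m v^T)^T by rewrite !trmx_mul trmxK mulmxA.
  have : (v *m (S + S^T) *m v^T) 0 0 = 0 by rewrite vA mul0mx mxE.
  by rewrite mulmxDr mulmxDl e [LHS]mxE [X in _ + X]mxE.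
have hloc : locus (quad S) (pt v).
  have hh : quad S \is 2.-homog.
    apply: rpred_sum => i _; apply: rpred_sum => j _; apply: dhomogZ.
    exact: dhomogM (homogX _ _) (homogX _ _).
  apply/(locus_pt hh v0)/eqP; move/eqP: q2.
  by rewrite mulf_eq0 (negPf (two_neq0 char5)).
have [i] := ns _ hloc.
by rewrite hcoord_ev ev_mderiv_quad cE -scalemxAl vA scaler0 mxE eqxx.
Qed.

(** Here the pullback is c f^2 with f = t^5 + a t. Since r^4 = -a, f(r t) = r^5 (t^5 - t), and the
    matrix [D] realizes t -> r t on (1, t, t^2), whence the scalar c r^10. *)
Lemma frame_rescale H M r c a : r != 0 -> c != 0 -> r ^+ 4 = - a ->
  M *m H *m ctr M = c *: mat3 (row3 0 0 1) (row3 0 (2 * a) 0) (row3 (a ^+ 2) 0 0) ->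
  exists N, [/\ frame H N, cset N = cset M, pt (row o0 N) = pt (row o0 M) &
    pt (row o2 N) = pt (row o2 M)].
Proof.
move=> r0 c0 ra e.
pose D := mat3 (row3 1 0 0) (row3 0 r 0) (row3 0 0 (r ^+ 2)).
have fN : frame H (D *m M).
  exists (c * r ^+ 10); first by rewrite mulf_neq0 // expf_neq0.
  rewrite ctrM !mulmxA -(mulmxA D M) -(mulmxA D (M *m H)) e -scalemxAr -scalemxAl -scalerA.
  congr (_ *: _).
  have aE : a = - r ^+ 4 by rewrite ra opprK.
  apply/matrixP; apply: forall_ord3; apply: forall_ord3;
    rewrite !mxE sum_ord3 !mxE !sum_ord3 !mxE /= ?pFrobenius_autE;
    rewrite ?expr0n ?expr1n /= ?(mulr0, mul0r, addr0, add0r, mulr1, mul1r) //.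
  - by rewrite -exprM.
  - rewrite aE (three_mtwo char5); ring.
  - rewrite aE; ring.
have uN := frame_unit fN.
have uM : M \in unitmx by move: uN; rewrite unitmx_mul => /andP[].
have vD s : vpt (Some s) *m D = vpt (Some (r * s)).
  by rewrite mul_mat3; apply: row3P; rewrite !mxE /=; ring.
have vD' : vpt None *m D = r ^+ 2 *: vpt None.
  by rewrite mul_mat3; apply: row3P; rewrite !mxE /=; ring.
have rr0 : r ^+ 2 != 0 by rewrite expf_neq0.
exists (D *m M); split=> //.
- apply/seteqP; split=> P [o ->].
    rewrite mulmxA; case: o => [s|]; first by exists (Some (r * s)); rewrite vD.
    by exists None; rewrite vD' -scalemxAl ptZ // vptM_neq0.
  case: o => [s|]; first by exists (Some (r^-1 * s)); rewrite mulmxA vD mulVKf.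
  by exists None; rewrite mulmxA vD' -scalemxAl ptZ // vptM_neq0.
- congr pt; rewrite row_mul row_mat3 row3_mul.
  by rewrite !scale0r scale1r !addr0.
have r20 : row o2 M != 0.
  have -> : row o2 M = vpt None *m M by rewrite row3_mul !scale0r scale1r !add0r.
  exact: vptM_neq0.
by rewrite row_mul row_mat3 row3_mul !scale0r !add0r ptZ.
Qed.

Lemma size_of_sqr11 (f : {poly k}) : size (f ^+ 2) = 11%N -> size f = 6%N.
Proof. by move=> e; have := size_exp f 2; rewrite e /=; case: (size f) => [|m] /=; lia. Qed.

(** Any two contact points may be prescribed: [P1] gets parameter 0 and [P2] infinity. This freedom
    later allows a secant or a common point to be put in a fixed position. *)
Lemma tangent_conic_frame H Q P1 P2 : H \in unitmx ->
  totally_tangent_conics (hform H) Q ->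
  (Q `&` locus (hform H)) P1 -> (Q `&` locus (hform H)) P2 -> P1 <> P2 ->
  exists M, [/\ frame H M, Q = cset M, P1 = rpt M 1 & P2 = rpt M 0].
Proof.
move=> uH [q [hq ns QE _ mult]] [QP1 GP1] [QP2 GP2] P12.
have [S qS] := quad_surj hq; rewrite qS in hq ns QE mult.
have uA := nonsingular_quad_unit ns.
have sA : (S + S^T)^T = S + S^T by rewrite linearD /= trmxK addrC.
have [x x0 P1E] := pt_surj P1; have [z z0 P2E] := pt_surj P2.
have iso v : v != 0 -> Q (pt v) -> v *m (S + S^T) *m v^T = 0.
  move=> v0; rewrite QE => /(locus_pt hq v0); rewrite ev_quad => e.
  rewrite mulmxDr mulmxDl; have eS : v *m S *m v^T = 0.
    by rewrite [LHS]mx11_scalar e; apply/matrixP => i j; rewrite !mxE mul0rn.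
  have -> : v *m S^T *m v^T = (v *m S *m v^T)^T by rewrite !trmx_mul trmxK mulmxA.
  by rewrite eS trmx0 addr0.
have [|||M [b [uM b0 rx rz MA]]] := hyperbolic_frame uA sA x0 z0.
- by rewrite -P1E -P2E.
- by apply: iso; rewrite -?P1E.
- by apply: iso; rewrite -?P2E.
have two := two_neq0 char5.
have twoq T : 2 *: quad T = quad (T + T^T).
  by rewrite quadD quad_tr scaler_nat mulr2n.
have lq : lin M (quad S) = b *: conic_form k.
  apply: (scalerI two); rewrite lin_quad twoq !trmx_mul trmxK mulmxA -mulmxDl -mulmxDr.
  rewrite MA quadZ -(conicC_sym char5) -twoq conic_form_quad.
  by rewrite !scalerA mulrC.
have qE : quad S = b *: conic_eq M.
  by rewrite -[LHS]lin1 -(mulVmx uM) -lin_comp lq comp_mpolyZ.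
have QM : Q = cset M.
  rewrite QE -locus_conic_eq // qE; apply/seteqP; split=> P; rewrite /locus /= mevalZ.
    by move/eqP; rewrite mulf_eq0 (negPf b0) => /eqP.
  by move=> ->; rewrite mulr0.
pose H' := M *m H *m ctr M.
have uH' : H' \in unitmx by rewrite !unitmx_mul uM uH ctr_unit uM.
have ord N s : N \in unitmx -> cset N = cset M -> conic_eq N = conic_eq M ->
    root (pull (@conic_param k) (hform (N *m H *m ctr N))) s ->
    exists2 g, g.[s] != 0 &
      pull (@conic_param k) (hform (N *m H *m ctr N)) = ('X - s%:P) ^+ 2 * g.
  move=> uN cN eN; rewrite -lin_hform -pull_lin => rs.
  apply: (inter_mult_order2 uN b0 (q := quad S)); first by rewrite eN.
    by rewrite pull_lin lin_hform pull_conic_neq0 // !unitmx_mul uN uH ctr_unit.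
  apply: mult; rewrite QM -cN; split; first by exists (Some s).
  apply/(locus_pt (hform_homog H)); first exact: vptM_neq0.
  rewrite -(eqP rs) horner_pull; apply: meval_eq => i.
  by rewrite horner_conic_param.
have row0E N : row o0 N = vpt (Some 0) *m N.
  by rewrite row3_mul expr0n !scale0r scale1r !addr0.
have row2E N : row o2 N = vpt None *m N.
  by rewrite row3_mul !scale0r scale1r !add0r.
have root0 N : N \in unitmx -> ev (hform H) (row o0 N) = 0 ->
    root (pull (@conic_param k) (hform (N *m H *m ctr N))) 0.
  move=> uN e; rewrite -lin_hform -pull_lin /root horner_pull -[X in _ == X]e.
  by apply/eqP/meval_eq => i; rewrite horner_conic_param row0E.
have locx v : v != 0 -> locus (hform H) (pt v) -> ev (hform H) v = 0.
  by move=> v0 /(locus_pt (hform_homog H) v0).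
have [g g0 Gg] := ord M 0 uM erefl erefl
  (root0 M uM (etrans (congr1 _ rx) (locx x x0 (eq_ind _ (fun P => locus _ P) GP1 _ P1E)))).
have [h00 h10 h20] := order2_entries Gg g0.
(* The tangency at infinity is read as a tangency at 0 in the reversed parameter; it gives the
   entries [h22], [h12] and [h02]. *)
have uR : revm k *m M \in unitmx by rewrite unitmx_mul revm_unit.
have rR : row o0 (revm k *m M) = z.
  by rewrite row_mul row_mat3 row3_mul !scale0r scale1r !add0r.
have [g' g'0 Gg'] := ord (revm k *m M) 0 uR (cset_revm uM) (conic_eq_revm uM)
  (root0 _ uR (etrans (congr1 _ rR) (locx z z0 (eq_ind _ (fun P => locus _ P) GP2 _ P2E)))).
have [] := order2_entries Gg' g'0.
have -> : revm k *m M *m H *m ctr (revm k *m M) = revm k *m H' *m revm k.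
  by rewrite ctrM ctr_revm /H' !mulmxA.
have revE (X : 'M[k]_3) : let Y := revm k *m X *m revm k in
    (Y o0 o0 = X o2 o2) * (Y o1 o0 = X o1 o2) * (Y o2 o0 = X o0 o2).
  by rewrite /= !mxE !sum_ord3 !mxE !sum_ord3 !mxE /= !(mul0r, mulr0, mul1r, mulr1, addr0, add0r).
rewrite !revE -/H' in h00 h10 h20 Gg * => h22 h12 h02.
set G := pull (@conic_param k) (hform H') in Gg.
have G0 : G != 0 by apply: pull_conic_neq0.
have [c [f [c0 fm GE]]] := double_roots G0 (fun s hs => ord M s uM erefl erefl hs).
have Gn n := coef_pull_conic H' n; rewrite -/G h00 h10 h22 h12 in Gn.
(* The exponents 11 and 12 are gone and [h02], the coefficient of t^10, is nonzero; thus f has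
   degree 5. *)
have sG : size G = 11%N.
  apply/eqP; rewrite eqn_leq; apply/andP; split.
    apply/leq_sizeP => n hn; rewrite Gn !mul0r.
    have ne e : (e < 11)%N -> (n == e) = false.
      by move=> he; apply/eqP => ne; move: hn; rewrite ne leqNgt he.
    by rewrite !ne // !mulr0 !addr0.
  rewrite ltnNge; apply: contraNN h02 => hs.
  by have := Gn 10%N; rewrite nth_default //= !(mulr0, mulr1, addr0, add0r) => <-.
have sf : size f = 6%N.
  apply: size_of_sqr11; rewrite -(size_scale _ c0) -GE; exact: sG.
have fn n : (f ^+ 2)`_n = c^-1 * G`_n.
  by rewrite GE coefZ mulKf.
have fE := sqr_quintic fm sf; rewrite !fn !Gn /= in fE.
have {}fE : f = 'X^5 + f`_1 *: 'X.
  by apply: fE; rewrite !(mulr0, mulr1, addr0, add0r).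
set a := f`_1 in fE.
have f2 : f ^+ 2 = 'X^10 + (2 * a) *: 'X^6 + (a ^+ 2) *: 'X^2.
  by rewrite fE -!mul_polyC rmorphM rmorphXn /= rmorph_nat; ring.
have Gn' n : G`_n = c * ((n == 10)%:R + 2 * a * (n == 6)%:R + a ^+ 2 * (n == 2)%:R).
  by rewrite GE f2 coefZ !coefD !coefZ !coefXn.
(* The coefficient of t^2 is c a^2, and it is nonzero because the order of contact at 0 is exactly
   2. *)
have a0 : a != 0.
  have := Gn 2%N; rewrite Gn' /= !(mulr0, mulr1, addr0, add0r) => e.
  by apply: contraNneq h20 => a0; rewrite -e a0 expr0n mulr0.
have [r ra] := root_exists (- a) (isT : (0 < 4)%N).
have r0 : r != 0 by apply: contraNneq a0 => r0; rewrite -oppr_eq0 -ra r0 expr0n.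
(* The four entries excluded by tangency at 0 and infinity are zero; the other five are the
   coefficients of t^5, t^10, t^6, t^2 and t^7 in c f^2. *)
have [|N [fN cN p0 p2]] := frame_rescale r0 c0 ra (M := M) (H := H).
  rewrite -/H'; apply/matrixP; apply: forall_ord3; apply: forall_ord3;
    rewrite [RHS]mxE mat3E row3E ?mulr0 ?mulr1 //.
  - by have := Gn 5%N; rewrite Gn' /= !(mulr0, mulr1, addr0, add0r) => <-.
  - by have := Gn 10%N; rewrite Gn' /= !(mulr0, mulr1, addr0, add0r) => <-.
  - by have := Gn 6%N; rewrite Gn' /= !(mulr0, mulr1, addr0, add0r) => <-.
  - by have := Gn 2%N; rewrite Gn' /= !(mulr0, mulr1, addr0, add0r) => <-.
  - by have := Gn 7%N; rewrite Gn' /= !(mulr0, mulr1, addr0, add0r) => <-.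
exists N; split=> //; first by rewrite cN.
  by rewrite P1E -rx -p0 row0E.
by rewrite P2E -rz -p2 row2E.
Qed.

End Classification.

(** * Coordinates in F_25 *)

Arguments qadd : simpl never.
Arguments qmul : simpl never.
Arguments qopp : simpl never.
Arguments qconj : simpl never.
Arguments qinv : simpl never.

Lemma F5_natD x y : F5_nat (F5_add x y) = ((F5_nat x + F5_nat y) %% 5)%N.
Proof. by case: x y => [] []. Qed.
Lemma F5_natM x y : F5_nat (F5_mul x y) = ((F5_nat x * F5_nat y) %% 5)%N.
Proof. by case: x y => [] []. Qed.
Lemma F5_dblE x : F5_dbl x = F5_add x x. Proof. by case: x. Qed.
Lemma F5_addN x : F5_add x (F5_opp x) = f0. Proof. by case: x. Qed.

Section Bridge.
Local Open Scope classical_set_scope.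
Local Open Scope card_scope.
Variables (k : closedFieldType) (char5 : 5%N \in [pchar k]).
Implicit Types (M H : 'M[k]_3).
Notation frame := (frame char5).
Notation frob := (frob char5).
Notation ctr := (ctr char5).

Lemma natr_mod5 n : (n %% 5)%N%:R = n%:R :> k.
Proof. by rewrite {2}(divn_eq n 5) natrD natrM (five0 char5) mulr0 add0r. Qed.

Definition io5 (a : F5) : k := (F5_nat a)%:R.

Lemma io5D a b : io5 (F5_add a b) = io5 a + io5 b.
Proof. by rewrite /io5 F5_natD natr_mod5 natrD. Qed.
Lemma io5M a b : io5 (F5_mul a b) = io5 a * io5 b.
Proof. by rewrite /io5 F5_natM natr_mod5 natrM. Qed.
Lemma io5N a : io5 (F5_opp a) = - io5 a.
Proof. by apply/eqP; rewrite -addr_eq0 addrC -io5D F5_addN. Qed.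
Lemma io5_dbl a : io5 (F5_dbl a) = 2%:R * io5 a.
Proof. by rewrite F5_dblE io5D mulr_natl mulr2n. Qed.
Lemma io5_frob a : io5 a ^+ 5 = io5 a.
Proof. by rewrite -(pFrobenius_autE char5) rmorph_nat. Qed.

(** The image of w; the default 0 is never taken, [k] being algebraically closed. *)
Definition omega : k := xget 0 [set c : k | c ^+ 2 = 2%:R].
Lemma omega2 : omega ^+ 2 = 2%:R.
Proof.
have [c hc] := root_exists (2%:R : k) (isT : (0 < 2)%N).
exact: (@xgetI _ 0 [set c : k | c ^+ 2 = 2%:R] c hc).
Qed.
Lemma omega5 : omega ^+ 5 = - omega.
Proof.
rewrite exprS (exprM omega 2 2) omega2 -natrX mulr_natr -[LHS]mulr_natl.
have -> : (2 ^ 2)%:R = 5%:R - 1 :> k by rewrite -[5%N]/(4 + 1)%N natrD addrK.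
by rewrite (five0 char5) sub0r mulN1r.
Qed.

Definition io (x : F25) : k := io5 x.1 + io5 x.2 * omega.

Lemma ioD a b : io (qadd a b) = io a + io b.
Proof. by rewrite /io /= !io5D; ring. Qed.
Lemma ioN a : io (qopp a) = - io a.
Proof. by rewrite /io /= !io5N; ring. Qed.
Lemma ioM a b : io (qmul a b) = io a * io b.
Proof.
case: a b => a b [c d]; rewrite /io /= !io5D io5_dbl !io5M -omega2; ring.
Qed.
Lemma io_conj a : io (qconj a) = io a ^+ 5.
Proof.
rewrite -(frobE char5) /io rmorphD rmorphM /= !frobE !io5_frob omega5 io5N; ring.
Qed.
Lemma io0 : io q0 = 0. Proof. by rewrite /io /io5 /= mul0r addr0. Qed.
Lemma io1 : io q1 = 1. Proof. by rewrite /io /io5 /= mul0r addr0. Qed.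
Lemma io_F5 a : io (a, f0) = io5 a. Proof. by rewrite /io /io5 /= mul0r addr0. Qed.

Lemma qmulVx x : x != q0 -> qmul x (qinv x) = q1.
Proof. by case: x => [] [] []. Qed.

Lemma io_eq0 x : (io x == 0) = (x == q0).
Proof.
apply/eqP/eqP => [x0|->]; last exact: io0.
apply/eqP; apply: contraT => /qmulVx /(congr1 io)/eqP.
by rewrite ioM x0 mul0r io1 eq_sym oner_eq0.
Qed.

Lemma io_inj : injective io.
Proof.
move=> x y e; have /eqP : io (qadd x (qopp y)) = 0 by rewrite ioD ioN e subrr.
rewrite io_eq0; case: x y {e} => a b [c d] /eqP [].
by case: a c => [] [] //; case: b d => [] [].
Qed.

Lemma io_inv x : io (qinv x) = (io x)^-1.
Proof.
have [->|x0] := eqVneq x q0; first by rewrite io0 invr0 -io0.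
have ix0 : io x != 0 by rewrite io_eq0.
by apply: (mulfI ix0); rewrite -ioM qmulVx // io1 mulfV.
Qed.

(** X^25 - X has at most 25 roots, and the images of the 25 elements of [F25s] already are distinct
    roots. *)
Lemma io_surj c : (c ^+ 5) ^+ 5 = c -> exists x, c = io x.
Proof.
move=> hc; have [/mapP[x _ ->]|cn] := boolP (c \in map io F25s); first by exists x.
pose p : {poly k} := 'X^25 - 'X.
have sp : size p = 26 by rewrite size_polyDl size_polyXn // size_polyN size_polyX.
have p0 : p != 0 by rewrite -size_poly_eq0 sp.
have u : uniq (c :: map io F25s).
  by rewrite cons_uniq cn map_inj_uniq //; apply: io_inj.
have rt a : (a ^+ 5) ^+ 5 = a -> root p a.
  by move=> ha; rewrite /root !hornerE -[25%N]/(5 * 5)%N exprM ha subrr.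
have ha : all (root p) (c :: map io F25s).
  apply/allP => a; rewrite inE => /orP[/eqP ->|/mapP[x _ ->]]; apply: rt => //.
  by rewrite -!io_conj; case: x => [b d]; congr io; rewrite /qconj /=; case: d.
have := max_poly_roots p0 ha u; rewrite sp.
by have -> : size (c :: map io F25s) = 26 by [].
Qed.

Definition rowm (v : vec) : 'rV[k]_3 := row3 (io v.1.1) (io v.1.2) (io v.2).
Definition matm (N : mat) : 'M[k]_3 := mat3 (rowm N.1.1) (rowm N.1.2) (rowm N.2).

Lemma rowm_inj : injective rowm.
Proof.
move=> [[a b] c] [[a' b'] c'] /rowP e.
by move: (e o0) (e o1) (e o2); rewrite !row3E /= => /io_inj -> /io_inj -> /io_inj ->.
Qed.

Lemma rowm_vmul v N : rowm (vmul v N) = rowm v *m matm N.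
Proof.
case: v N => [[v0 v1] v2] [[[[a b] c] [[a' b'] c']] [[a'' b''] c'']].
by rewrite mul_mat3 !row3E; apply: row3P; rewrite !mxE /= !ioD !ioM.
Qed.

Lemma matm_mmul (K N : mat) : matm (mmul K N) = matm K *m matm N.
Proof.
case: K => [[r0 r1] r2]; case: N => [[s0 s1] s2].
by rewrite {2}/matm mat3_mul -!rowm_vmul.
Qed.

Lemma io3 : io q3 = 3%:R. Proof. by rewrite io_F5. Qed.

Lemma io_herm u v : (rowm u *m stdH k *m ctr (rowm v)) 0 0 = io (herm u v).
Proof.
case: u v => [[a b] c] [[a' b'] c'].
rewrite mul_stdH mxE sum_ord3 !mxE /= ?frobE ?pFrobenius_autE.
rewrite !ioD !ioM io3 !io_conj; ring.
Qed.

Lemma ctr_gram_entry (A X : 'M[k]_3) i j :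
  (X *m A *m ctr X) i j = (row i X *m A *m ctr (row j X)) 0 0.
Proof. by rewrite -row_mul !mxE; apply: eq_bigr => a _; rewrite !mxE. Qed.

Lemma matm_gram N i j : (matm N *m stdH k *m ctr (matm N)) i j =
  io (herm (nth N.1.1 [:: N.1.1; N.1.2; N.2] i) (nth N.1.1 [:: N.1.1; N.1.2; N.2] j)).
Proof.
rewrite ctr_gram_entry -io_herm; move: i j.
by apply: forall_ord3; apply: forall_ord3; rewrite !row_mat3.
Qed.

Lemma isometryP N : isometry_up_to_scalar N <-> frame (stdH k) (matm N).
Proof.
have stdE i j : stdH k i j = mat3 (row3 0 0 1) (row3 0 3%:R 0) (row3 1 0 0) i j by [].
split=> [|[l l0 e]].
  case: N => [[r0 r1] r2] /and4P[l0 /eqP e20 /eqP e11 /allP h].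
  have h0 c : c \in [:: herm r0 r0; herm r2 r2; herm r0 r1; herm r1 r0; herm r1 r2; herm r2 r1] ->
      io c = 0 by move=> /h /eqP ->; exact: io0.
  exists (io (herm r0 r2)); first by rewrite io_eq0.
  apply/matrixP; apply: forall_ord3; apply: forall_ord3;
    rewrite matm_gram [RHS]mxE stdE mat3E row3E /= ?mulr0 ?mulr1 ?e20 ?e11 ?ioM ?io3 1?mulrC //;
    by apply: h0; rewrite !inE eqxx ?orbT.
have {}e (i j : 'I_3) : io (herm (nth N.1.1 [:: N.1.1; N.1.2; N.2] i) (nth N.1.1 [:: N.1.1; N.1.2; N.2] j))
    = l * stdH k i j.
  by rewrite -matm_gram e [LHS]mxE.
case: N e => [[r0 r1] r2] /= e.
have z (i j : 'I_3) : stdH k i j = 0 ->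
   herm (nth r0 [:: r0; r1; r2] i) (nth r0 [:: r0; r1; r2] j) = q0.
  by move=> h; apply/io_inj; rewrite e h mulr0 io0.
have e02 := e o0 o2; have e20 := e o2 o0; have e11 := e o1 o1.
rewrite !stdE !mat3E !row3E /= ?mulr1 in e02 e20 e11.
apply/and4P; split; first by rewrite -io_eq0 e02.
- by apply/eqP/io_inj; rewrite e02 e20.
- by apply/eqP/io_inj; rewrite ioM io3 e02 e11 mulrC.
by rewrite /= (z o0 o0) ?(z o2 o2) ?(z o0 o1) ?(z o1 o0) ?(z o1 o2) ?(z o2 o1) ?stdE ?mat3E ?row3E //=.
Qed.

Lemma ctr_ctrE (A : 'M[k]_3) i j : ctr (ctr A) i j = (A i j ^+ 5) ^+ 5.
Proof. by rewrite !mxE. Qed.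

(* If [X] is unitary for [stdH], then so is its Hermitian adjoint, and [X] equals
   its own image under the 25-power Frobenius map. *)
Lemma rational_frame H M M' : frame H M -> frame H M' ->
  exists N c, [/\ c != 0, isometry_up_to_scalar N & M' = c *: (matm N *m M)].
Proof.
move=> fM fM'; have uM := frame_unit fM; have uM' := frame_unit fM'.
have [l l0 e] := fM; have [l' l'0 e'] := fM'.
have [X M'E] : exists X, M' = X *m M by exists (M' *m invmx M); rewrite mulmxKV.
have uX : X \in unitmx by move: uM'; rewrite M'E unitmx_mul => /andP[].
have Xe : l *: (X *m stdH k *m ctr X) = l' *: stdH k.
  rewrite -e' [in RHS]M'E ctrM !mulmxA -(mulmxA X M) -(mulmxA X (M *m H)) e.
  by rewrite -scalemxAr -scalemxAl.
(* Scaling a matrix by m multiplies its Gram matrix by m m^5 = m^6, so a sixth root turns the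
   similitude into an isometry. *)
have [m me] := root_exists (l / l') (isT : (0 < 6)%N).
have m0 : m != 0.
  apply: contraTneq isT => m0; move: me; rewrite m0 expr0n => /esym/eqP.
  by rewrite mulf_eq0 invr_eq0 (negPf l0) (negPf l'0).
pose Y := m *: X.
have Ye : Y *m stdH k *m ctr Y = stdH k.
  rewrite /Y ctrZ -scalemxAl -scalemxAl -scalemxAr scalerA frobE -exprS me.
  by rewrite mulrC -scalerA Xe scalerA mulVf // scale1r.
have sH : ctr (stdH k) = stdH k.
  apply/matrixP; apply: forall_ord3; apply: forall_ord3;
  by rewrite !mxE /= ?pFrobenius_autE ?expr0n ?expr1n // -(pFrobenius_autE char5) rmorph_nat.
have uY : Y \in unitmx.
  by rewrite unitmxZ ?unitfE.
have YY : ctr (ctr Y) = Y.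
  have uS : stdH k *m ctr Y \in unitmx by rewrite unitmx_mul (stdH_unit char5) ctr_unit.
  apply: (can_inj (mulmxK uS)); rewrite !mulmxA Ye.
  by rewrite -[RHS]sH -[in RHS]Ye !ctrM sH mulmxA.
have {}YY i j : (Y i j ^+ 5) ^+ 5 = Y i j by rewrite -ctr_ctrE YY.
have /choice [f hf] : forall ij : 'I_3 * 'I_3, exists a, Y ij.1 ij.2 = io a.
  by move=> ij; apply/io_surj/YY.
pose r i : vec := (f (i, o0), f (i, o1), f (i, o2)).
have YN : Y = matm (r o0, r o1, r o2).
  by apply/matrixP; apply: forall_ord3; apply: forall_ord3; rewrite mat3E row3E /= -hf.
exists (r o0, r o1, r o2), m^-1; split; first by rewrite invr_eq0.
  by apply/isometryP; rewrite -YN; exists 1; rewrite ?oner_neq0 // scale1r.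
by rewrite -YN /Y -scalemxAl scalerA mulVf // scale1r -M'E.
Qed.

Lemma vnormP v : rowm v != 0 -> herm v v = q0 ->
  exists2 d, d != q0 & v = vscale d (canv (vnorm v)).
Proof.
case: v => [[x y] z] v0 vv; rewrite /vnorm; have [z0|z0] := eqVneq z q0.
  move: vv; rewrite z0 => vv.
  (* With z = 0, isotropy reads 3 y^6 = 0. *)
  have y0 : y = q0 by move: vv; case: x y {v0} => [] [] [] [] [] [].
  exists x.
    apply: contraNneq v0 => x0; rewrite x0 y0 z0.
    by apply/eqP; apply: row3P; rewrite row3E mxE /= io0.
  by apply: rowm_inj; rewrite y0; apply: row3P; rewrite !row3E /= ?ioM ?io1 ?io0 ?mulr1 ?mulr0.
have iz0 : io z != 0 by rewrite io_eq0.
exists z => //; apply: rowm_inj; apply: row3P; rewrite !row3E /= ?ioM ?io1 ?io_inv ?mulr1 //;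
by rewrite mulVKf.
Qed.

Lemma rowm_vscale d v : rowm (vscale d v) = io d *: rowm v.
Proof. by case: v => [[a b] c]; apply: row3P; rewrite !mxE /= ioM. Qed.

Lemma matm_vscalem d N : matm (vscalem d N) = io d *: matm N.
Proof.
case: N => [[r0 r1] r2]; apply/row_matrixP; apply: forall_ord3.
all: by rewrite linearZ /= !row_mat3 rowm_vscale.
Qed.

Lemma isometry_scale d N : d != q0 -> isometry_up_to_scalar N ->
  isometry_up_to_scalar (vscalem d N).
Proof.
move=> d0 /isometryP fN; apply/isometryP; rewrite matm_vscalem.
by apply: frameZ; rewrite ?io_eq0.
Qed.

Lemma matm_unit N : isometry_up_to_scalar N -> matm N \in unitmx.
Proof. by move/isometryP/frame_unit. Qed.

Lemma rowm_row_neq0 N : isometry_up_to_scalar N -> rowm N.2 != 0.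
Proof.
move=> iN; have -> : rowm N.2 = vpt None *m matm N.
  by rewrite mul_mat3 !row3E !scale0r scale1r !add0r.
by apply: vptM_neq0; apply: matm_unit.
Qed.

(** A matrix of a frame matters only up to a scalar, which is spent here on normalizing the last
    row; this shortens the enumerations. *)
Lemma rational_frame_canon H M M' : frame H M -> frame H M' ->
  exists N c o, [/\ c != 0, isometry_up_to_scalar N, N.2 = canv o &
    M' = c *: (matm N *m M)].
Proof.
move=> fM fM'; have [N [c [c0 iN ->]]] := rational_frame fM fM'.
have [|d d0 dE] := vnormP (rowm_row_neq0 iN).
  by case: N iN => [[r0 r1] r2] /and4P[_ _ _ /allP h]; apply/eqP/h; rewrite !inE eqxx orbT.
have id0 : io d != 0 by rewrite io_eq0.
exists (vscalem (qinv d) N), (c * io d), (vnorm N.2); split.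
- by rewrite mulf_neq0.
- by apply: isometry_scale => //; rewrite -io_eq0 io_inv invr_eq0.
- apply: rowm_inj; case: N dE {iN} => [[r0 r1] r2] /= dE.
  by rewrite {1}dE !rowm_vscale scalerA io_inv mulVf // scale1r.
by rewrite matm_vscalem -scalemxAl scalerA io_inv mulfK.
Qed.

End Bridge.

(** * Contact points over F_25 and their colors *)

Section Blocks.
Local Open Scope classical_set_scope.
Local Open Scope card_scope.
Variables (k : closedFieldType) (char5 : 5%N \in [pchar k]).
Implicit Types (M H : 'M[k]_3).
Notation frame := (frame char5).
Notation rowm := (@rowm k).
Notation matm := (@matm k).

Lemma vpt_rparam i : (i < 6)%N -> vpt (rparam k i) = rowm (nth (q0, q0, q0) veronese i).
Proof.
have h (p : F5 * F5) : rowm ((F5_mul p.1 p.1, f0), (F5_mul p.1 p.2, f0), (F5_mul p.2 p.2, f0)) =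
    row3 (io5 k p.1 ^+ 2) (io5 k p.1 * io5 k p.2) (io5 k p.2 ^+ 2).
  by rewrite /rowm /= !io_F5 !io5M.
move=> hi; rewrite (nth_map (f0, f0)) // h.
move: i hi => [|[|[|[|[|[|//]]]]]] _; rewrite /vpt /io5 /= ?mul0r ?expr0n ?expr1n ?mul1r //.
Qed.

Lemma mul_block N i : (i < 6)%N ->
  vpt (rparam k i) *m matm N = rowm (nth (q0, q0, q0) (block N) i).
Proof. by move=> hi; rewrite vpt_rparam // (nth_map (q0, q0, q0)) // rowm_vmul. Qed.

(** Canonical representatives make [mpt M] injective, so that equality of contact points becomes a
    computable equality of options. *)
Definition mpt M o : proj_point k := pt (rowm (canv o) *m M).

Lemma rowm_canv_neq0 o : rowm (canv o) != 0.
Proof.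
case: o => [[a b]|]; apply/eqP => /rowP.
  by move/(_ o2)/eqP; rewrite row3E mxE /= io1 oner_eq0.
by move/(_ o0)/eqP; rewrite row3E mxE /= io1 oner_eq0.
Qed.

Lemma mpt_inj M : M \in unitmx -> injective (mpt M).
Proof.
move=> uM o o' /(pt_mul_inj uM (rowm_canv_neq0 _) (rowm_canv_neq0 _)).
case/(pt_eqP (rowm_canv_neq0 _) (rowm_canv_neq0 _)) => c c0 /rowP e.
move: (e o0) (e o1) (e o2); rewrite !mxE.
case: o o' {e} => [[a b]|] [[a' b']|] //=; rewrite ?io0 ?io1 ?mulr1 ?mulr0.
- move=> ea eb ce; move: ea eb.
  by rewrite -ce !mul1r => /(io_inj char5) -> /(io_inj char5) ->.
- by move=> _ _ /esym/eqP; rewrite (negPf c0).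
- by move=> _ _ /eqP; rewrite oner_eq0.
Qed.

Lemma pt_rowm M v : M \in unitmx -> rowm v != 0 -> herm v v = q0 ->
  pt (rowm v *m M) = mpt M (vnorm v).
Proof.
move=> uM v0 vv; have [d d0 {1}->] := vnormP char5 v0 vv.
by rewrite rowm_vscale // -scalemxAl ptZ ?io_eq0 ?mul_unit_neq0 ?rowm_canv_neq0.
Qed.

Lemma block_isotropic N i : isometry_up_to_scalar N -> (i < 6)%N ->
  let v := nth (q0, q0, q0) (block N) i in rowm v != 0 /\ herm v v = q0.
Proof.
move=> iN hi v; have vE : rowm v = vpt (rparam k i) *m matm N by rewrite mul_block.
have fN := proj1 (isometryP char5 N) iN; have [l l0 e] := fN.
split; first by rewrite vE vptM_neq0 // (frame_unit fN).
apply: (io_inj char5); rewrite io0 -(io_herm char5) -ev_hform vE (ev_hform_frame _ e).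
have := proj2 (rationalP char5 (rparam k i)) (ex_intro2 _ _ i (_ : i \in iota 0 6) erefl).
rewrite mem_iota => /(_ hi); case: (rparam k i) => [s|] //= ->.
by rewrite subrr expr0n mulr0.
Qed.

Lemma rpt_block M N i : M \in unitmx -> isometry_up_to_scalar N -> (i < 6)%N ->
  rpt (matm N *m M) i = mpt M (nth None (nblock N) i).
Proof.
move=> uM iN hi; have [v0 vv] := block_isotropic iN hi.
by rewrite /rpt mulmxA mul_block // pt_rowm // /nblock (nth_map (q0, q0, q0)).
Qed.

Lemma frame_matm H M N : frame H M -> isometry_up_to_scalar N -> frame H (matm N *m M).
Proof. by move=> fM /(isometryP char5); apply: frame_mul. Qed.

Lemma cset_mpt H M N P : frame H M -> isometry_up_to_scalar N ->
  (cset (matm N *m M) `&` locus (hform H)) P <-> exists2 o, o \in nblock N & P = mpt M o.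
Proof.
move=> fM iN; have uM := frame_unit fM; rewrite (cset_rpt _ (frame_matm fM iN)).
split=> [[i]|[o]].
  rewrite mem_iota => hi ->; rewrite rpt_block //.
  by exists (nth None (nblock N) i) => //; apply: mem_nth.
move/(nthP None) => [i hi <-] ->; exists i; first by rewrite mem_iota.
by rewrite rpt_block.
Qed.

Lemma nblock_uniq N : isometry_up_to_scalar N -> uniq (nblock N).
Proof.
move=> iN; have uN := matm_unit char5 iN; apply/(uniqP None) => i j hi hj e.
have u1 := unitmx1 k 3; apply: (rpt_inj char5 (M := matm N *m 1%:M)).
- by rewrite unitmx_mul uN.
- by rewrite mem_iota.
- by rewrite mem_iota.
by rewrite !rpt_block // e.
Qed.

Lemma cset_eq_nblock M N N' : M \in unitmx -> isometry_up_to_scalar N ->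
  isometry_up_to_scalar N' -> all (mem (nblock N')) (nblock N) ->
  cset (matm N *m M) = cset (matm N' *m M).
Proof.
move=> uM iN iN' /allP h; apply: (cset_eq_rpt char5).
- by rewrite unitmx_mul uM (matm_unit char5).
- by rewrite unitmx_mul uM (matm_unit char5).
move=> i; rewrite mem_iota => hi; rewrite rpt_block //.
have /h/(nthP None) [j hj <-] : nth None (nblock N) i \in nblock N by apply: mem_nth.
by exists j; rewrite ?mem_iota // rpt_block.
Qed.

Lemma nblock_canv_isotropic N o : isometry_up_to_scalar N -> o \in nblock N ->
  herm (canv o) (canv o) = q0.
Proof.
move=> iN /(nthP None) [i hi <-]; rewrite /nblock (nth_map (q0, q0, q0)) //.
have [] := block_isotropic iN hi; move: (nth _ (block N) i) => v /= v0 vv.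
have [d d0 vE] := vnormP char5 v0 vv.
apply: (io_inj char5); rewrite io0; move/(congr1 (io k))/eqP: vv.
rewrite [in X in X -> _]vE -(io_herm char5) rowm_vscale // ctrZ -!scalemxAl -scalemxAr.
rewrite mxE mxE io0 frobE !mulf_eq0 io_eq0 // (negPf d0) /= => /eqP <-.
by rewrite -(io_herm char5).
Qed.

Lemma isotropic_color o : herm (canv o) (canv o) = q0 ->
  (color o < 21)%N /\ o \in nblock (Wm (color o)).
Proof.
have /andP[/allP h h0] := color_partition.
case: o => [[a b]|] // e.
have -> : a = (qnorm b, a.2).
  by move: e => /=; case: a b {h h0} => [] [] [] [[] []].
by have /allP/(_ _ (mem_F5s a.2))/andP[] := h _ (mem_F25s b).
Qed.

Lemma W_iso j : (j < 21)%N -> isometry_up_to_scalar (Wm j).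
Proof. by move=> hj; apply: (allP W_isometry); apply: mem_nth. Qed.

Lemma W_color j o : (j < 21)%N -> o \in nblock (Wm j) -> color o = j.
Proof.
move=> hj ho; have := allP W_monochrome j; rewrite mem_iota => /(_ hj).
by move/allP/(_ _ ho)/eqP.
Qed.

(** An isotropic point of color [j] lies in the block of [Wm j]; six such points determine the
    conic. *)
Lemma monochrome_cset M N j : M \in unitmx -> isometry_up_to_scalar N ->
  (j < 21)%N -> monochrome j N -> cset (matm N *m M) = cset (matm (Wm j) *m M).
Proof.
move=> uM iN hj /allP h; apply: cset_eq_nblock => //; first exact: W_iso.
apply/allP => o ho; have [_] := isotropic_color (nblock_canv_isotropic iN ho).
by rewrite (eqP (h o ho)).
Qed.

Lemma matm_idm : matm idm = 1%:M.
Proof.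
apply/matrixP; apply: forall_ord3; apply: forall_ord3;
by rewrite mat3E row3E !mxE /= ?io1 ?io0.
Qed.

End Blocks.

(** * Adjacency and components *)

Lemma count_gt1P (T : Type) (x0 : T) (p : pred T) (s : seq T) :
  (1 < count p s)%N <-> exists i j, [/\ (i < j)%N, (j < size s)%N, p (nth x0 s i) & p (nth x0 s j)].
Proof.
elim: s => [|a s IH] /=; first by split=> // -[i [j []]].
case: (boolP (p a)) => pa; rewrite ?add0n ?add1n ?ltnS.
  rewrite -has_count; split=> [/(has_nthP x0) [j hj pj]|[i [[|j] [ij hj pi pj]]]] //.
    by exists 0%N, j.+1; split.
  by apply/(has_nthP x0); exists j.
rewrite IH; split=> [[i [j [ij hj pi pj]]]|[[|i] [[|j] [ij hj pi pj]]]] //.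
- by exists i.+1, j.+1; split.
- by rewrite /= (negPf pa) in pi.
- by exists i, j; split.
Qed.

Lemma uniq_map_inj (T U : eqType) (f : T -> U) (s : seq T) :
  uniq (map f s) -> {in s &, injective f}.
Proof.
elim: s => [|a s IH] //= /andP[fa us] x y; rewrite !inE.
case/orP=> [/eqP ->|xs] /orP[/eqP ->|ys] e //.
- by case/mapP: fa; exists y.
- by case/mapP: fa; exists x.
- exact: IH.
Qed.

(** * Special secants through the contact points of a conic *)

Section Secants.
Local Open Scope classical_set_scope.
Local Open Scope card_scope.
Variables (k : closedFieldType) (char5 : 5%N \in [pchar k]).
Implicit Types (M H : 'M[k]_3).
Notation frame := (frame char5).
Notation rowm := (@rowm k).
Notation matm := (@matm k).

Definition lform (c : 'rV[k]_3) : {mpoly k[3]} := \sum_i c 0 i *: 'X_i.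

Lemma lform_homog c : lform c \is 1.-homog.
Proof. by apply: rpred_sum => i _; apply/dhomogZ/homogX. Qed.

Lemma ev_lform c x : ev (lform c) x = (x *m c^T) 0 0.
Proof.
rewrite /ev raddf_sum mxE; apply: eq_bigr => i _ /=.
by rewrite mevalZ mevalXU mxE mulrC.
Qed.

Lemma lform_surj l : l \is 1.-homog -> exists c, l = lform c.
Proof.
move: l; apply: dhomog_ind => [|p q [a ->] [b ->]|a m /eqP].
- by exists 0; rewrite /lform big1 // => i _; rewrite mxE scale0r.
- exists (a + b); rewrite /lform -big_split; apply: eq_bigr => i _.
  by rewrite mxE scalerDl.
case/mdeg1P => i /eqP ->; exists (a *: delta_mx 0 i).
rewrite /lform (bigD1 i) //= !mxE !eqxx mulr1 big1 ?addr0 // => j ji.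
by rewrite !mxE (negPf ji) mulr0 scale0r.
Qed.

Definition mline M (c : 'rV[k]_3) := locus (lin (invmx M) (lform c)).

Lemma mlineP M c x : M \in unitmx -> x != 0 ->
  mline M c (pt (x *m M)) <-> (x *m c^T) 0 0 = 0.
Proof.
move=> uM x0; rewrite /mline (locus_pt (lin_homog _ (lform_homog c))) ?mul_unit_neq0 //.
by rewrite ev_lin mulmxK // ev_lform.
Qed.

Lemma is_lineP M L : M \in unitmx ->
  is_line L <-> exists2 c, c != 0 & L = mline M c.
Proof.
move=> uM; split=> [[l [hl l0 ->]]|[c c0 ->]].
  have [c cE] := lform_surj (lin_homog M hl).
  have lE : l = lin (invmx M) (lform c) by rewrite -cE lin_comp mulVmx // lin1.
  exists c; last by rewrite /mline -lE.
  apply: contraNneq l0 => c0; rewrite lE /lform c0 big1 ?raddf0 // => i _.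
  by rewrite mxE scale0r.
exists (lin (invmx M) (lform c)); split=> //; first exact/lin_homog/lform_homog.
apply: contraNneq c0 => /(congr1 (fun F => lin M F)).
rewrite lin_comp mulmxV // lin1 raddf0 => e; apply/eqP/rowP => i.
rewrite mxE; have := ev_lform c (delta_mx 0 i); rewrite e /ev meval0 -rowE => /esym.
by rewrite !mxE.
Qed.

(** In the coordinates of [M] the two points are (1, 0, 0) and (0, 0, 1), so the coefficients of x
    and z vanish and the line is y = 0. *)
Lemma two_point_line M L L' : M \in unitmx -> is_line L -> is_line L' ->
  L (pt (row o0 M)) -> L (pt (row o2 M)) -> L' (pt (row o0 M)) -> L' (pt (row o2 M)) ->
  L = L'.
Proof.
move=> uM.
have d0 (i : 'I_3) : delta_mx 0 i != 0 :> 'rV[k]_3.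
  by apply/eqP => /rowP/(_ i)/eqP; rewrite !mxE !eqxx oner_eq0.
suff h K : is_line K -> K (pt (row o0 M)) -> K (pt (row o2 M)) -> K = mline M (delta_mx 0 o1).
  by move=> hL hL' h0 h2 h0' h2'; rewrite (h L) // (h L').
case/(is_lineP _ uM) => c c0 ->; rewrite !rowE !(mlineP _ uM (d0 _)).
rewrite -!rowE !mxE => e0 e2.
have cE : c = c 0 o1 *: delta_mx 0 o1.
  by apply: row3P; rewrite !mxE /= ?mulr0 ?mulr1.
have cT : c^T = c 0 o1 *: (delta_mx 0 o1)^T by rewrite {1}cE linearZ.
have c1 : c 0 o1 != 0 by apply: contraNneq c0 => c1; rewrite cE c1 scale0r.
apply/seteqP; split=> P; have [x] := pt_surj P; have [y ->] : exists y, x = y *m M.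
- by exists (x *m invmx M); rewrite mulmxKV.
- rewrite mul_unit_neq0 // => y0 ->; rewrite !(mlineP _ uM y0) cT -scalemxAr mxE.
  by move/eqP; rewrite mulf_eq0 (negPf c1) => /eqP.
- by exists (x *m invmx M); rewrite mulmxKV.
- rewrite mul_unit_neq0 // => y0 ->; rewrite !(mlineP _ uM y0) cT -scalemxAr [in X in _ -> X]mxE.
  by move=> ->; rewrite mulr0.
Qed.

Lemma row0_vpt M : row o0 M = vpt (Some 0) *m M.
Proof. by rewrite row3_mul expr0n !scale0r scale1r !addr0. Qed.

Lemma row2_vpt M : row o2 M = vpt None *m M.
Proof. by rewrite row3_mul !scale0r scale1r !add0r. Qed.

Lemma pairsP i j : (i < 6)%N -> (j < 6)%N -> i != j -> (i, j) \in pairs.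
Proof.
move=> hi hj ij; rewrite mem_filter ij; apply/allpairsP; exists (i, j).
by rewrite !mem_iota.
Qed.

Lemma mem_pairs ij : ij \in pairs -> [/\ (ij.1 < 6)%N, (ij.2 < 6)%N & ij.1 != ij.2].
Proof.
rewrite mem_filter => /andP[ij12 /allpairsP [[i j] [hi hj e]]].
by move: hi hj ij12; rewrite e !mem_iota.
Qed.

Lemma idm_iso : isometry_up_to_scalar idm. Proof. by []. Qed.

Lemma reparam_frame H M ij : frame H M -> ij \in pairs ->
  let M' := matm (reparam ij) *m M in
  [/\ isometry_up_to_scalar (reparam ij), cset M' = cset M, pt (row o0 M') = rpt M ij.1 & pt (row o2 M') = rpt M ij.2].
Proof.
move=> fM hij M'; have uM := frame_unit fM.
have [hi hj _] := mem_pairs hij.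
have /and4P[iR hR /eqP h1 /eqP h0] := allP reparam_ok _ hij.
have rM i : (i < 6)%N -> rpt M i = mpt M (nth None (nblock idm) i).
  by move=> h; rewrite -rpt_block // ?matm_idm ?mul1mx.
split=> //.
- by rewrite -[in RHS](mul1mx M) -matm_idm; apply: (cset_eq_nblock char5).
- by rewrite row0_vpt -[vpt _]/(vpt (rparam k 1)) -[LHS]/(rpt _ 1) rpt_block // h1 rM.
- by rewrite row2_vpt -[vpt _]/(vpt (rparam k 0)) -[LHS]/(rpt _ 0) rpt_block // h0 rM.
Qed.

(** After a reparametrization the point has parameter 0, where [weierstrass_row0] applies; [j] is
    just another index to be sent to infinity. *)
Lemma cset_weierstrass H M P : frame H M -> (cset M `&` locus (hform H)) P ->
  weierstrass (hform H) P.
Proof.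
move=> fM /(cset_rpt _ fM) [i]; rewrite mem_iota => hi ->.
pose j := if i is 0%N then 1%N else 0%N.
have hij : (i, j) \in pairs by apply: pairsP => //; case: i @j {hi}.
have [iR _ <- _] := reparam_frame fM hij.
exact: weierstrass_row0 (frame_matm fM iR).
Qed.

Lemma io_dot l v : (rowm v *m (rowm l)^T) 0 0 = io k (dot l v).
Proof.
case: l v => [[a b] c] [[a' b'] c'].
by rewrite mxE sum_ord3 !mxE /= !ioD // !ioM //; ring.
Qed.

Lemma mline_rpt M N l i : M \in unitmx -> isometry_up_to_scalar N -> (i < 6)%N ->
  mline M (rowm l) (rpt (matm N *m M) i) <-> dot l (nth (q0, q0, q0) (block N) i) == q0.
Proof.
move=> uM iN hi; have [v0 _] := block_isotropic char5 iN hi.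
rewrite /rpt mulmxA mul_block // mlineP // io_dot -(io_eq0 char5).
by split=> /eqP.
Qed.

Lemma secant_line M ij : M \in unitmx -> ij \in pairs ->
  [/\ is_line (mline M (rowm (secant ij))), mline M (rowm (secant ij)) (rpt M ij.1) &
      mline M (rowm (secant ij)) (rpt M ij.2)].
Proof.
move=> uM hij; have [hi hj _] := mem_pairs hij.
have /and4P[l0 d1 d2 _] := allP secants_incident _ hij.
have rM i : rpt M i = rpt (matm idm *m M) i by rewrite matm_idm mul1mx.
split.
- apply/(is_lineP _ uM); exists (rowm (secant ij)) => //.
  apply: contra_neq l0 => e; apply: (rowm_inj char5); rewrite e.
  by apply: row3P; rewrite row3E mxE /= io0.
- by rewrite rM mline_rpt.
- by rewrite rM mline_rpt.
Qed.

Lemma line_through_rpt H M L ij : frame H M -> ij \in pairs -> is_line L ->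
  L (rpt M ij.1) -> L (rpt M ij.2) -> L = mline M (rowm (secant ij)).
Proof.
move=> fM hij hL L1 L2; have uM := frame_unit fM.
have [iR _ e0 e2] := reparam_frame fM hij.
have [hl l1 l2] := secant_line uM hij.
apply: (two_point_line (frame_unit (frame_matm fM iR))) => //; by rewrite ?e0 ?e2.
Qed.

(** Contact points are Weierstrass points, so every line joining two of them is a special secant,
    and these lines are given by cross products. *)
Lemma secants_ofP H M L : frame H M ->
  secants_of (hform H) (cset M) L <-> exists2 l, l \in secants & L = mline M (rowm l).
Proof.
move=> fM; have uM := frame_unit fM.
split=> [[[hL _] [P1 [P2 [P12 h1 h2 L1 L2]]]]|[l /mapP [ij]]].
  have [i] := proj1 (cset_rpt _ fM) h1; rewrite mem_iota => hi P1E.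
  have [j] := proj1 (cset_rpt _ fM) h2; rewrite mem_iota => hj P2E.
  have ij : i != j by apply: contra_notN P12 => /eqP e; rewrite P1E P2E e.
  wlog lt : i j P1 P2 P12 h1 h2 L1 L2 hi hj P1E P2E ij / (i < j)%N.
    move=> W; have [lt|lt|e] := ltngtP i j; last by rewrite e eqxx in ij.
      exact: (W i j P1 P2).
    by apply: (W j i P2 P1); rewrite 1?eq_sym //; apply: nesym.
  have hij := pairsP hi hj ij; exists (secant (i, j)).
    by apply: map_f; rewrite mem_filter lt.
  by apply: (line_through_rpt fM hij) => //=; rewrite -?P1E -?P2E.
rewrite mem_filter => /andP[lt hij] -> ->.
have [hi hj ij12] := mem_pairs hij.
have [hl l1 l2] := secant_line uM hij.
have P12 : rpt M ij.1 <> rpt M ij.2.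
  by move/(rpt_inj char5 uM); rewrite !mem_iota => /(_ hi hj) /eqP; rewrite (negPf ij12).
have h1 : (cset M `&` locus (hform H)) (rpt M ij.1).
  by apply/(cset_rpt _ fM); exists ij.1; rewrite ?mem_iota.
have h2 : (cset M `&` locus (hform H)) (rpt M ij.2).
  by apply/(cset_rpt _ fM); exists ij.2; rewrite ?mem_iota.
split; last by exists (rpt M ij.1), (rpt M ij.2).
split=> //; exists (rpt M ij.1), (rpt M ij.2); split=> //; exact: cset_weierstrass fM _.
Qed.

Lemma joins_two_mline H M N l : frame H M -> isometry_up_to_scalar N ->
  joins_two (cset (matm N *m M) `&` locus (hform H)) (mline M (rowm l)) <->
  (1 < count (fun v => dot l v == q0) (block N))%N.
Proof.
move=> fM iN; have uM := frame_unit fM; have fN := frame_matm fM iN.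
rewrite (count_gt1P (q0, q0, q0)); split=> [[P1 [P2 [P12 h1 h2 L1 L2]]]|[i [j [ij hj di dj]]]].
  have [i] := proj1 (cset_rpt _ fN) h1; rewrite mem_iota => hi P1E.
  have [j] := proj1 (cset_rpt _ fN) h2; rewrite mem_iota => hj P2E.
  move: L1 L2; rewrite P1E P2E !mline_rpt // => di dj.
  case: (ltngtP i j) => ij; [by exists i, j; split|by exists j, i; split|].
  by case: P12; rewrite P1E P2E ij.
have hi : (i < 6)%N := ltn_trans ij hj.
exists (rpt (matm N *m M) i), (rpt (matm N *m M) j); split.
- move/(rpt_inj char5 (frame_unit fN)); rewrite !mem_iota => /(_ hi hj) e.
  by move: ij; rewrite e ltnn.
- by apply/(cset_rpt _ fN); exists i; rewrite ?mem_iota.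
- by apply/(cset_rpt _ fN); exists j; rewrite ?mem_iota.
- by rewrite mline_rpt.
- by rewrite mline_rpt.
Qed.

Lemma mline_secant_inj M : M \in unitmx ->
  {in secants &, injective (fun l => mline M (rowm l))}.
Proof.
move=> uM l l' hl hl' e; apply: (uniq_map_inj secants_separated hl hl').
have bE : block idm = veronese by [].
apply: (@eq_from_nth _ false); rewrite ?size_map // => i hi.
rewrite !(nth_map (q0, q0, q0)) // -bE.
have e' : mline M (rowm l) (rpt (matm idm *m M) i) = mline M (rowm l') (rpt (matm idm *m M) i).
  by rewrite e.
apply/idP/idP => /(mline_rpt _ uM idm_iso hi) h; apply/(mline_rpt _ uM idm_iso hi).
  by rewrite -e'.
by rewrite e'.
Qed.

Lemma card_common_secants H M N : frame H M -> isometry_up_to_scalar N ->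
  secants_of (hform H) (cset M) `&` secants_of (hform H) (cset (matm N *m M)) #=
  `I_(common_secants N).
Proof.
move=> fM iN; have uM := frame_unit fM.
rewrite /common_secants -size_filter.
apply: (card_image_seq (f := fun l => mline M (rowm l))).
- by apply: filter_uniq; apply: map_uniq secants_separated.
- move=> l l'; rewrite !mem_filter => /andP[_ hl] /andP[_ hl'].
  exact: mline_secant_inj.
move=> L; split=> [[/(secants_ofP _ fM) [l hl ->] [_ /(joins_two_mline _ fM iN) h]]|].
  by exists l; rewrite // mem_filter h.
move=> [l]; rewrite mem_filter => /andP[h hl] ->.
have hQ : secants_of (hform H) (cset M) (mline M (rowm l)).
  by apply/(secants_ofP _ fM); exists l.
by split=> //; split; [case: hQ|apply/(joins_two_mline _ fM iN)].
Qed.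

End Secants.

(** * Common points of two conics sharing a secant *)

Section Adjacency.
Local Open Scope classical_set_scope.
Local Open Scope card_scope.
Variables (k : closedFieldType) (char5 : 5%N \in [pchar k]).
Implicit Types (M H : 'M[k]_3).
Notation frame := (frame char5).
Notation rowm := (@rowm k).
Notation matm := (@matm k).
Notation io := (io k).

Lemma frame_form_unit H M : frame H M -> H \in unitmx.
Proof.
move=> [l l0 e]; have : M *m H *m ctr char5 M \in unitmx.
  by rewrite e unitmxZ ?unitfE // (stdH_unit char5).
by rewrite !unitmx_mul => /andP[/andP[]].
Qed.

Lemma csetZ c M : c != 0 -> M \in unitmx -> cset (c *: M) = cset M.
Proof.
move=> c0 uM; apply/seteqP; split=> P [o ->]; exists o;
by rewrite -scalemxAr ptZ // vptM_neq0.
Qed.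

Lemma rptZ c M i : c != 0 -> M \in unitmx -> rpt (c *: M) i = rpt M i.
Proof. by move=> c0 uM; rewrite /rpt -scalemxAr ptZ // vptM_neq0. Qed.

Lemma cset_pt M x : M \in unitmx -> x != 0 ->
  cset M (pt (x *m M)) <-> x 0 o0 * x 0 o2 = x 0 o1 ^+ 2.
Proof.
move=> uM x0; rewrite -locus_conic_eq // (locus_pt (conic_eq_homog M)) ?mul_unit_neq0 //.
rewrite ev_lin mulmxK // ev_conic_form; split=> [/eqP|->]; last by rewrite subrr.
by rewrite subr_eq0 => /eqP.
Qed.

(** Such an [N] sends (1, s, s^2) to (x0 + s^2 z0, s y, x2 + s^2 z2), so x z - y^2 becomes even in
    s. Infinity is a common point exactly when the coefficient of s^4 is zero. *)
Lemma cset_even_quartic M x0 x2 y z0 z2 o :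
  let N : mat := ((x0, q0, x2), (q0, y, q0), (z0, q0, z2)) in
  let: (A, B, C) := even_quartic x0 x2 y z0 z2 in
  M \in unitmx -> isometry_up_to_scalar N ->
  cset M (pt (vpt o *m (matm N *m M))) <->
  if o is Some s then io A + io B * s ^+ 2 + io C * s ^+ 4 = 0 else io C = 0.
Proof.
move=> N uM iN; rewrite mulmxA cset_pt // ?vptM_neq0 ?(matm_unit char5) //.
rewrite !(ioD, ioM, ioN) //.
have -> : vpt o *m matm N = if o is Some s
    then row3 (io x0 + s ^+ 2 * io z0) (s * io y) (io x2 + s ^+ 2 * io z2)
    else row3 (io z0) 0 (io z2).
  by case: o => [s|]; rewrite mul_mat3; apply: row3P; rewrite !mxE /= ?io0; ring.
case: o => [s|]; rewrite !row3E; last by rewrite expr0n.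
set lhs := (X in X = _ <-> _); set rhs := (X in _ = X <-> _).
have -> : io x0 * io x2 + (io x0 * io z2 + io x2 * io z0 - io y * io y) * s ^+ 2 +
    io z0 * io z2 * s ^+ 4 = lhs - rhs by rewrite /lhs /rhs; ring.
by split=> [->|/eqP]; [rewrite subrr|rewrite subr_eq0 => /eqP].
Qed.

Lemma card4_distinct (T : Type) (A : set T) : A #= `I_4 ->
  exists x y z, [/\ A x, A y & A z] /\ [/\ x <> y, x <> z & y <> z].
Proof.
case/eq_cardSP => x Ax /eq_cardSP [y [Ay yx] /eq_cardSP [z [[Az zx] zy] _]].
by exists x, y, z; split; split=> //; apply/nesym.
Qed.

(** In the first case only the parameters 0 and infinity remain. In the second, C = 0 forces B = 0
    and leaves at most infinity, while C != 0 gives 2 C s^2 = -B, hence at most two values. Three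
    distinct common points are already a contradiction. *)
Lemma even_quartic_degenerate M x0 x2 y z0 z2 :
  let N : mat := ((x0, q0, x2), (q0, y, q0), (z0, q0, z2)) in
  let: (A, B, C) := even_quartic x0 x2 y z0 z2 in
  M \in unitmx -> isometry_up_to_scalar N ->
  [&& A == q0, C == q0 & B != q0] ||
  ((A != q0) && (qmul B B == qmul (f4, f0) (qmul A C))) ->
  ~ (cset M `&` cset (matm N *m M) #= `I_4).
Proof.
move=> N; case E : (even_quartic x0 x2 y z0 z2) => [[A B] C] uM iN hABC.
case/card4_distinct => P1 [P2 [P3 [[[h1 [o1' e1]] [h2 [o2' e2]] [h3 [o3' e3]]] [n12 n13 n23]]]].
have ev o : cset M (pt (vpt o *m (matm N *m M))) ->
    if o is Some s then io A + io B * s ^+ 2 + io C * s ^+ 4 = 0 else io C = 0.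
  by have := cset_even_quartic (M := M) (x0 := x0) (x2 := x2) (y := y) (z0 := z0) (z2 := z2) o;
     rewrite E => /(_ uM iN) ->.
have {}n12 : o1' <> o2' by move=> e; apply: n12; rewrite e1 e2 e.
have {}n13 : o1' <> o3' by move=> e; apply: n13; rewrite e1 e3 e.
have {}n23 : o2' <> o3' by move=> e; apply: n23; rewrite e2 e3 e.
rewrite e1 in h1; rewrite e2 in h2; rewrite e3 in h3.
move: (ev _ h1) (ev _ h2) (ev _ h3) n12 n13 n23.
move: hABC => /orP[/and3P[/eqP -> /eqP -> B0]|/andP[A0 /eqP BB]].
  have z s : io q0 + io B * s ^+ 2 + io q0 * s ^+ 4 = 0 -> s = 0.
    rewrite io0 mul0r addr0 add0r => /eqP.
    by rewrite mulf_eq0 io_eq0 // (negPf B0) sqrf_eq0 => /eqP.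
  clear h1 h2 h3 e1 e2 e3.
  by move: o1' o2' o3' => [s1|] [s2|] [s3|] // => [/z -> /z ->|/z -> /z ->|/z -> _ /z ->|_ /z -> /z ->].
have A0' : io A != 0 by rewrite io_eq0.
have BB' : io B ^+ 2 = 4%:R * (io A * io C).
  by rewrite expr2 -!ioM // BB ioM // io_F5.
have [C0|C0] := eqVneq (io C) 0.
  have B0 : io B = 0 by apply/eqP; rewrite -sqrf_eq0 BB' C0 !mulr0.
  have z s : io A + io B * s ^+ 2 + io C * s ^+ 4 <> 0.
    by rewrite C0 B0 !mul0r !addr0; apply/eqP.
  clear h1 h2 h3 e1 e2 e3.
  by move: o1' o2' o3' => [s1|] [s2|] [s3|] g1 g2 g3 n12 n13 n23;
    first [by case: (z _ g1) | by case: (z _ g2) | by case: (z _ g3) | by case: n12].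
have C0' : io C <> 0 by apply/eqP.
clear h1 h2 h3 e1 e2 e3; move: o1' o2' o3' => [s1|] [s2|] [s3|] // g1 g2 g3 n12 n13 n23.
have z s : io A + io B * s ^+ 2 + io C * s ^+ 4 = 0 -> 2%:R * io C * s ^+ 2 = - io B.
  move=> h; apply/eqP; rewrite -addr_eq0 -sqrf_eq0; apply/eqP.
  transitivity (4%:R * io C * (io A + io B * s ^+ 2 + io C * s ^+ 4) +
     (io B ^+ 2 - 4%:R * (io A * io C))); first by ring.
  by rewrite h mulr0 add0r BB' subrr.
have sq s t : io A + io B * s ^+ 2 + io C * s ^+ 4 = 0 ->
    io A + io B * t ^+ 2 + io C * t ^+ 4 = 0 -> s <> t -> s = - t.
  move=> hs ht st; have : s ^+ 2 == t ^+ 2.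
    have C2 : 2%:R * io C != 0 by rewrite mulf_neq0 // (two_neq0 char5).
    by apply/eqP/(mulfI C2); rewrite (z s hs) (z t ht).
  by rewrite eqf_sqr => /orP[] /eqP.
(* [s1] is opposite to both [s2] and [s3], which therefore coincide. *)
apply: n23; congr Some; apply: oppr_inj.
rewrite -(sq s1 s2) // -1?(sq s1 s3) // => e; [apply: n13|apply: n12]; by rewrite e.
Qed.

(** The middle row is orthogonal to the other two, which span the plane y = 0, and so is (0, 1, 0).
    Hence the coordinates [u] of (0, 1, 0) in the rows of [N] are zero except the middle one. *)
Lemma even_isometry (x0 x2 z0 z2 : F25) r1 :
  let N : mat := ((x0, q0, x2), r1, (z0, q0, z2)) in
  isometry_up_to_scalar N -> exists y, r1 = (q0, y, q0).
Proof.
move=> N iN; have fN := proj1 (isometryP char5 N) iN.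
have uN := frame_unit fN; have [l l0 e] := fN.
have [u uE] : exists u : 'rV[k]_3, delta_mx 0 o1 = u *m matm N.
  by exists (delta_mx 0 o1 *m invmx (matm N)); rewrite mulmxKV.
have : delta_mx 0 o1 *m stdH k *m ctr char5 (matm N) = l *: (u *m stdH k).
  by rewrite uE -(mulmxA u) -(mulmxA u) e -scalemxAr.
rewrite !mul_stdH => /rowP h; have h0 := h o0; have h2 := h o2.
have ce (X : 'M[k]_3) (v : 'rV[k]_3) j : (v *m ctr char5 X) 0 j =
    v 0 o0 * X j o0 ^+ 5 + v 0 o1 * X j o1 ^+ 5 + v 0 o2 * X j o2 ^+ 5.
  by rewrite mxE sum_ord3 !mxE.
have de (j : 'I_3) : (delta_mx 0 o1 : 'rV[k]_3) 0 j = (j == o1)%:R by rewrite mxE.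
have sE (v : 'rV[k]_3) j : (l *: v) 0 j = l * v 0 j by rewrite mxE.
rewrite !ce sE !row3E !de !mat3E !row3E /= io0 ?expr0n /= !(mulr0, mul0r, addr0) in h0.
rewrite !ce sE !row3E !de !mat3E !row3E /= io0 ?expr0n /= !(mulr0, mul0r, addr0) in h2.
have u2 : u 0 o2 = 0 by apply: (mulfI l0); rewrite -h0 mulr0.
have u0 : u 0 o0 = 0 by apply: (mulfI l0); rewrite -h2 mulr0.
move: uE; rewrite mul_mat3 u0 u2 !scale0r add0r addr0 => uE.
case: r1 @N iN fN uN e uE h h0 h2 => [[a b] c] N iN fN uN e uE h h0 h2.
exists b; move/rowP: uE => uE; move: (uE o0) (uE o1) (uE o2); rewrite !mxE /= => ea eb ec.
have u1 : u 0 o1 != 0 by apply: contra_eq_neq eb => ->; rewrite mul0r oner_eq0.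
have z t : 0 = u 0 o1 * io t -> t = q0.
  by move/esym/eqP; rewrite mulf_eq0 (negPf u1) io_eq0 // => /eqP.
by rewrite (z a ea) (z c ec).
Qed.

End Adjacency.

Section Components.
Local Open Scope classical_set_scope.
Local Open Scope card_scope.
Variables (k : closedFieldType) (char5 : 5%N \in [pchar k]).
Implicit Types (M H : 'M[k]_3).
Notation frame := (frame char5).
Notation rowm := (@rowm k).
Notation matm := (@matm k).
Notation io := (io k).

Lemma rowm0_matm (N : mat) M : row o0 (matm N *m M) = rowm N.1.1 *m M.
Proof. by rewrite row_mul row_mat3. Qed.

Lemma rowm2_matm (N : mat) M : row o2 (matm N *m M) = rowm N.2 *m M.
Proof. by rewrite row_mul row_mat3. Qed.

Lemma rpt_row M : (rpt M 1 = pt (row o0 M)) * (rpt M 0 = pt (row o2 M)).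
Proof. by rewrite row0_vpt row2_vpt. Qed.

(** Choose one common secant and make it y = 0 by reparametrizing the first conic. The second conic
    has a frame whose points 0 and infinity are its own two contact points on that line, so rows 0
    and 2 of the transition matrix have middle entry 0. The matrix then falls under
    [adjacent_candidates]. *)
Lemma adjacent_step H M Q' : frame H M -> adjacent (hform H) (cset M) Q' ->
  exists K ij, [/\ K \in [:: K1; K2], ij \in pairs &
    Q' = cset (matm (mmul K (reparam ij)) *m M)].
Proof.
move=> fM [TQ TQ' _ c4 c3].
have /eq_cardSP [L [hL [_ [P1 [P2 [P12 h1 h2 L1 L2]]]]] _] := c3.
have [l /mapP [ij]] := proj1 (secants_ofP _ fM) hL; rewrite mem_filter => /andP[_ hij] -> {l} LE.
have uM := frame_unit fM; have uH := frame_form_unit fM.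
have [iR cR r0 r2] := reparam_frame fM hij.
set M1 := matm (reparam ij) *m M in cR r0 r2.
have fM1 : frame H M1 by apply: frame_matm.
have uM1 := frame_unit fM1.
have [M' [fM' QE P1E P2E]] := tangent_conic_frame char5 uH TQ' h1 h2 P12.
have [N [c [o [c0 iN No ME]]]] := rational_frame_canon fM1 fM'.
have uN1 : matm N *m M1 \in unitmx by apply: frame_unit (frame_matm fM1 iN).
rewrite ME csetZ // in QE; rewrite ME rptZ // in P1E; rewrite ME rptZ // in P2E.
have lineL : L = mline M1 (delta_mx 0 o1).
  have d1 : delta_mx 0 o1 != 0 :> 'rV[k]_3.
    by apply/eqP => /rowP/(_ o1)/eqP; rewrite !mxE !eqxx oner_eq0.
  have [l0 l1 l2] := secant_line char5 uM hij.
  apply: (two_point_line uM1).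
  - by rewrite LE.
  - apply/(is_lineP _ uM1); exact: (ex_intro2 _ _ (delta_mx 0 o1) d1 erefl).
  - by rewrite r0 LE.
  - by rewrite r2 LE.
  - rewrite row0_vpt; apply/(mlineP _ uM1 (vpt_neq0 _)).
    by rewrite mxE sum_ord3 !mxE /= !(mulr0, mulr1, addr0).
  - rewrite row2_vpt; apply/(mlineP _ uM1 (vpt_neq0 _)).
    by rewrite mxE sum_ord3 !mxE /= !(mulr0, mulr1, addr0, mul0r).
have mid (v : vec) : rowm v != 0 -> L (pt (rowm v *m M1)) -> v.1.2 = q0.
  move=> v0; rewrite lineL => /(mlineP _ uM1 v0).
  rewrite mxE sum_ord3 !mxE /= !(mulr0, mulr1, addr0, add0r) => /eqP.
  by rewrite io_eq0 // => /eqP.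
have n0 : rowm N.1.1 != 0.
  by rewrite -(mul_unit_neq0 _ uM1) -rowm0_matm row0_vpt vptM_neq0.
have n2 : rowm N.2 != 0 by rewrite No rowm_canv_neq0.
have m0 : N.1.1.1.2 = q0 by apply: mid; rewrite // -rowm0_matm -(rpt_row _).1 -P1E.
have m2 : N.2.1.2 = q0 by apply: mid; rewrite // -rowm2_matm -(rpt_row _).2 -P2E.
case: N iN No ME uN1 QE P1E P2E n0 n2 m0 m2 => [[[[x0 x1] x2] r1] [[z0 z1] z2]] iN /= No _ uN1 QE _ _ _ _ m0 m2.
rewrite {}m0 {}m2 in iN No QE.
have [y r1E] := even_isometry char5 iN; rewrite {}r1E in iN QE.
have hr0 : herm (x0, q0, x2) (x0, q0, x2) == q0.
  by case/and4P: (iN) => _ _ _ /andP[].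
have ho : o \in None :: [seq Some (a, q0) | a <- F25s].
  case: o No => [[a b]|] // [_ eb _]; rewrite inE -eb orFb.
  by apply: (map_f (fun a => Some (a, q0))); apply: mem_F25s.
have /allP/(_ x2 (mem_F25s x2)) := allP adjacent_candidates _ (mem_F25s x0).
rewrite hr0 => /allP/(_ _ ho); rewrite -No => /allP/(_ y (mem_F25s y)).
cbv beta iota zeta; rewrite iN; case E: even_quartic => [[A B] C].
have cs : common_secants ((x0, q0, x2), (q0, y, q0), (z0, q0, z2)) = 3.
  by apply: (card_II_inj (card_common_secants fM1 iN)); rewrite cR -QE.
rewrite [X in X != 3]cs /= => h.
have deg := even_quartic_degenerate char5 (M := M1) (x0 := x0) (x2 := x2) (y := y) (z0 := z0) (z2 := z2).
rewrite E in deg; have {}deg := deg uM1 iN.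
rewrite orbA in h; case/orP: h => [/deg []|]; first by rewrite cR -QE.
have Kiso K : K \in [:: K1; K2] -> isometry_up_to_scalar K by apply: (allP K_isometry).
have K1in : K1 \in [:: K1; K2] by rewrite inE eqxx.
have K2in : K2 \in [:: K1; K2] by rewrite !inE eqxx orbT.
have fin K : K \in [:: K1; K2] ->
    all (mem (nblock K)) (nblock ((x0, q0, x2), (q0, y, q0), (z0, q0, z2))) ->
    exists K ij, [/\ K \in [:: K1; K2], ij \in pairs &
      Q' = cset (matm (mmul K (reparam ij)) *m M)].
  move=> hKin hK; exists K, ij; split; [exact: hKin|exact: hij|].
  rewrite QE (matm_mmul char5) -mulmxA.
  exact: (cset_eq_nblock char5 uM1 iN (Kiso K hKin) hK).
by case/orP; [apply: fin K1in|apply: fin K2in].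
Qed.

Lemma K1_adjacent H M : frame H M -> adjacent (hform H) (cset M) (cset (matm K1 *m M)).
Proof.
move=> fM; have iK : isometry_up_to_scalar K1 by [].
have uM := frame_unit fM; have fK := frame_matm fM iK; have uK := frame_unit fK.
have cS := card_common_secants fM iK.
split; [exact: cset_totally_tangent|exact: cset_totally_tangent| | |exact: cS].
  (* A conic shares 15 secants with itself, but only three with its image under [K1]. *)
  move=> e; have := card_common_secants fM idm_iso.
  by rewrite matm_idm mul1mx {2}e => /(card_II_inj cS).
(* The parameters, on the second conic, of the four common points: 1 + 2 w, 2 + w and their
   opposites, the roots of 3 w s^4 + 2 s^2 + 3 w. *)
pose roots : seq F25 := [:: (f1, f2); (f2, f1); (f3, f4); (f4, f3)].
have ev o : cset M (pt (vpt o *m (matm K1 *m M))) <->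
    if o is Some s then exists2 r, r \in roots & s = io r else False.
  have := cset_even_quartic char5 (M := M) (x0 := q1) (x2 := (f0, f3)) (y := (f0, f1))
    (z0 := (f0, f3)) (z2 := q1) o.
  move=> /(_ uM iK) ->; case: o => [s|]; last first.
    by split=> // /eqP; rewrite io_eq0.
  pose C : F25 := (f0, f3).
  have -> : qmul (f0, f3) q1 = C by [].
  have -> : qadd (qadd (qmul q1 q1) (qmul (f0, f3) (f0, f3))) (qopp (qmul (f0, f1) (f0, f1))) =
    qopp (qmul C (qadd (qmul (f1, f2) (f1, f2)) (qmul (f2, f1) (f2, f1)))) by [].
  have -> : qmul q1 (f0, f3) = qmul C (qmul (qmul (f1, f2) (f1, f2)) (qmul (f2, f1) (f2, f1))) by [].
  have C0 : io C != 0 by rewrite io_eq0.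
  clearbody C; rewrite !(ioN, ioM, ioD) //; set r := io (f1, f2); set t := io (f2, f1).
  have -> : io C * (r * r * (t * t)) + - (io C * (r * r + t * t)) * s ^+ 2 + io C * s ^+ 4 =
    io C * ((s - r) * (s - t) * (s + t) * (s + r)) by ring.
  have rN : io (f4, f3) = - r by rewrite -ioN.
  have tN : io (f3, f4) = - t by rewrite -ioN.
  split=> [/eqP|[a]].
    rewrite !mulf_eq0 (negPf C0) /= !subr_eq0 !addr_eq0 -!orbA => /or4P[] /eqP ->.
    - by exists (f1, f2).
    - by exists (f2, f1).
    - by exists (f3, f4); rewrite ?tN.
    - by exists (f4, f3); rewrite ?rN.
  rewrite !inE => /or4P[] /eqP -> ->; rewrite ?rN ?tN -/r -/t; ring.
apply: (card_image_seq (s := roots) (f := fun r => pt (vpt (Some (io r)) *m (matm K1 *m M)))) => //.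
- by move=> r t _ _ /(vptM_inj uK) [] /(io_inj char5).
move=> P; split=> [[h [o e]]|[r hr ->]].
  by move: h; rewrite e => /ev; case: o {e} => // s [r hr ->]; exists r.
by split; [apply/ev; exists r|exists (Some (io r))].
Qed.

Lemma isometry_mmul N N' : isometry_up_to_scalar N -> isometry_up_to_scalar N' ->
  isometry_up_to_scalar (mmul N N').
Proof.
move=> /(isometryP char5) h /(isometryP char5) h'; apply/(isometryP char5).
by rewrite (matm_mmul char5); apply: frame_mul.
Qed.

(** One direction is an induction on the last step of a path, where the neighbor of a listed conic
    is listed by [W_closed]. The other follows [W_path] back to the initial conic by strong
    induction. *)
Lemma component_W H M Q : frame H M ->
  clos_refl_trans _ (adjacent (hform H)) (cset M) Q <->
  exists2 j, (j < 21)%N & Q = cset (matm (Wm j) *m M).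
Proof.
move=> fM; have uM := frame_unit fM.
have W0 : matm (Wm 0) = 1%:M by rewrite -(matm_idm k).
have stepE K ij j : matm (mmul K (reparam ij)) *m (matm (Wm j) *m M) =
    matm (mmul K (mmul (reparam ij) (Wm j))) *m M.
  by rewrite !(matm_mmul char5) !mulmxA.
split=> [/clos_rt_rtn1_iff|[j + ->]].
  elim=> [|Q1 Q2 adj _ [j hj Q1E]]; first by exists 0%N; rewrite // W0 mul1mx.
  have fj : frame H (matm (Wm j) *m M) by apply: frame_matm => //; apply: W_iso.
  rewrite Q1E in adj; have [K [ij [hK hij ->]]] := adjacent_step fj adj.
  have hj' : j \in iota 0 21 by rewrite mem_iota.
  have /allP/(_ _ hij)/allP/(_ _ hK) := allP W_closed _ hj'.
  move=> /andP[hc hmono]; rewrite stepE.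
  exists (color (head None (nblock (mmul K (mmul (reparam ij) (Wm j)))))) => //.
  have /and4P[iR _ _ _] := allP reparam_ok _ hij.
  apply: (monochrome_cset char5) => //.
  apply: isometry_mmul; first exact: (allP K_isometry).
  by apply: isometry_mmul => //; apply: W_iso.
elim/ltn_ind: j => -[_ _|j IH hj]; first by rewrite W0 mul1mx; apply: rt_refl.
have hj' : j \in iota 0 20 by rewrite mem_iota.
have := allP W_reachable _ hj'; case: (nth _ W_path j) => [[r l] i] /and3P[ij hrl hmono].
have hi : (i < 21)%N by apply: leq_trans ij _; apply: ltnW.
apply: (rt_trans _ _ _ _ _ (IH i ij hi)); apply: rt_step.
have fi : frame H (matm (Wm i) *m M) by apply: frame_matm => //; apply: W_iso.
have [iR cR _ _] := reparam_frame fi hrl.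
rewrite -cR; have := K1_adjacent (frame_matm fi iR).
have -> : matm K1 *m (matm (reparam (r, l)) *m (matm (Wm i) *m M)) =
    matm (mmul K1 (mmul (reparam (r, l)) (Wm i))) *m M.
  by rewrite -stepE (matm_mmul char5) mulmxA.
rewrite (monochrome_cset char5 uM _ hj hmono) //.
by apply: isometry_mmul => //; apply: isometry_mmul => //; apply: W_iso.
Qed.

End Components.

(** * Intersections of a conic with a component *)

Section Final.
Local Open Scope classical_set_scope.
Local Open Scope card_scope.
Variables (k : closedFieldType) (char5 : 5%N \in [pchar k]).
Implicit Types (M H : 'M[k]_3).
Notation frame := (frame char5).
Notation rowm := (@rowm k).
Notation matm := (@matm k).
Notation io := (io k).

Lemma hermitian_curve_hform (F : {mpoly k[3]}) : hermitian_curve F ->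
  exists2 H, H \in unitmx & F = hform H.
Proof.
move=> [c [g [c0 ug ->]]].
have fE : fermat6 k = hform 1%:M.
  apply: eq_bigr => i _; rewrite (bigD1 i) //= mxE eqxx scale1r -exprS big1 ?addr0 // => j ji.
  by rewrite mxE eq_sym (negPf ji) scale0r.
exists (c *: (g^T *m 1%:M *m ctr char5 g^T)).
  by rewrite unitmxZ ?unitfE // !unitmx_mul unitmx1 ctr_unit unitmx_tr ug.
have -> : linear_change g (fermat6 k) = lin g^T (fermat6 k).
  congr comp_mpoly; apply: eq_from_tnth => i; rewrite !tnth_mktuple.
  by apply: eq_bigr => j _; rewrite mxE.
rewrite fE (lin_hform char5) /hform scaler_sumr; apply: eq_bigr => i _.
by rewrite scaler_sumr; apply: eq_bigr => j _; rewrite scalerA [in RHS]mxE.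
Qed.

Lemma card6_other (T : Type) (A : set T) (a : T) : A #= `I_6 -> exists2 b, A b & a <> b.
Proof.
case/eq_cardSP => x Ax /eq_cardSP [y [Ay yx] _].
have [e|ne] := pselect (a = x); last by exists x.
by exists y => //; rewrite e; apply/nesym.
Qed.

Lemma tangent_conic_through H Q P : H \in unitmx ->
  totally_tangent_conics (hform H) Q -> (Q `&` locus (hform H)) P ->
  exists M, [/\ frame H M, Q = cset M & P = rpt M 1].
Proof.
move=> uH TQ hP; have [q [_ _ _ c6 _]] := TQ.
have [P2 hP2 n] := card6_other P c6.
by have [M [fM QE P1E _]] := tangent_conic_frame char5 uH TQ hP hP2 n; exists M.
Qed.

Lemma adjacent_sym (F : {mpoly k[3]}) Q Q' : adjacent F Q Q' -> adjacent F Q' Q.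
Proof. by move=> [h1 h2 h3 h4 h5]; split=> //; [apply/nesym|rewrite setIC|rewrite setIC]. Qed.

Lemma component_eq (F : {mpoly k[3]}) Q Q' :
  clos_refl_trans _ (adjacent F) Q Q' ->
  [set X | clos_refl_trans _ (adjacent F) Q X] = [set X | clos_refl_trans _ (adjacent F) Q' X].
Proof.
have sym X Y : clos_refl_trans _ (adjacent F) X Y -> clos_refl_trans _ (adjacent F) Y X.
  elim=> [x y h|x|x y z _ h1 _ h2]; [exact/rt_step/adjacent_sym|exact: rt_refl|].
  exact: rt_trans h2 h1.
move=> h; apply/seteqP; split=> X hX; first exact: rt_trans (sym _ _ h) hX.
exact: rt_trans h hX.
Qed.

(** A frame of [Q] differs from [M] by a matrix over F_25, so the contact point is an isotropic
    point in the coordinates of [M]; its color is the index sought. *)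
Lemma point_in_component H M Q P : frame H M -> totally_tangent_conics (hform H) Q ->
  (Q `&` locus (hform H)) P ->
  exists2 j, (j < 21)%N & (cset (matm (Wm j) *m M) `&` locus (hform H)) P.
Proof.
move=> fM TQ hP; have uM := frame_unit fM.
have [M' [fM' QE PE]] := tangent_conic_through (frame_form_unit fM) TQ hP.
have [N [c [c0 iN ME]]] := rational_frame fM fM'.
have PN : (cset (matm N *m M) `&` locus (hform H)) P.
  by rewrite QE ME csetZ // in hP; exact: frame_unit (frame_matm fM iN).
have [o ho ->] := proj1 (cset_mpt P fM iN) PN.
have [hc hoW] := isotropic_color (nblock_canv_isotropic char5 iN ho).
by exists (color o) => //; apply/(cset_mpt _ fM (W_iso hc)); exists o.
Qed.

(** Orthogonality of the middle row to (x0, 0, 0) kills its last entry, orthogonality to the last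
    row gives its first entry, and comparison of its square with the scalar of the form gives x0 =
    y^6. *)
Lemma isometry_normal_form (x0 : F25) r1 o :
  let N : mat := ((x0, q0, q0), r1, canv o) in
  isometry_up_to_scalar N ->
  exists b a1 y, y != q0 /\
    N = (((qnorm y, f0), q0, q0), (qmul q2 (qmul y (qconj b)), y, q0), ((qnorm b, a1), b, q1)).
Proof.
move=> N iN; have /and4P[l0 _ /eqP h11 /allP h] := iN.
have z c : c \in [:: herm N.1.1 N.1.1; herm N.2 N.2; herm N.1.1 N.1.2; herm N.1.2 N.1.1;
   herm N.1.2 N.2; herm N.2 N.1.2] -> c = q0 by move/h/eqP.
have ihE (u v : vec) : io (herm u v) = io u.1.1 * io v.2 ^+ 5 + io u.2 * io v.1.1 ^+ 5 +
    3%:R * (io u.1.2 * io v.1.2 ^+ 5).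
  by case: u v => [[u0 u1] u2] [[v0 v1] v2]; rewrite /= !ioD // !ioM // !io_conj // io3.
have zio u v : herm u v = q0 -> io u.1.1 * io v.2 ^+ 5 + io u.2 * io v.1.1 ^+ 5 +
    3%:R * (io u.1.2 * io v.1.2 ^+ 5) = 0 by rewrite -ihE => ->; exact: io0.
have h10 := zio _ _ (z _ (_ : herm N.1.2 N.1.1 \in _)).
have h12 := zio _ _ (z _ (_ : herm N.1.2 N.2 \in _)).
have h22 : herm N.2 N.2 = q0 by apply: z; rewrite !inE eqxx ?orbT.
move: h10 => /(_ ltac:(by rewrite !inE eqxx ?orbT)) h10.
move: h12 => /(_ ltac:(by rewrite !inE eqxx ?orbT)) h12.
move/(congr1 io): h11; rewrite ioM // io3 !ihE => h11.
move: l0; rewrite -(io_eq0 char5) ihE.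
case: r1 @N iN h z h10 h12 h22 h11 => [[x y] w] N iN h z h10 h12 h22 h11.
(* For [None], rows 0 and 2 are proportional and the scalar of the form would be zero. *)
case: o @N iN h z h10 h12 h22 h11 => [[a b]|] N iN h z h10 h12 h22 h11 /=; last first.
  by rewrite !io0 expr0n /= !(mulr0, mul0r, addr0) eqxx.
rewrite /= !io0 !io1 ?expr0n ?expr1n /= !(mulr0, mul0r, addr0, mulr1, add0r) in h10 h11 h12 * => x00.
have w0 : w = q0.
  by move/eqP: h10; rewrite mulf_eq0 expf_eq0 (negPf x00) orbF io_eq0 // => /eqP.
move: h11 h12; rewrite w0 io0 !(mul0r, mulr0, addr0, expr0n) /= add0r => h11 h12.
have x0E : x0 = (qnorm y, f0).
  have -> : (qnorm y, f0) = qmul y (qconj y) by case: (y) => [] [] [].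
  apply: (io_inj char5); rewrite ioM // io_conj //; apply/esym.
  exact: (mulfI (three_neq0 char5) h11).
have y0 : y != q0.
  by apply: contraNneq x00 => y0; rewrite x0E y0 io_eq0.
have xE : x = qmul q2 (qmul y (qconj b)).
  have io2 : io q2 = 2%:R by rewrite io_F5.
  apply: (io_inj char5); rewrite !ioM // io_conj // io2.
  apply/eqP; rewrite -subr_eq0 -[X in _ == X]h12; apply/eqP.
  by rewrite (three_mtwo char5); ring.
have aE : a = (qnorm b, a.2).
  by move: h22 => /=; case: (a) (b) => [] [] [] [[] []].
exists b, a.2, y; split=> //.
by rewrite /N /= w0 x0E xE {1}aE.
Qed.

Lemma rowm_pt_row0 (v : vec) M : M \in unitmx -> rowm v != 0 ->
  pt (rowm v *m M) = pt (row o0 M) -> v = (v.1.1, q0, q0).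
Proof.
move=> uM v0; rewrite row0_vpt => /(pt_mul_inj uM v0 (vpt_neq0 _)).
move=> /esym /(pt_eqP (vpt_neq0 _) v0) [c c0 /rowP e].
have := e o1; have := e o2; case: v {v0 e} => [[a b] d].
rewrite !mxE /= expr0n !mulr0 => /eqP; rewrite io_eq0 // => /eqP -> /eqP.
by rewrite io_eq0 // => /eqP ->.
Qed.

(** Both conics have the same point at parameter 0, so the first row of the transition matrix is a
    multiple of (1, 0, 0). *)
Lemma tangent_conic_normal_form H M Q : frame H M ->
  totally_tangent_conics (hform H) Q -> (Q `&` locus (hform H)) (rpt M 1) ->
  exists b a1 y, y != q0 /\ let N :=
      (((qnorm y, f0), q0, q0), (qmul q2 (qmul y (qconj b)), y, q0), ((qnorm b, a1), b, q1)) in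
    isometry_up_to_scalar N /\ Q = cset (matm N *m M).
Proof.
move=> fM TQ hP; have uM := frame_unit fM.
have [M' [fM' QE PE]] := tangent_conic_through (frame_form_unit fM) TQ hP.
have [N [c [o [c0 iN No ME]]]] := rational_frame_canon fM fM'.
have uN := frame_unit (frame_matm fM iN).
move: QE PE; rewrite ME csetZ // rptZ // !rpt_row rowm0_matm => QE PE.
have n0 : rowm N.1.1 != 0.
  by rewrite -(mul_unit_neq0 _ uM) -rowm0_matm row0_vpt vptM_neq0.
have r0E := rowm_pt_row0 uM n0 (esym PE).
case: N iN No QE r0E {ME PE uN n0} => [[r0 r1] r2] iN /= r2E QE r0E.
rewrite r0E r2E in iN QE.
have [b [a1 [y [y0 NE]]]] := isometry_normal_form iN.
by rewrite NE in iN QE; exists b, a1, y; split.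
Qed.

Section Intersections.
Variables (H M : 'M[k]_3) (N : mat).
Hypotheses (fM : frame H M) (iN : isometry_up_to_scalar N).

Let E j := cset (matm (Wm j) *m M).
Let cnt j := count (pred1 j) (map color (nblock N)).

(** The blocks partition the isotropic points, so the contact points shared with conic [j] are
    exactly those of color [j]. *)
Lemma card_meet_W j : (j < 21)%N ->
  cset (matm N *m M) `&` E j `&` locus (hform H) #= `I_(cnt j).
Proof.
move=> hj; have uM := frame_unit fM.
rewrite /cnt count_map -size_filter; apply: (card_image_seq (f := mpt M)).
- exact/filter_uniq/(nblock_uniq char5 iN).
- by move=> o o' _ _; apply: (mpt_inj char5 uM).
move=> P; split=> [[[h1 h2] h3]|[o]].
  have [o ho PE] := proj1 (cset_mpt P fM iN) (conj h1 h3).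
  have [o' ho' PE'] := proj1 (cset_mpt P fM (W_iso hj)) (conj h2 h3).
  exists o => //; rewrite mem_filter ho andbT /= -(W_color hj ho') PE in PE' *.
  by rewrite (mpt_inj char5 uM PE').
rewrite mem_filter /= => /andP[/eqP oj ho] ->.
have [h1 h3] := proj2 (cset_mpt (mpt M o) fM iN) (ex_intro2 _ _ o ho erefl).
have [_ hoW] := isotropic_color (nblock_canv_isotropic char5 iN ho); rewrite oj in hoW.
have [h2 _] := proj2 (cset_mpt (mpt M o) fM (W_iso hj)) (ex_intro2 _ _ o hoW erefl).
by [].
Qed.

Lemma W_cset_inj : {in iota 0 21 &, injective E}.
Proof.
move=> i j; rewrite !mem_iota => hi hj e; have uM := frame_unit fM.
have [o ho] : exists o, o \in nblock (Wm i).
  by exists (nth None (nblock (Wm i)) 0); apply: mem_nth.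
have [h1 h3] := proj2 (cset_mpt (mpt M o) fM (W_iso hi)) (ex_intro2 _ _ o ho erefl).
rewrite -/(E i) e in h1.
have [o' ho' /(mpt_inj char5 uM) oo'] := proj1 (cset_mpt _ fM (W_iso hj)) (conj h1 h3).
by rewrite -(W_color hi ho) -(W_color hj ho') oo'.
Qed.

Lemma meets_in_W m :
  meets_in (hform H) (cset (matm N *m M))
    [set Q | clos_refl_trans _ (adjacent (hform H)) (cset M) Q] m
    (count (fun j => cnt j == m) (iota 0 21)).
Proof.
rewrite /meets_in -size_filter; apply: (card_image_seq (f := E)).
- exact/filter_uniq/iota_uniq.
- move=> i j; rewrite !mem_filter => /andP[_ hi] /andP[_ hj]; exact: W_cset_inj.
move=> Q; split=> [[/(component_W _ fM) [j hj ->] hc]|[j]].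
  exists j => //; rewrite mem_filter mem_iota /= hj andbT.
  by apply/eqP/(card_II_inj (card_meet_W hj)).
rewrite mem_filter mem_iota => /andP[/eqP <- hj] ->; split; last exact: card_meet_W.
by apply/(component_W _ fM); exists j.
Qed.

End Intersections.

Lemma hform_component_patterns H Q D : H \in unitmx ->
  totally_tangent_conics (hform H) Q -> components (hform H) D -> ~ D Q ->
  [\/ meets_in (hform H) Q D 2 3 /\ meets_in (hform H) Q D 0 18,
      [/\ meets_in (hform H) Q D 2 1, meets_in (hform H) Q D 1 4 &
          meets_in (hform H) Q D 0 16] |
      meets_in (hform H) Q D 1 6 /\ meets_in (hform H) Q D 0 15].
Proof.
move=> uH TQ [Q1 TQ1 ->] DQ.
have [_ [_ _ _ c6 _]] := TQ; have /eq_cardSP [P hP _] := c6.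
have [_ [_ _ _ c61 _]] := TQ1; have /eq_cardSP [P1 hP1 _] := c61.
have [M0 [fM0 Q1E _]] := tangent_conic_through uH TQ1 hP1.
have [j hj hPj] := point_in_component fM0 TQ hP.
have fj := frame_matm fM0 (W_iso hj).
(* The member of the component through a contact point of [Q] becomes the new base conic, with that
   point at parameter 0. *)
have [M [fM WE PE]] := tangent_conic_through uH (cset_totally_tangent fj) hPj.
have path : clos_refl_trans _ (adjacent (hform H)) Q1 (cset M).
  by rewrite Q1E -WE; apply/(component_W _ fM0); exists j.
rewrite (component_eq path) in DQ *; rewrite PE in hP.
have [b [a1 [y [y0 [iN QE]]]]] := tangent_conic_normal_form fM TQ hP.
set N := (X in matm X) in QE; rewrite -/N in iN.
have mW m : meets_in (hform H) Q
    [set X | clos_refl_trans _ (adjacent (hform H)) (cset M) X] m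
    (count (pred1 m) [seq count (pred1 i) (map color (nblock N)) | i <- iota 0 21]).
  by rewrite count_map QE; apply: meets_in_W fM iN m.
have := allP color_patterns _ (mem_F25s b) => /allP/(_ a1 (mem_F5s a1))/allP/(_ y (mem_F25s y)).
rewrite (negPf y0) orFb; cbv beta zeta; rewrite -/N.
case/or4P => [/andP[/eqP e2 /eqP e0]|/and3P[/eqP e2 /eqP e1 /eqP e0]|/andP[/eqP e1 /eqP e0]|hmono].
- by constructor 1; move: (mW 2%N) (mW 0%N); rewrite e2 e0.
- by constructor 2; move: (mW 2%N) (mW 1%N) (mW 0%N); rewrite e2 e1 e0.
- by constructor 3; move: (mW 1%N) (mW 0%N); rewrite e1 e0.
(* If all six contact points have one color, [Q] itself belongs to the component. *)
exfalso; apply: DQ.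
have uM := frame_unit fM.
have ho : head None (nblock N) \in nblock N by rewrite -nth0; apply: mem_nth.
have [hc _] := isotropic_color (nblock_canv_isotropic char5 iN ho).
apply/(component_W _ fM); exists (color (head None (nblock N))) => //.
by rewrite QE; apply: (monochrome_cset char5).
Qed.

End Final.

Theorem proposition1p5 (k : closedFieldType) (char5 : 5%N \in [pchar k])
    (Gamma : {mpoly k[3]}) (Gamma_hermitian : hermitian_curve Gamma)
    (Q : set (proj_point k)) (D' : set (set (proj_point k)))
    (Q_tangent : totally_tangent_conics Gamma Q)
    (D'_component : components Gamma D') (QnotinD' : ~ D' Q) :
  [\/ meets_in Gamma Q D' 2 3 /\ meets_in Gamma Q D' 0 18,
      [/\ meets_in Gamma Q D' 2 1, meets_in Gamma Q D' 1 4 &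
          meets_in Gamma Q D' 0 16] |
      meets_in Gamma Q D' 1 6 /\ meets_in Gamma Q D' 0 15].
Proof.
have [H uH GE] := hermitian_curve_hform char5 Gamma_hermitian.
rewrite GE in Q_tangent D'_component *.
exact: (hform_component_patterns char5 uH).
Qed.
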